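(* Let $\mathcal{W}=\bigcup_{n=1}^N\mathcal{W}_n$ with $\mathcal{W}_n=\{\omega:|\omega-\overline{\omega}_n|\le W_n/2\}$ pairwise disjoint, and let $\alpha_0\ge 0$. Let $Q(z,\omega)$, with $Q(z,\cdot)\in L^2(\mathbb{R})$, be the Fourier transform of a bounded signal $q(z,t)$ propagating according to $$\frac{\partial}{\partial z}Q(z,\omega)=\left(-\frac{\alpha(\omega)}{2}+j\frac{\beta_2}{2}\omega^2\right)Q(z,\omega)+j\frac{\gamma}{4\pi^2}\int_{-\infty}^{\infty}\int_{-\infty}^{\infty}Q(z,\omega_1)Q^*(z,\omega_2)Q(z,\omega-\omega_1+\omega_2)\,d\omega_2\,d\omega_1$$ with the brick-walls attenuation profile $\alpha(\omega)=\alpha_0$ for $\omega\in\mathcal{W}$ and $\alpha(\omega)=\infty$ otherwise. Then the signal has no energy outside $\mathcal{W}$ for $z>0$: $$E_{\overline{\mathcal{W}}}(z)=0,\quad z>0,$$ where $\overline{\mathcal{W}}=\mathbb{R}\setminus\mathcal{W}$, and the signal energy satisfies $$E(z)=E_{\mathcal{W}}(0)e^{-\alpha_0 z}\quad (z>0).$$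
   Context: $z$ is distance, $\omega$ angular frequency, $t$ time; $Q(z,\omega)=\int q(z,t)e^{-j\omega t}dt$; $\beta_2,\gamma$ are real constants; ''bounded'' means $|q(z,t)|\le q_{\max}$ for some constant. For a set $\mathcal{S}\subseteq\mathbb{R}$, $E_{\mathcal{S}}(z)=\frac{1}{2\pi}\int_{\mathcal{S}}|Q(z,\omega)|^2d\omega$, and $E(z)=E_{\mathbb{R}}(z)$. The propagation with infinite attenuation outside $\mathcal{W}$ is understood as the limit $\alpha_1\to\infty$ of propagation with the finite profile $\alpha(\omega)=\alpha_0$ on $\mathcal{W}$ and $\alpha(\omega)=\alpha_1$ off $\mathcal{W}$. *)

(* Defs.v *)
From HB Require Import structures.
From mathcomp Require Import all_boot all_order all_algebra.
From mathcomp Require Import all_classical all_reals all_analysis.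
From mathcomp Require Export complex.
Import Order.TTheory GRing.Theory Num.Theory numFieldNormedType.Exports.
Set Implicit Arguments. Unset Strict Implicit. Unset Printing Implicit Defensive.
Local Open Scope classical_set_scope.
Local Open Scope ring_scope.
Local Open Scope complex_scope.

Section Defs.
Variable R : realType.
Local Notation mu := (@lebesgue_measure R).

Definition sqn (z : R[i]) : R := complex.Re z ^+ 2 + complex.Im z ^+ 2.
Definition cabs (z : R[i]) : R := Num.sqrt (sqn z).

Definition cintegrable (D : set R) (f : R -> R[i]) : Prop :=
  mu.-integrable D (fun x => (complex.Re (f x))%:E) /\
  mu.-integrable D (fun x => (complex.Im (f x))%:E).
Definition cint (D : set R) (f : R -> R[i]) : R[i] :=
  (Rintegral mu D (fun x => complex.Re (f x))) +i* (Rintegral mu D (fun x => complex.Im (f x))).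

Definition L2 (f : R -> R[i]) : Prop :=
  measurable_fun setT (fun x => complex.Re (f x)) /\
  measurable_fun setT (fun x => complex.Im (f x)) /\
  mu.-integrable setT (fun x => (sqn (f x))%:E).

Definition energy (Q : R -> R[i]) (S : set R) : \bar R :=
  ((2 * pi)^-1)%:E * (\int[mu]_(w in S) (sqn (Q w))%:E)%E.

Definition L2dist2 (f g : R -> R[i]) : \bar R :=
  (\int[mu]_(w in setT) (sqn (f w - g w))%:E)%E.

Definition cexpmi (x : R) : R[i] := (cos x) -i* (sin x).

Definition truncFT (q : R -> R[i]) (T : R) (w : R) : R[i] :=
  cint `[- T, T] (fun t => q t * cexpmi (w * t)).

(* Q is the (L^2, Plancherel) Fourier transform of q:
   Q(w) = int q(t) e^{-j w t} dt, understood as the L^2 limit of the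
   truncated transforms. *)
Definition is_FT (q Q : R -> R[i]) : Prop :=
  (forall T w, cintegrable `[- T, T] (fun t => q t * cexpmi (w * t))) /\
  (L2dist2 (truncFT q T) Q @[T --> +oo] --> 0%E).

Definition window (N : nat) (wbar Wd : 'I_N -> R) : set R :=
  \bigcup_(n in [set: 'I_N]) [set w | `|w - wbar n| <= Wd n / 2].

Definition brickwall (W : set R) (a0 a1 : R) (w : R) : R :=
  if `[< W w >] then a0 else a1.

Definition nlinner (Q : R -> R[i]) (w w1 : R) : R -> R[i] :=
  fun w2 => Q w1 * (Q w2)^* * Q (w - w1 + w2).
Definition nlterm (Q : R -> R[i]) (w : R) : R[i] :=
  cint setT (fun w1 => cint setT (nlinner Q w w1)).
Definition nl_defined (Q : R -> R[i]) (w : R) : Prop :=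
  (forall w1, cintegrable setT (nlinner Q w w1)) /\
  cintegrable setT (fun w1 => cint setT (nlinner Q w w1)).

Definition cderive (f : R -> R[i]) (z : R) (d : R[i]) : Prop :=
  is_derive z 1 (fun s => complex.Re (f s)) (complex.Re d) /\
  is_derive z 1 (fun s => complex.Im (f s)) (complex.Im d).

Definition nlse_rhs (alpha : R -> R) (b2 g : R) (Q : R -> R[i]) (w : R) : R[i] :=
  ((- alpha w / 2)%:C + 'i * (b2 / 2 * w ^+ 2)%:C) * Q w
  + 'i * (g / (4 * pi ^+ 2))%:C * nlterm Q w.

End Defs.

(* Main.v *)
(* Write [Q = Q1 + j Q2] and let [r] be the autocorrelation of [Q]; the nonlinear
   term is the convolution of [Q] with [r].  Since [Q] is the transform of a
   signal bounded by [qmax], convolution with [Q] is bounded on L2 with a norm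
   controlled by [qmax] (Bessel's inequality used twice), hence so is
   convolution with [r].  As [Re r] is even and [Im r] is odd, the nonlinear
   term conserves the energy.  The pointwise equation gives
   [d|Q|^2 = - alpha |Q|^2 + flux], which may be integrated over [w] as long as
   the energy stays bounded; local boundedness holds by a Baire-type argument,
   because the energy is finite, lower semicontinuous in [z], and nonincreasing
   wherever it is bounded.  With out-of-band attenuation [a1] the out-of-band
   energy is then O(1/a1), so the energy exchanged with the band vanishes as
   [a1 -> +oo], leaving only the decay [exp (- a0 z)] in the band. *)
Require Import Defs.
From HB Require Import structures.
From mathcomp Require Import all_boot all_order all_algebra.
From mathcomp Require Import all_classical all_reals all_analysis.
From mathcomp Require Import measurable_realfun complex lra ring.
Import Order.TTheory GRing.Theory Num.Theory numFieldNormedType.Exports.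
Set Implicit Arguments.
Unset Strict Implicit.
Unset Printing Implicit Defensive.
Local Open Scope classical_set_scope.
Local Open Scope ring_scope.

(** * Real-valued Lebesgue integrals *)

Section RealIntegral.
Context d {T : measurableType d} {R : realType}.
Variable mu : {measure set T -> \bar R}.
Implicit Types (D : set T) (f g h : T -> R).

(** Nothing is assumed about how the spectrum depends on [z] in L2: the equation holds at each fixed
    frequency, and each energy is finite without any uniformity in [z]. The bound on the signal
    compensates for this, since it controls the cubic term in L2 linearly by the energy itself, with
    a constant independent of [z] and of [a1]. Convolution estimates are proved for functions in
    both L1 and L2, where Fubini applies, and reach L2 by truncation and Fatou's lemma. Constants
    survive but need not be sharp, so a Bessel inequality with [16 * pi] stands in for Plancherel's
    identity. The energy balances carry a free factor [expR (lambda * z)]: [lambda = 0] gives the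
    decrease of the energy, [lambda = a1] its growth control backwards in [z] and the out-of-band
    decay, [lambda = a0] the in-band law. In the limit, Young's inequality with weight [k] bounds
    the exchange by [k] times the out-of-band energy plus [1 / k] times a constant; the choice
    [a1 = k ^+ 2] makes both contributions of order [1 / k]. *)

Lemma integrable_measurable D f :
  mu.-integrable D (EFin \o f) -> measurable_fun D f.
Proof. by move=> /measurable_int/measurable_EFinP. Qed.

Lemma integrable_le D f g : measurable D -> measurable_fun D f ->
  mu.-integrable D (EFin \o g) -> (forall x, D x -> `|f x| <= g x) ->
  mu.-integrable D (EFin \o f).
Proof.
move=> mD mf ig fg; apply: le_integrable ig => //; first exact/measurable_EFinP.
by move=> x Dx /=; rewrite lee_fin (le_trans (fg x Dx))// ler_norm.
Qed.

Lemma integrable_add D f g : measurable D ->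
  mu.-integrable D (EFin \o f) -> mu.-integrable D (EFin \o g) ->
  mu.-integrable D (EFin \o (fun x => f x + g x)).
Proof. by move=> mD fi gi; exact: (integrableD mD fi gi). Qed.

Lemma integrable_sub D f g : measurable D ->
  mu.-integrable D (EFin \o f) -> mu.-integrable D (EFin \o g) ->
  mu.-integrable D (EFin \o (fun x => f x - g x)).
Proof. by move=> mD fi gi; exact: (integrableB mD fi gi). Qed.

Lemma integrable_scale D (k : R) f : measurable D ->
  mu.-integrable D (EFin \o f) ->
  mu.-integrable D (EFin \o (fun x => k * f x)).
Proof. by move=> mD fi; exact: (integrableZl mD k fi). Qed.

Lemma integrable_opp D f : measurable D ->
  mu.-integrable D (EFin \o f) ->
  mu.-integrable D (EFin \o (fun x => - f x)).
Proof. by move=> mD fi; exact: (integrableN fi). Qed.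

Lemma integrable_fineK D f : measurable D -> mu.-integrable D (EFin \o f) ->
  (\int[mu]_(x in D) f x)%:E = (\int[mu]_(x in D) (f x)%:E)%E.
Proof. by move=> mD fi; rewrite /Rintegral fineK//; exact: integrable_fin_num. Qed.

Lemma Rintegral_dominated D (f_ : nat -> T -> R) f g : measurable D ->
  (forall n, measurable_fun D (f_ n)) ->
  (forall x, D x -> f_ n x @[n --> \oo] --> f x) ->
  mu.-integrable D (EFin \o g) ->
  (forall n x, D x -> `|f_ n x| <= g x) ->
  mu.-integrable D (EFin \o f) /\
  \int[mu]_(x in D) f_ n x @[n --> \oo] --> \int[mu]_(x in D) f x.
Proof.
move=> mD mf_ f_f ig f_g.
have mf : measurable_fun D f by apply: measurable_fun_cvg f_f.
have mf_E n : measurable_fun D (EFin \o f_ n) by exact/measurable_EFinP.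
have mfE : measurable_fun D (EFin \o f) by exact/measurable_EFinP.
have cvE : {ae mu, forall x, D x -> (f_ n x)%:E @[n --> \oo] --> (f x)%:E}.
  by apply: aeW => x Dx; apply: cvg_EFin; [exact: nearW|exact: f_f].
have leE : {ae mu, forall x n, D x -> (`|(f_ n x)%:E| <= (g x)%:E)%E}.
  by apply: aeW => x n Dx; rewrite lee_fin f_g.
have [fi _ cv] := dominated_convergence mD mf_E mfE cvE ig leE.
split => //; apply: fine_cvg; rewrite integrable_fineK//.
Qed.

(** The limit inherits integrability together with the bound, so that it never has to be checked
    separately; operator bounds and energies are carried to limits in this form. *)
Lemma Rintegral_fatou D (f_ : nat -> T -> R) f (C : R) : measurable D ->
  (forall n, mu.-integrable D (EFin \o f_ n)) ->
  (forall n x, D x -> 0 <= f_ n x) ->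
  (forall x, D x -> f_ n x @[n --> \oo] --> f x) ->
  (forall n, \int[mu]_(x in D) f_ n x <= C) ->
  mu.-integrable D (EFin \o f) /\ \int[mu]_(x in D) f x <= C.
Proof.
move=> mD fi f0 f_f fC.
have mf_ n : measurable_fun D (f_ n) by exact: integrable_measurable (fi n).
have mf : measurable_fun D f by apply: measurable_fun_cvg f_f.
have f0' x : D x -> 0 <= f x.
  move=> Dx; rewrite -(cvg_lim _ (f_f x Dx))//.
  by apply: limr_ge; [apply/cvg_ex; exists (f x); exact: f_f|apply: nearW => n; exact: f0].
have key : (\int[mu]_(x in D) (f x)%:E <= C%:E)%E.
  have mf_E n : measurable_fun D (EFin \o f_ n) by exact/measurable_EFinP.
  have f0E n x : D x -> (0 <= (EFin \o f_ n) x)%E by move=> Dx; rewrite lee_fin f0.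
  have := fatou mu mD mf_E f0E.
  rewrite [X in (X <= _ -> _)%E](_ : _ = \int[mu]_(x in D) (f x)%:E)%E; last first.
    apply: eq_integral => x /[!inE] Dx; apply: (cvg_limn_einf_sup _).1.
    by apply: cvg_EFin; [exact: nearW|exact: f_f].
  move=> /le_trans; apply.
  rewrite limn_einf_lim; apply: lime_le; first exact: is_cvg_einfs.
  apply: nearW => n; apply: le_trans (_ : _ <= \int[mu]_(x in D) (f_ n x)%:E)%E _.
    by apply: ereal_inf_lbound; exists n => //=.
  by rewrite -integrable_fineK// lee_fin fC.
have fint : mu.-integrable D (EFin \o f).
  apply/integrableP; split; first exact/measurable_EFinP.
  rewrite (eq_integral (EFin \o f)); last first.
    by move=> x /[!inE] Dx /=; rewrite ger0_norm ?f0'.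
  by rewrite (le_lt_trans key)// ltry.
by split => //; rewrite -lee_fin integrable_fineK.
Qed.


Lemma integrable_mul_sq D f g : measurable D ->
  measurable_fun D f -> measurable_fun D g ->
  mu.-integrable D (EFin \o (fun x => f x ^+ 2)) ->
  mu.-integrable D (EFin \o (fun x => g x ^+ 2)) ->
  mu.-integrable D (EFin \o (fun x => f x * g x)).
Proof.
move=> mD mf mg fi gi.
apply: (@integrable_le _ _ (fun x => f x ^+ 2 + g x ^+ 2)) => //.
- exact: measurable_funM.
- exact: integrable_add.
- move=> x _; rewrite normrM -(real_normK (num_real (f x))).
  rewrite -(real_normK (num_real (g x))).
  have := normr_ge0 (f x); have := normr_ge0 (g x); nra.
Qed.

Lemma cauchy_schwarz D f g : measurable D ->
  measurable_fun D f -> measurable_fun D g ->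
  mu.-integrable D (EFin \o (fun x => f x ^+ 2)) ->
  mu.-integrable D (EFin \o (fun x => g x ^+ 2)) ->
  (\int[mu]_(x in D) (f x * g x)) ^+ 2 <=
  (\int[mu]_(x in D) (f x ^+ 2)) * (\int[mu]_(x in D) (g x ^+ 2)).
Proof.
move=> mD mf mg fi gi.
have fgi := integrable_mul_sq mD mf mg fi gi.
set a := \int[mu]_(x in D) (f x * g x); set F := \int[mu]_(x in D) (f x ^+ 2).
set G := \int[mu]_(x in D) (g x ^+ 2).
have F0 : 0 <= F by apply: Rintegral_ge0 => x _; exact: sqr_ge0.
have G0 : 0 <= G by apply: Rintegral_ge0 => x _; exact: sqr_ge0.
have key s t : 0 <= s ^+ 2 * F + 2 * s * t * a + t ^+ 2 * G.
  have : 0 <= \int[mu]_(x in D) (s ^+ 2 * f x ^+ 2 + 2 * s * t * (f x * g x) + t ^+ 2 * g x ^+ 2).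
    apply: Rintegral_ge0 => x _.
    have -> : s ^+ 2 * f x ^+ 2 + 2 * s * t * (f x * g x) + t ^+ 2 * g x ^+ 2 =
      (s * f x + t * g x) ^+ 2 by ring.
    exact: sqr_ge0.
  by rewrite RintegralD ?RintegralD ?RintegralZl//;
    do ?[exact: integrable_scale|apply: integrable_add].
have [G00|Gn0] := eqVneq G 0.
  have [a0|an0] := eqVneq a 0; first by rewrite a0 G00; lra.
  (* With [G = 0] the form is affine in [t]; this value of [t] makes it equal to [-1]. *)
  have := key 1 (- (F + 1) / (2 * a)); rewrite G00 mulr0 addr0 expr1n mul1r mulr1.
  have -> : 2 * (- (F + 1) / (2 * a)) * a = - (F + 1) by field.
  lra.
have Gp : 0 < G by rewrite lt_neqAle eq_sym Gn0.
(* At [s = G], [t = - a] the form factors as [G * (G * F - a ^+ 2)]. *)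
have := key G (- a); nra.
Qed.
End RealIntegral.

(** * Reflection, translation and Fubini on the real line *)

Section Lebesgue.
Context {R : realType}.
Notation mu := (@lebesgue_measure R).
Implicit Types (f g h : R -> R).

Definition reflect_at (a : R) : measurableTypeR R -> measurableTypeR R :=
  fun x => a - x.

Lemma measurable_reflect_at (a : R) : measurable_fun setT (reflect_at a).
Proof. exact: measurable_funB. Qed.

Definition reflected_lebesgue (a : R) :
    {measure set (measurableTypeR R) -> \bar R} :=
  measure_function_pushforward__canonical__measure_function_Measure mu
    (measurable_reflect_at a).

(** By uniqueness it suffices to compare half-open intervals; the reflection moves the open end to
    the other side, which does not change the length. *)
Lemma lebesgue_measure_reflect (a : R) (A : set R) : measurable A ->
  mu A = reflected_lebesgue a A.
Proof.
move=> mA; apply: lebesgue_measure_unique => // _ [[b c] _ <-].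
rewrite /reflected_lebesgue/= /pushforward.
rewrite (_ : _ @^-1` _ = `[a - c, a - b[%classic); last first.
  apply/seteqP; split => x /=; rewrite /reflect_at/= !in_itv/= => /andP[? ?];
    apply/andP; split; lra.
rewrite !lebesgue_measure_itv/= !lte_fin ltrD2l ltrN2; case: ifPn => // _.
by rewrite -!EFinB; congr (_%:E); ring.
Qed.

Lemma integrable_reflect (a : R) f : mu.-integrable setT (EFin \o f) ->
  mu.-integrable setT (EFin \o (fun x => f (a - x))).
Proof.
move=> /integrableP[mf fi]; apply/integrableP; split.
  exact: (measurableT_comp mf (measurable_reflect_at a)).
move: fi; rewrite (eq_measure_integral (reflected_lebesgue a)); last first.
  by move=> A mA _; exact: lebesgue_measure_reflect.
rewrite (ge0_integral_pushforward (measurable_reflect_at a))//.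
exact: measurableT_comp.
Qed.

Lemma Rintegral_reflect (a : R) f : mu.-integrable setT (EFin \o f) ->
  \int[mu]_x f (a - x) = \int[mu]_x f x.
Proof.
move=> fi; apply/esym; rewrite /Rintegral.
rewrite (eq_measure_integral (reflected_lebesgue a)); last first.
  by move=> A mA _; exact: lebesgue_measure_reflect.
rewrite (integral_pushforward (measurable_reflect_at a))//.
  exact: (measurable_int _ fi).
exact: integrable_reflect.
Qed.

(** A translation is the composite of two reflections, so one change of variables serves for
    both. *)
Lemma integrable_shift (a : R) f : mu.-integrable setT (EFin \o f) ->
  mu.-integrable setT (EFin \o (fun x => f (a + x))).
Proof.
move=> /(@integrable_reflect a)/(@integrable_reflect 0).
by under eq_fun => x do rewrite /= sub0r opprK.
Qed.

Lemma Rintegral_shift (a : R) f : mu.-integrable setT (EFin \o f) ->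
  \int[mu]_x f (a + x) = \int[mu]_x f x.
Proof.
move=> fi; rewrite -(Rintegral_reflect a fi) -(Rintegral_reflect 0 (integrable_reflect a fi)).
by apply: eq_Rintegral => x _; rewrite sub0r opprK.
Qed.

(** Tonelli treats the positive and negative parts separately and [fine] is measurable, so the
    integral may even diverge for some [x]. *)
Lemma measurable_Rintegral_param (F : R * R -> R) : measurable_fun setT F ->
  measurable_fun setT (fun x => \int[mu]_y F (x, y)).
Proof.
move=> mF; rewrite /Rintegral.
have mF' : measurable_fun setT (EFin \o F) by exact/measurable_EFinP.
apply: (@measurableT_comp _ _ _ _ _ _ (@fine R) _ (fun x => \int[mu]_y (F (x, y))%:E)%E) => //.
under eq_fun => x do rewrite integralE.
have mp := measurable_funepos mF'; have mn := measurable_funeneg mF'.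
apply: emeasurable_funB.
- rewrite [X in measurable_fun _ X](_ : _ = fubini_F mu ((EFin \o F)^\+)%E).
    exact: measurable_fun_fubini_tonelli_F.
  by apply/funext => x; apply: eq_integral => y _; rewrite !funeposE.
- rewrite [X in measurable_fun _ X](_ : _ = fubini_F mu ((EFin \o F)^\-)%E).
    exact: measurable_fun_fubini_tonelli_F.
  by apply/funext => x; apply: eq_integral => y _; rewrite !funenegE.
Qed.

Lemma fubini_lty (F : R * R -> R) : measurable_fun setT F ->
  (forall x, mu.-integrable setT (EFin \o (fun y => F (x, y)))) ->
  mu.-integrable setT (EFin \o (fun x => \int[mu]_y `|F (x, y)|)) ->
  (\int[mu]_x \int[mu]_y `|(F (x, y))%:E| < +oo)%E.
Proof.
move=> mF F1 F12; have /integrableP[_] := F12; apply: le_lt_trans.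
apply: ge0_le_integral => //.
- by move=> x _; exact: integral_ge0.
- have mA : measurable_fun setT (abse \o (EFin \o F)).
    by apply: measurableT_comp => //; exact/measurable_EFinP.
  have abs0 (z : R * R) : (0 <= (abse \o (EFin \o F)) z)%E by exact: abse_ge0.
  exact: (@measurable_fun_fubini_tonelli_F _ _ (measurableTypeR R)
    (measurableTypeR R) R mu (abse \o (EFin \o F)) mA abs0).
- apply: measurableT_comp => //; apply/measurable_EFinP.
  exact: integrable_measurable F12.
move=> x _ /=.
rewrite -(@integrable_fineK _ _ _ mu setT (fun y => `|F (x, y)|))//; last exact: integrable_norm.
by rewrite lee_fin ler_norm.
Qed.

(** Integrability of all sections, and not just of almost all, lets each real inner integral be
    identified pointwise with its extended value. *)
Lemma Rintegral_fubini (F : R * R -> R) : measurable_fun setT F ->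
  (forall x, mu.-integrable setT (EFin \o (fun y => F (x, y)))) ->
  (forall y, mu.-integrable setT (EFin \o (fun x => F (x, y)))) ->
  mu.-integrable setT (EFin \o (fun x => \int[mu]_y `|F (x, y)|)) ->
  \int[mu]_x (\int[mu]_y F (x, y)) = \int[mu]_y (\int[mu]_x F (x, y)).
Proof.
move=> mF F1 F2 F12; rewrite {1}/Rintegral [RHS]/Rintegral; congr fine.
under eq_integral => x _ do rewrite integrable_fineK//.
under [RHS]eq_integral => x _ do rewrite integrable_fineK//.
apply: (@Fubini _ _ _ _ _ mu mu (EFin \o F)).
apply/integrable12ltyP; first exact/measurable_EFinP.
exact: fubini_lty.
Qed.

Lemma integrable_fubini (F : R * R -> R) : measurable_fun setT F ->
  (forall x, mu.-integrable setT (EFin \o (fun y => F (x, y)))) ->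
  (forall y, mu.-integrable setT (EFin \o (fun x => F (x, y)))) ->
  mu.-integrable setT (EFin \o (fun x => \int[mu]_y `|F (x, y)|)) ->
  mu.-integrable setT (EFin \o (fun y => \int[mu]_x F (x, y))).
Proof.
move=> mF F1 F2 F12.
(* The variables are swapped so that the first marginal of [F'] is the wanted integral over [x]. *)
pose F' : measurableTypeR R * measurableTypeR R -> \bar R :=
  fun z => (F (z.2, z.1))%:E.
have mF' : measurable_fun setT F'.
  by apply/measurable_EFinP; apply: (measurableT_comp mF); exact: measurable_swap.
have iF' : (mu \x mu)%E.-integrable setT F'.
  apply/(@integrable21ltyP _ _ (measurableTypeR R) (measurableTypeR R) R mu mu F') => //.
  exact: fubini_lty.
have := integrable_fubini_F iF'.
congr (_.-integrable _ _); apply/funext => y /=.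
by rewrite integrable_fineK.
Qed.

End Lebesgue.

(** * Convolution and correlation on L2 *)

Section L2Convolution.
Context {R : realType}.
Notation mu := (@lebesgue_measure R).
Implicit Types (f g h : R -> R).

Definition sqint f := measurable_fun setT f /\
  mu.-integrable setT (EFin \o (fun x => f x ^+ 2)).

Definition nsq f : R := \int[mu]_x (f x ^+ 2).

Definition conv f g (w : R) : R := \int[mu]_x (f x * g (w - x)).

Definition corr f g (v : R) : R := \int[mu]_x (f x * g (v + x)).

Lemma nsq_ge0 f : 0 <= nsq f.
Proof. by apply: Rintegral_ge0 => x _; exact: sqr_ge0. Qed.

Lemma sqint_mul f g : sqint f -> sqint g ->
  mu.-integrable setT (EFin \o (fun x => f x * g x)).
Proof. by move=> [mf fi] [mg gi]; exact: integrable_mul_sq. Qed.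

Lemma sqint_cauchy_schwarz f g : sqint f -> sqint g ->
  (\int[mu]_x (f x * g x)) ^+ 2 <= nsq f * nsq g.
Proof. by move=> [mf fi] [mg gi]; exact: cauchy_schwarz. Qed.

Lemma sqint_reflect (a : R) f : sqint f -> sqint (fun x => f (a - x)).
Proof.
move=> [mf fi]; split; last exact: integrable_reflect fi.
exact: (measurableT_comp mf (measurable_reflect_at a)).
Qed.

Lemma nsq_reflect (a : R) f : sqint f -> nsq (fun x => f (a - x)) = nsq f.
Proof. by move=> [mf fi]; exact: (Rintegral_reflect a fi). Qed.

Lemma sqint_shift (a : R) f : sqint f -> sqint (fun x => f (a + x)).
Proof.
move=> [mf fi]; split; last exact: integrable_shift fi.
by apply: (measurableT_comp mf); exact: measurable_funD.
Qed.

Lemma nsq_shift (a : R) f : sqint f -> nsq (fun x => f (a + x)) = nsq f.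
Proof. by move=> [mf fi]; exact: (Rintegral_shift a fi). Qed.

Lemma sqint_add f g : sqint f -> sqint g -> sqint (fun x => f x + g x).
Proof.
move=> [mf fi] [mg gi]; split; first exact: measurable_funD.
apply: (@integrable_le _ (measurableTypeR R) _ mu _ _ (fun x => 2 * (f x ^+ 2 + g x ^+ 2))) => //.
- by apply: measurable_funX; exact: measurable_funD.
- by apply: integrable_scale => //; exact: integrable_add.
- by move=> x _; rewrite ger0_norm ?sqr_ge0//; have := sqr_ge0 (f x - g x); nra.
Qed.

Lemma sqint_scale (k : R) f : sqint f -> sqint (fun x => k * f x).
Proof.
move=> [mf fi]; split; first exact: measurable_funM.
by under eq_fun do rewrite exprMn; exact: integrable_scale.
Qed.

Lemma nsq_scale (k : R) f : sqint f -> nsq (fun x => k * f x) = k ^+ 2 * nsq f.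
Proof.
move=> [mf fi]; rewrite /nsq -RintegralZl//.
by apply: eq_Rintegral => x _; rewrite exprMn.
Qed.

Lemma sqint_sub f g : sqint f -> sqint g -> sqint (fun x => f x - g x).
Proof.
move=> sf sg; have := sqint_add sf (sqint_scale (-1) sg).
by under eq_fun do rewrite mulN1r.
Qed.

Lemma sqint_dominated f g : measurable_fun setT f -> sqint g ->
  (forall x, `|f x| <= `|g x|) -> sqint f.
Proof.
move=> mf [mg gi] fg; split => //.
apply: (integrable_le _ _ gi) => //; first exact: measurable_funX.
move=> x _; rewrite normrX -[g x ^+ 2]ger0_norm ?sqr_ge0// normrX.
by rewrite ler_pXn2r ?nnegrE.
Qed.

Lemma nsq_le f g : sqint f -> sqint g -> (forall x, `|f x| <= `|g x|) ->
  nsq f <= nsq g.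
Proof.
move=> [mf fi] [mg gi] fg; apply: le_Rintegral => // x _.
by rewrite -[f x ^+ 2]ger0_norm ?sqr_ge0// -[g x ^+ 2]ger0_norm ?sqr_ge0// !normrX
  ler_pXn2r ?nnegrE.
Qed.

Lemma nsq_add_le f g : sqint f -> sqint g ->
  nsq (fun x => f x + g x) <= 2 * (nsq f + nsq g).
Proof.
move=> sf sg; have [mf fi] := sf; have [mg gi] := sg.
rewrite /nsq -RintegralD// -RintegralZl//; last exact: integrable_add.
apply: le_Rintegral => //.
- exact: (sqint_add sf sg).2.
- by apply: integrable_scale => //; exact: integrable_add.
- by move=> x _; have := sqr_ge0 (f x - g x); nra.
Qed.

Definition trunc (n : nat) f (x : R) : R := if `|x| <= n%:R then f x else 0.

Lemma truncE n f x : trunc n f x = f x * \1_(`[- n%:R, n%:R]) x.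
Proof.
rewrite /trunc indicE; case: ifPn => xn.
  by rewrite mem_set ?mulr1//= in_itv/= -ler_norml.
by rewrite memNset ?mulr0//= in_itv/= -ler_norml; exact/negP.
Qed.

Lemma measurable_trunc n f : measurable_fun setT f ->
  measurable_fun setT (trunc n f).
Proof.
move=> mf; rewrite (_ : trunc n f = fun x => f x * \1_(`[- n%:R, n%:R]) x);
  last by apply/funext => x; exact: truncE.
by apply: measurable_funM => //; exact: measurable_indic.
Qed.

Lemma trunc_le n f x : `|trunc n f x| <= `|f x|.
Proof. by rewrite /trunc; case: ifPn => // _; rewrite normr0. Qed.

Lemma trunc_cvg f x : trunc n f x @[n --> \oo] --> f x.
Proof.
apply: cvg_near_cst; near=> n; rewrite /trunc ifT//.
by near: n; exact: nbhs_infty_ger.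
Unshelve. all: by end_near. Qed.

Lemma sqint_trunc n f : sqint f -> sqint (trunc n f).
Proof.
move=> sf; apply: (sqint_dominated _ sf); last exact: trunc_le.
by apply: measurable_trunc; case: sf.
Qed.

Lemma integrable_trunc n f : sqint f -> mu.-integrable setT (EFin \o trunc n f).
Proof.
move=> sf; have [mf fi] := sf.
apply: (@integrable_le _ (measurableTypeR R) _ mu _ _ (fun x => \1_(`[- n%:R, n%:R]) x + f x ^+ 2)) => //.
- exact: measurable_trunc.
- by apply: integrable_add => //; exact: integrable_indic_itv.
move=> x _; rewrite truncE normrM indicE.
case: (_ \in _); last by rewrite normr0 mulr0 add0r sqr_ge0.
rewrite normr1 mulr1 -(real_normK (num_real (f x))).
by have := sqr_ge0 (`|f x| - 1); have := normr_ge0 (f x) => /=; rewrite -[true%:R]/1; nra.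
Qed.

Lemma nsq_trunc_cvg0 f : sqint f ->
  nsq (fun x => f x - trunc n f x) @[n --> \oo] --> 0.
Proof.
move=> sf; have [mf fi] := sf.
have [] := @Rintegral_dominated _ _ _ mu setT
  (fun n x => (f x - trunc n f x) ^+ 2) (fun=> 0) (fun x => f x ^+ 2) => //.
- move=> n; apply: measurable_funX; apply: measurable_funB => //.
  exact: measurable_trunc.
- move=> x _; rewrite (_ : 0 = (f x - f x) * (f x - f x)); last by rewrite subrr mul0r.
  by apply: cvgM; apply: cvgB; [exact: cvg_cst|exact: trunc_cvg|exact: cvg_cst|exact: trunc_cvg].
- move=> n x _; rewrite ger0_norm ?sqr_ge0// /trunc; case: ifPn => _.
    by rewrite subrr expr0n sqr_ge0.
  by rewrite subr0.
- by move=> _; rewrite Rintegral_cst// mul0r.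
Qed.

Lemma conv_integrable f g (w : R) : sqint f -> sqint g ->
  mu.-integrable setT (EFin \o (fun x => f x * g (w - x))).
Proof. by move=> sf sg; apply: sqint_mul => //; exact: sqint_reflect. Qed.

Lemma corr_integrable f g (v : R) : sqint f -> sqint g ->
  mu.-integrable setT (EFin \o (fun x => f x * g (v + x))).
Proof. by move=> sf sg; apply: sqint_mul => //; exact: sqint_shift. Qed.

Lemma conv_sq_le f g w : sqint f -> sqint g -> conv f g w ^+ 2 <= nsq f * nsq g.
Proof.
move=> sf sg; rewrite -(nsq_reflect w sg); apply: sqint_cauchy_schwarz => //.
exact: sqint_reflect.
Qed.

Lemma corr_sq_le f g w : sqint f -> sqint g -> corr f g w ^+ 2 <= nsq f * nsq g.
Proof.
move=> sf sg; rewrite -(nsq_shift w sg); apply: sqint_cauchy_schwarz => //.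
exact: sqint_shift.
Qed.

Lemma measurable_conv f g : measurable_fun setT f -> measurable_fun setT g ->
  measurable_fun setT (conv f g).
Proof.
move=> mf mg.
apply: (@measurable_Rintegral_param _ (fun z => f z.2 * g (z.1 - z.2))).
apply: measurable_funM; first exact: (measurableT_comp mf).
by apply: (measurableT_comp mg); exact: measurable_funB.
Qed.

Lemma conv_trunc_cvg f g w : sqint f -> sqint g ->
  conv (trunc n f) g w @[n --> \oo] --> conv f g w.
Proof.
move=> sf sg; have [mf fi] := sf; have [mg' gi'] := sqint_reflect w sg.
have [] := @Rintegral_dominated _ _ _ mu setT
  (fun n x => trunc n f x * g (w - x)) (fun x => f x * g (w - x))
  (fun x => `|f x * g (w - x)|) => //.
- by move=> n; apply: measurable_funM => //; exact: measurable_trunc.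
- by move=> x _; apply: cvgM; [exact: trunc_cvg|exact: cvg_cst].
- by apply: integrable_norm; exact: conv_integrable.
- by move=> n x _; rewrite !normrM ler_wpM2r// trunc_le.
Qed.

(** [C] bounds the square of the operator norm on real L2. Testing on all of L2 is meaningful for
    [g] in L2, since the integral defining [conv f g] then converges at every point. *)
Definition bounded_conv (C : R) g := 0 <= C /\ forall f, sqint f ->
  sqint (conv f g) /\ nsq (conv f g) <= C * nsq f.

(** Truncations of [f] are integrable and have smaller norm, and [conv (trunc n f) g] tends to
    [conv f g] pointwise by dominated convergence; Fatou then extends the bound from integrable test
    functions to L2. *)
Lemma bounded_conv_ext (C : R) g : 0 <= C -> sqint g ->
  (forall f, sqint f -> mu.-integrable setT (EFin \o f) ->
    sqint (conv f g) /\ nsq (conv f g) <= C * nsq f) ->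
  bounded_conv C g.
Proof.
move=> C0 sg H; split => // f sf.
have [mf _] := sf; have [mg _] := sg.
have [] := @Rintegral_fatou _ _ _ mu setT (fun n w => conv (trunc n f) g w ^+ 2)
  (fun w => conv f g w ^+ 2) (C * nsq f) => //.
- move=> n; have [[]//] := H _ (sqint_trunc n sf) (integrable_trunc n sf).
- by move=> n x _; exact: sqr_ge0.
- by move=> x _; rewrite expr2; under eq_fun do rewrite expr2; apply: cvgM;
    exact: conv_trunc_cvg.
- move=> n; have [_] := H _ (sqint_trunc n sf) (integrable_trunc n sf).
  move/le_trans; apply; apply: ler_wpM2l => //; apply: nsq_le => //.
    exact: sqint_trunc.
  exact: trunc_le.
- by move=> ci cle; split => //; split => //; exact: measurable_conv.
Qed.

Lemma corr_conv f g v : sqint f -> sqint g ->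
  corr f g v = conv (fun x => g (0 - x)) f (0 - v).
Proof.
move=> sf sg; rewrite /corr -(Rintegral_reflect (0 - v) (corr_integrable v sf sg)).
by apply: eq_Rintegral => x _; rewrite mulrC; congr (g _ * f _); ring.
Qed.

(** A correlation is a convolution up to reflecting the second argument and the result, and
    reflections are isometries. *)
Lemma bounded_corr (C : R) f g : sqint f -> sqint g -> bounded_conv C f ->
  sqint (corr f g) /\ nsq (corr f g) <= C * nsq g.
Proof.
move=> sf sg [C0 H]; have [sc nc] := H _ (sqint_reflect 0 sg).
have -> : corr f g = fun v => conv (fun x => g (0 - x)) f (0 - v).
  by apply/funext => v; exact: corr_conv.
split; first exact: (sqint_reflect 0 sc).
by rewrite (nsq_reflect 0 sc) (le_trans nc)// nsq_reflect.
Qed.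

(** Fubini on the triple product. Integrability of [f] makes it absolutely convergent, because the
    integral over [y] of [|g y * h (w - x + y)|] is at most [nsq g + nsq h] uniformly in [x]. *)
Lemma conv_corrA f g h w : sqint f -> mu.-integrable setT (EFin \o f) ->
  sqint g -> sqint h -> conv f (corr g h) w = corr g (conv f h) w.
Proof.
move=> sf fi sg sh; have [mf _] := sf; have [mg _] := sg; have [mh _] := sh.
rewrite /conv /corr.
transitivity (\int[mu]_x \int[mu]_y (f x * (g y * h (w - x + y)))).
  apply: eq_Rintegral => x _; rewrite RintegralZl//; exact: corr_integrable.
rewrite (@Rintegral_fubini _ (fun z => f z.1 * (g z.2 * h (w - z.1 + z.2)))).
- apply: eq_Rintegral => y _ /=; rewrite -RintegralZl//; last first.
    exact: conv_integrable.
  apply: eq_Rintegral => x _; have -> : w + y - x = w - x + y by ring.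
  by ring.
- apply: measurable_funM; first exact: (measurableT_comp mf).
  apply: measurable_funM; first exact: (measurableT_comp mg).
  apply: (measurableT_comp mh); apply: measurable_funD => //.
  exact: measurable_funB.
- by move=> x /=; apply: integrable_scale => //; exact: corr_integrable.
- move=> y /=; have := integrable_scale (g y) measurableT (conv_integrable (w + y) sf sh).
  congr (_.-integrable _ _); apply/funext => x /=; congr (_%:E).
  by rewrite mulrCA; congr (f _ * (g _ * h _)); rewrite addrAC.
- have mF : measurable_fun setT (fun z : R * R => `|f z.1 * (g z.2 * h (w - z.1 + z.2))|).
    apply: measurableT_comp => //.
    apply: measurable_funM; first exact: (measurableT_comp mf).
    apply: measurable_funM; first exact: (measurableT_comp mg).
    apply: (measurableT_comp mh); apply: measurable_funD => //.
    exact: measurable_funB.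
  have fi' := integrable_scale (nsq g + nsq h) measurableT (integrable_norm fi).
  apply: (integrable_le _ _ fi') => //; first exact: measurable_Rintegral_param mF.
  move=> x _; rewrite ger0_norm; last by apply: Rintegral_ge0 => y _.
  have ci := corr_integrable (w - x) sg sh.
  under eq_Rintegral do rewrite /= normrM.
  rewrite RintegralZl//; last exact: integrable_norm.
  rewrite mulrC ler_wpM2r//; rewrite -(nsq_shift (w - x) sh).
  have [_ gi] := sg; have [_ hi] := sqint_shift (w - x) sh.
  rewrite /nsq -RintegralD//; apply: le_Rintegral => //.
    exact: integrable_norm.
    exact: integrable_add.
  move=> y _; rewrite normrM -(real_normK (num_real (g y))).
  rewrite -(real_normK (num_real (h (w - x + y)))).
  by have := normr_ge0 (g y); have := normr_ge0 (h (w - x + y)); nra.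
Qed.

(** On integrable functions, associativity writes the operator as two bounded ones in succession,
    whence the product of their constants; [bounded_conv_ext] reaches the rest of L2. *)
Lemma bounded_conv_corr (C : R) g h : sqint g -> sqint h ->
  bounded_conv C g -> bounded_conv C h -> bounded_conv (C * C) (corr g h).
Proof.
move=> sg sh Bg Bh; have [C0 Hg] := Bg; have [_ Hh] := Bh.
have [sc _] := bounded_corr sg sh Bg.
apply: bounded_conv_ext => //; first exact: mulr_ge0.
move=> f sf fi; have -> : conv f (corr g h) = corr g (conv f h).
  by apply/funext => w; exact: conv_corrA.
have [sfh nfh] := Hh _ sf; have [s n] := bounded_corr sg sfh Bg.
by split => //; rewrite (le_trans n)// -mulrA ler_wpM2l.
Qed.
End L2Convolution.

(** * Moving a convolution across the L2 inner product *)

Section Symmetry.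
Context {R : realType}.
Notation mu := (@lebesgue_measure R).
Implicit Types (f g h : R -> R).

Lemma cvg0_sq_le (x y : nat -> R) : (forall n, x n ^+ 2 <= y n) ->
  y n @[n --> \oo] --> 0 -> x n @[n --> \oo] --> 0.
Proof.
move=> xy y0; apply/cvgrPdist_lt => e e0; near=> n.
rewrite sub0r normrN -(@ltr_pXn2r _ 2%N)// ?nnegrE ?(ltW e0)//.
rewrite -normrX ger0_norm ?sqr_ge0// (le_lt_trans (xy n))//.
rewrite (le_lt_trans (ler_norm _))//.
near: n; have /cvgrPdist_lt/(_ (e ^+ 2)) := y0.
rewrite exprn_gt0// => /(_ isT); apply: filterS => n.
by rewrite sub0r normrN.
Unshelve. all: by end_near. Qed.

Lemma inner_cvg (a_ b_ : nat -> R -> R) (a b : R -> R) :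
  (forall n, sqint (a_ n)) -> (forall n, sqint (b_ n)) -> sqint a -> sqint b ->
  nsq (fun x => a x - a_ n x) @[n --> \oo] --> 0 ->
  nsq (fun x => b x - b_ n x) @[n --> \oo] --> 0 ->
  \int[mu]_x (a_ n x * b_ n x) @[n --> \oo] --> \int[mu]_x (a x * b x).
Proof.
move=> sa_ sb_ sa sb a0 b0.
have sda n : sqint (fun x => a x - a_ n x) by exact: sqint_sub.
have sdb n : sqint (fun x => b x - b_ n x) by exact: sqint_sub.
pose I1 n := \int[mu]_x ((a x - a_ n x) * (b x - b_ n x)).
pose I2 n := \int[mu]_x ((a x - a_ n x) * b x).
pose I3 n := \int[mu]_x (a x * (b x - b_ n x)).
(* Each error term has a factor tending to 0 in L2, so Cauchy-Schwarz disposes of all three. *)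
have E n : \int[mu]_x (a_ n x * b_ n x) = \int[mu]_x (a x * b x) + (I1 n - I2 n - I3 n).
  have i0 := sqint_mul sa sb; have i1 := sqint_mul (sda n) (sdb n).
  have i2 := sqint_mul (sda n) sb; have i3 := sqint_mul sa (sdb n).
  have i12 := integrable_sub measurableT i1 i2.
  rewrite /I1 /I2 /I3 -RintegralB// -RintegralB// -RintegralD//; last first.
    exact: (integrable_sub measurableT i12 i3).
  by apply: eq_Rintegral => x _; ring.
under eq_fun do rewrite E.
have c1 : I1 n @[n --> \oo] --> 0.
  apply: (cvg0_sq_le (fun n => sqint_cauchy_schwarz (sda n) (sdb n))).
  have := cvgM a0 b0; rewrite mulr0; exact.
have c2 : I2 n @[n --> \oo] --> 0.
  apply: (cvg0_sq_le (fun n => sqint_cauchy_schwarz (sda n) sb)).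
  have := cvgM a0 (@cvg_cst _ (nsq b) _ \oo _); rewrite mul0r; exact.
have c3 : I3 n @[n --> \oo] --> 0.
  apply: (cvg0_sq_le (fun n => sqint_cauchy_schwarz sa (sdb n))).
  have := cvgM (@cvg_cst _ (nsq a) _ \oo _) b0; rewrite mulr0; exact.
have := cvgD (@cvg_cst _ (\int[mu]_x (a x * b x)) _ \oo _) (cvgB (cvgB c1 c2) c3).
by rewrite !subr0 addr0; exact.
Qed.

Lemma convB f g h w : sqint f -> sqint g -> sqint h ->
  conv (fun x => f x - g x) h w = conv f h w - conv g h w.
Proof.
move=> sf sg sh; rewrite /conv -RintegralB//; try exact: conv_integrable.
by apply: eq_Rintegral => x _; rewrite mulrBl.
Qed.

(** [e] records the parity of the kernel: it will be 1 for an even [r] and -1 for an odd one. Fubini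
    applies because [f] and [g] are integrable and [r] is bounded. *)
Lemma conv_sym_L1 (B e : R) (r : R -> R) f g : sqint r ->
  (forall v, `|r v| <= B) -> (forall v, r (0 - v) = e * r v) ->
  sqint f -> sqint g ->
  mu.-integrable setT (EFin \o f) -> mu.-integrable setT (EFin \o g) ->
  \int[mu]_w (f w * conv g r w) = e * \int[mu]_w (g w * conv f r w).
Proof.
move=> sr rB re sf sg fi gi.
have [mf _] := sf; have [mg _] := sg; have [mr _] := sr.
have mF : measurable_fun setT (fun z : R * R => f z.1 * (g z.2 * r (z.1 - z.2))).
  apply: measurable_funM; first exact: (measurableT_comp mf).
  apply: measurable_funM; first exact: (measurableT_comp mg).
  by apply: (measurableT_comp mr); exact: measurable_funB.
have B0 : 0 <= B by rewrite (le_trans _ (rB 0)).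
have bound h : sqint h -> mu.-integrable setT (EFin \o h) -> forall x,
  `|conv h r x| <= B * \int[mu]_y `|h y|.
  move=> sh hi x; apply: (le_trans (le_normr_Rintegral _ (conv_integrable x sh sr))) => //.
  rewrite -RintegralZl//; last exact: integrable_norm.
  apply: le_Rintegral => //.
  - by apply: integrable_norm; exact: conv_integrable.
  - by apply: integrable_scale => //; exact: integrable_norm.
  - by move=> y _; rewrite normrM mulrC ler_wpM2r.
have convi h k : sqint h -> sqint k -> mu.-integrable setT (EFin \o h) ->
    mu.-integrable setT (EFin \o k) ->
    mu.-integrable setT (EFin \o (fun x => h x * conv k r x)).
  move=> sh sk hi ki; have [mh _] := sh; have [mk _] := sk.
  have hi' := integrable_scale (B * \int[mu]_y `|k y|) measurableT (integrable_norm hi).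
  apply: (integrable_le _ _ hi') => //.
    by apply: measurable_funM => //; exact: measurable_conv.
  by move=> x _; rewrite normrM mulrC ler_wpM2r// bound.
transitivity (\int[mu]_w \int[mu]_x (f w * (g x * r (w - x)))).
  by apply: eq_Rintegral => w _; rewrite RintegralZl//; exact: conv_integrable.
rewrite -RintegralZl//; last exact: convi.
rewrite (@Rintegral_fubini _ (fun z => f z.1 * (g z.2 * r (z.1 - z.2))))//=.
- apply: eq_Rintegral => x _; rewrite mulrCA -RintegralZl//; last exact: conv_integrable.
  rewrite -RintegralZl//; last first.
    by apply: integrable_scale => //; exact: conv_integrable.
  apply: eq_Rintegral => w _.
  have -> : r (w - x) = e * r (x - w) by rewrite -re; congr r; ring.
  by ring.
- by move=> w; apply: integrable_scale => //; exact: conv_integrable.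
- move=> x; have := integrable_scale (g x) measurableT (corr_integrable (0 - x) sf sr).
  congr (_.-integrable _ _); apply/funext => w /=; congr (_%:E).
  by rewrite mulrCA; congr (f _ * (g _ * r _)); rewrite sub0r addrC.
- have fi' := integrable_scale (B * \int[mu]_y `|g y|) measurableT (integrable_norm fi).
  apply: (integrable_le _ _ fi') => //.
    apply: (@measurable_Rintegral_param _ (fun z => `|f z.1 * (g z.2 * r (z.1 - z.2))|)).
    exact: measurableT_comp.
  move=> w _; rewrite ger0_norm; last by apply: Rintegral_ge0 => y _.
  under [leLHS]eq_Rintegral do rewrite normrM.
  rewrite RintegralZl//; last by apply: integrable_norm; exact: conv_integrable.
  rewrite mulrC ler_wpM2r// -RintegralZl//; last exact: integrable_norm.
  apply: le_Rintegral => //.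
  + by apply: integrable_norm; exact: conv_integrable.
  + by apply: integrable_scale => //; exact: integrable_norm.
  + by move=> y _; rewrite normrM mulrC ler_wpM2r.
Qed.

(** Boundedness of convolution with [r] makes both sides continuous in the L2 norm, so the identity
    passes from the truncations of [f] and [g] to the functions themselves. *)
Lemma conv_sym (C B e : R) (r : R -> R) f g : sqint r -> bounded_conv C r ->
  (forall v, `|r v| <= B) -> (forall v, r (0 - v) = e * r v) ->
  sqint f -> sqint g ->
  \int[mu]_w (f w * conv g r w) = e * \int[mu]_w (g w * conv f r w).
Proof.
move=> sr [C0 Cr] rB re sf sg.
have cv h k : sqint h -> sqint k ->
   \int[mu]_w (trunc n h w * conv (trunc n k) r w) @[n --> \oo] -->
   \int[mu]_w (h w * conv k r w).
  move=> sh sk; apply: inner_cvg => //.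
  - by move=> n; exact: sqint_trunc.
  - by move=> n; have [] := Cr _ (sqint_trunc n sk).
  - by have [] := Cr _ sk.
  - exact: nsq_trunc_cvg0.
  - have sd n := sqint_sub sk (sqint_trunc n sk).
    apply: (@squeeze_cvgr _ _ _ _ (fun=> 0) (fun n => C * nsq (fun x => k x - trunc n k x))).
    + apply: nearW => n; rewrite nsq_ge0/=.
      rewrite (_ : (fun x => _) = conv (fun x => k x - trunc n k x) r).
        by have [] := Cr _ (sd n).
      by apply/funext => x; rewrite convB//; exact: sqint_trunc.
    + exact: cvg_cst.
    + have := cvgM (@cvg_cst _ C _ \oo _) (nsq_trunc_cvg0 sk); rewrite mulr0; exact.
have c1 := cv _ _ sf sg.
have c2 : e * \int[mu]_w (trunc n g w * conv (trunc n f) r w) @[n --> \oo] -->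
    e * \int[mu]_w (g w * conv f r w).
  by apply: cvgM; [exact: cvg_cst|exact: cv].
have E n : \int[mu]_w (trunc n f w * conv (trunc n g) r w) =
    e * \int[mu]_w (trunc n g w * conv (trunc n f) r w).
  by apply: conv_sym_L1 sr rB re _ _ _ _;
    [exact: sqint_trunc|exact: sqint_trunc|exact: integrable_trunc..].
rewrite -(cvg_lim _ c1)//; under eq_fun do rewrite E.
by rewrite (cvg_lim _ c2).
Qed.

End Symmetry.

(** * A Bessel inequality for the Fourier transform *)

Section RieszKernel.
Context {R : realType}.
Notation mu := (@lebesgue_measure R).
Implicit Types (f g h : R -> R).

Lemma Rintegral_FTC (F f : R -> R) (a b : R) : a <= b ->
  (forall x : R, a <= x <= b -> is_derive x 1 F (f x)) -> continuous f ->
  \int[mu]_(x in `[a, b]) f x = F b - F a.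
Proof.
rewrite le_eqVlt => /predU1P[<- _ _|ab dF cf].
  by rewrite set_itv1 Rintegral_set1 subrr.
have cF x : a <= x <= b -> {for x, continuous F}.
  move=> /dF dFx; apply: differentiable_continuous; apply/derivable1_diffP.
  exact: ex_derive.
rewrite /Rintegral (@continuous_FTC2 _ f F)//.
- by apply: continuous_subspaceT.
- split.
  + move=> x; rewrite in_itv/= => /andP[ax xb].
    by have [] := dF x _; rewrite ?(ltW ax) ?(ltW xb).
  + by apply: cvg_at_right_filter; apply: cF; rewrite lexx ltW.
  + by apply: cvg_at_left_filter; apply: cF; rewrite lexx ltW.
- move=> x; rewrite in_itv/= => /andP[ax xb]; rewrite derive1E.
  by have [] := dF x _; rewrite ?(ltW ax) ?(ltW xb).
Qed.

Lemma continuous_integrable_itv f (a b : R) : continuous f ->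
  mu.-integrable `[a, b] (EFin \o f).
Proof.
move=> cf; apply: continuous_compact_integrable; first exact: segment_compact.
exact: continuous_subspaceT.
Qed.

(* A frequency cut-off whose kernel is, unlike that of a sharp cut-off, bounded in
   L1 uniformly in [K]. *)
Definition riesz_weight (K w : R) : R := (1 - (w / K) ^+ 2) * \1_(`[- K, K]) w.

Definition riesz_kernel (K x : R) : R :=
  \int[mu]_w (riesz_weight K w * cos (w * x)).

Lemma riesz_weight_ge0 K w : 0 < K -> 0 <= riesz_weight K w.
Proof.
move=> K0; rewrite /riesz_weight indicE; case: (boolP (w \in _)); last by rewrite mulr0.
rewrite inE/= in_itv/= mulr1 -ler_norml => wK.
rewrite subr_ge0 -[leLHS]ger0_norm ?sqr_ge0// normrX expr_le1//.
by rewrite normrM normfV (gtr0_norm K0) ler_pdivrMr// mul1r.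
Qed.

Lemma riesz_weight_le K w : 0 < K -> riesz_weight K w <= \1_(`[- K, K]) w.
Proof.
move=> K0; rewrite /riesz_weight ler_piMl// lerBlDr lerDl; exact: sqr_ge0.
Qed.

Lemma measurable_riesz_weight K : measurable_fun setT (riesz_weight K).
Proof.
apply: measurable_funM; last exact: measurable_indic.
apply: measurable_funB => //; apply: measurable_funX.
exact: measurable_funM.
Qed.

Lemma integrable_riesz_weight K : 0 < K ->
  mu.-integrable setT (EFin \o riesz_weight K).
Proof.
move=> K0; apply: (integrable_le _ _ (integrable_indic_itv (- K) K true false)) => //.
- exact: measurable_riesz_weight.
- move=> w _; rewrite ger0_norm; first exact: riesz_weight_le.
  exact: riesz_weight_ge0.
Qed.

Lemma riesz_weight_cvg w :
  riesz_weight n.+1%:R w @[n --> \oo] --> (1 : R).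
Proof.
apply: (@cvg_trans _ ((1 - (w * n.+1%:R^-1) * (w * n.+1%:R^-1)) @[n --> \oo])).
  apply: near_eq_cvg; near=> n; rewrite /riesz_weight indicE mem_set ?mulr1 ?expr2//=.
  rewrite in_itv/= -ler_norml; near: n.
  have := nbhs_infty_ger `|w|; apply: filterS => n.
  by move/le_trans; apply; rewrite ler_nat.
have c0 : w * n.+1%:R^-1 @[n --> \oo] --> (0 : R).
  rewrite -(mulr0 w); apply: cvgM; first exact: cvg_cst.
  exact: cvg_harmonic.
have c1 : 1 - (w * n.+1%:R^-1) * (w * n.+1%:R^-1) @[n --> \oo] --> (1 - 0 * 0 : R).
  by apply: cvgB; [exact: cvg_cst|exact: cvgM].
by rewrite mulr0 subr0 in c1.
Unshelve. all: by end_near. Qed.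


(** The result of integrating [(1 - (w / K) ^+ 2) * cos (w * x)] by parts twice in [w]. *)
Definition riesz_primitive (K x w : R) : R :=
  (1 - (w * K^-1) * (w * K^-1)) * (sin (w * x) * x^-1)
  - 2 * K^-1 * K^-1 * x^-1 * x^-1 * (w * cos (w * x))
  + 2 * K^-1 * K^-1 * x^-1 * x^-1 * x^-1 * sin (w * x).

Lemma is_derive_riesz_primitive (K x w : R) : x != 0 -> K != 0 ->
  is_derive w 1 (riesz_primitive K x) ((1 - (w / K) ^+ 2) * cos (w * x)).
Proof.
move=> x0 K0; rewrite /riesz_primitive; apply: is_derive_eq.
rewrite /GRing.scale/=; field; exact/andP.
Qed.

Lemma riesz_kernelE (K x : R) : 0 < K ->
  riesz_kernel K x = \int[mu]_(w in `[- K, K]) ((1 - (w / K) ^+ 2) * cos (w * x)).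
Proof.
move=> K0; rewrite Rintegral_mkcond /riesz_kernel; apply: eq_Rintegral => w _.
rewrite patchE /riesz_weight indicE; case: ifPn => _; last by rewrite mulr0 mul0r.
by rewrite mulr1.
Qed.

Lemma continuous_riesz_integrand (K x : R) :
  continuous (fun w : R => (1 - (w / K) ^+ 2) * cos (w * x)).
Proof.
move=> w; apply: differentiable_continuous; apply/derivable1_diffP.
exact: ex_derive.
Qed.

(** The weight vanishes at both ends of the band, which removes the term of order [1 / x] and leaves
    a decay in [1 / x^2]. With [y = K * x], the trivial bound [2 * K] serves when [|y| <= 1];
    otherwise the explicit value [4 K (sin y - y cos y) / y^3] is at most [8 K / y^2]. In both cases
    16 suffices after multiplication by [1 + y^2]. *)
Lemma riesz_kernel_le (K x : R) : 0 < K ->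
  `|riesz_kernel K x| <= 16 * K / (1 + (K * x) ^+ 2).
Proof.
move=> K0.
have ki := integrable_riesz_weight K0.
have kle : `|riesz_kernel K x| <= 2 * K.
  have mk : measurable_fun setT (fun w => riesz_weight K w * cos (w * x)).
    apply: measurable_funM; first exact: measurable_riesz_weight.
    apply: (measurableT_comp (continuous_measurable_fun (@continuous_cos R))).
    exact: measurable_funM.
  have kci : mu.-integrable setT (EFin \o (fun w => riesz_weight K w * cos (w * x))).
    apply: (integrable_le _ _ ki) => // w _.
    rewrite normrM ger0_norm ?riesz_weight_ge0// ler_piMr ?riesz_weight_ge0//.
    by rewrite ler_norml cos_geN1 cos_le1.
  apply: (le_trans (le_normr_Rintegral _ kci)) => //.
  have -> : 2 * K = \int[mu]_w (\1_(`[- K, K]) w).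
    have m2K : mu `[- K, K] = (2 * K)%:E.
      rewrite lebesgue_measure_itv/= lte_fin ifT ?gtrN// -EFinB opprK.
      by congr (_%:E); ring.
    by rewrite /Rintegral integral_indic// setIT; have /= -> := m2K.
  apply: le_Rintegral => //.
  - exact: integrable_norm.
  - exact: integrable_indic_itv.
  move=> w _; rewrite normrM ger0_norm ?riesz_weight_ge0//.
  rewrite (le_trans _ (riesz_weight_le w K0))// ler_piMr ?riesz_weight_ge0//.
  by rewrite ler_norml cos_geN1 cos_le1.
set y := K * x.
have y2 : 0 <= y ^+ 2 by exact: sqr_ge0.
rewrite ler_pdivlMr; last by lra.
have [y1|y1] := leP `|y| 1.
  have y21 : y ^+ 2 <= 1 by rewrite -(real_normK (num_real y)) expr_le1.
  have := normr_ge0 (riesz_kernel K x); nra.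
have y0 : y != 0 by rewrite -normr_gt0 (lt_trans _ y1).
have x0 : x != 0 by apply: contraNneq y0 => x0; rewrite /y x0 mulr0.
have Kn0 : K != 0 by rewrite gt_eqF.
have -> : riesz_kernel K x = 4 * K * (sin y - y * cos y) * y^-1 ^+ 3.
  rewrite riesz_kernelE//.
  transitivity (riesz_primitive K x K - riesz_primitive K x (- K)).
    apply: Rintegral_FTC; first by rewrite ge0_cp// ltW.
      by move=> w _; exact: is_derive_riesz_primitive.
    exact: continuous_riesz_integrand.
  rewrite /riesz_primitive !mulNr sinN cosN -/y /y.
  by field; apply/andP.
rewrite 2!normrM normrX normfV [`|4 * K|]ger0_norm; last by rewrite mulr_ge0// ltW.
have s1 : `|sin y - y * cos y| <= 2 * `|y|.
  rewrite (le_trans (ler_normB _ _))// normrM.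
  have : `|sin y| <= 1 by rewrite ler_norml sin_geN1 sin_le1.
  have : `|cos y| <= 1 by rewrite ler_norml cos_geN1 cos_le1.
  have := normr_ge0 (sin y); have := normr_ge0 (cos y); nra.
have y21 : 1 <= y ^+ 2 by rewrite -(real_normK (num_real y)) expr_ge1// ltW.
apply: (@le_trans _ _ (4 * K * (2 * `|y|) * `|y|^-1 ^+ 3 * (1 + y ^+ 2))).
  rewrite ler_wpM2r//; first by lra.
  by rewrite ler_wpM2r ?exprn_ge0 ?invr_ge0// ler_wpM2l// mulr_ge0// ltW.
have -> : 4 * K * (2 * `|y|) * `|y|^-1 ^+ 3 * (1 + y ^+ 2) = 8 * K * (1 + (y ^+ 2)^-1).
  by rewrite -(real_normK (num_real y)); field; rewrite normr_eq0.
have : (y ^+ 2)^-1 <= 1 by rewrite invf_le1// (lt_le_trans _ y21).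
nra.
Qed.
End RieszKernel.

(** * Cosine and sine transforms of integrable functions *)

Section CosSinTransforms.
Context {R : realType}.
Notation mu := (@lebesgue_measure R).
Implicit Types (f g h : R -> R).

(** For [K > 0] this is [pi] times the Poisson kernel of the half-plane at height [1 / K]. It
    dominates [riesz_kernel K] up to the factor 16, and its mass does not grow with [K]. *)
Definition poisson_kernel (K x : R) : R := K / (1 + (K * x) ^+ 2).

Lemma poisson_kernel_bound (K x : R) : 0 <= K -> 0 <= poisson_kernel K x <= K.
Proof.
move=> K0; have := sqr_ge0 (K * x) => H; rewrite /poisson_kernel; apply/andP; split.
  by rewrite divr_ge0//; lra.
by rewrite ler_pdivrMr; [nra|lra].
Qed.

Lemma continuous_poisson_kernel (K : R) : continuous (poisson_kernel K).
Proof.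
move=> x; rewrite /poisson_kernel; apply: cvgM; first exact: cvg_cst.
apply: cvgV; first by have := sqr_ge0 (K * x); lra.
apply: cvgD; first exact: cvg_cst.
by apply: cvgM; (apply: cvgM; [exact: cvg_cst|exact: cvg_id]).
Qed.

Lemma poisson_kernel_integrable (K : R) : 0 <= K ->
  mu.-integrable setT (EFin \o poisson_kernel K) /\
  \int[mu]_x poisson_kernel K x <= pi.
Proof.
move=> K0; have c := @continuous_poisson_kernel K.
have mp := continuous_measurable_fun c.
have rest n : trunc n (poisson_kernel K) = (poisson_kernel K) \_ `[- n%:R, n%:R].
  apply/funext => x; rewrite patchE truncE indicE.
  by case: ifPn => _; rewrite ?mulr1 ?mulr0.
apply: (@Rintegral_fatou _ _ _ mu setT (fun n => trunc n (poisson_kernel K))) => //.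
- move=> n; rewrite rest -restrict_EFin; apply/integrable_restrict => //.
  by rewrite setTI; exact: continuous_integrable_itv.
- move=> n x _; rewrite /trunc; case: ifPn => // _.
  by have /andP[] := poisson_kernel_bound x K0.
- by move=> x _; exact: trunc_cvg.
- move=> n; rewrite rest -Rintegral_mkcond.
  have -> : \int[mu]_(x in `[- n%:R, n%:R]) poisson_kernel K x =
      atan (K * n%:R) - atan (K * - n%:R).
    apply: (@Rintegral_FTC _ (fun x => atan (K * x))) => //.
      by rewrite ge0_cp.
    move=> x _; apply: is_derive_eq.
    by rewrite /poisson_kernel /GRing.scale/= mulr1 mulrC.
  have := atan_ltpi2 (K * n%:R); have := atan_gtNpi2 (K * - n%:R); lra.
Qed.

Definition cos_transform h (w : R) : R := \int[mu]_t (h t * cos (w * t)).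
Definition sin_transform h (w : R) : R := \int[mu]_t (h t * sin (w * t)).

Lemma measurable_cos_fun d (T : measurableType d) (D : set T) (g : T -> R) :
  measurable_fun D g -> measurable_fun D (fun x => cos (g x)).
Proof.
by move=> mg; exact: (measurableT_comp (continuous_measurable_fun (@continuous_cos R)) mg).
Qed.

Lemma measurable_sin_fun d (T : measurableType d) (D : set T) (g : T -> R) :
  measurable_fun D g -> measurable_fun D (fun x => sin (g x)).
Proof.
by move=> mg; exact: (measurableT_comp (continuous_measurable_fun (@continuous_sin R)) mg).
Qed.

Lemma norm_cos_le1 (x : R) : `|cos x| <= 1.
Proof. by rewrite ler_norml cos_geN1 cos_le1. Qed.

Lemma norm_sin_le1 (x : R) : `|sin x| <= 1.
Proof. by rewrite ler_norml sin_geN1 sin_le1. Qed.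

Lemma integrable_bounded_mul h g (B : R) : mu.-integrable setT (EFin \o h) ->
  measurable_fun setT g -> (forall x, `|g x| <= B) ->
  mu.-integrable setT (EFin \o (fun x => h x * g x)).
Proof.
move=> hi mg gB; have mh := integrable_measurable hi.
have hi' := integrable_scale B measurableT (integrable_norm hi).
apply: (integrable_le _ _ hi') => //; first exact: measurable_funM.
by move=> x _; rewrite normrM mulrC ler_wpM2r.
Qed.

Lemma Rintegral_bounded_mul_le h g (B : R) : mu.-integrable setT (EFin \o h) ->
  measurable_fun setT g -> (forall x, `|g x| <= B) ->
  `|\int[mu]_x (h x * g x)| <= B * \int[mu]_x `|h x|.
Proof.
move=> hi mg gB; have hgi := integrable_bounded_mul hi mg gB.
apply: (le_trans (le_normr_Rintegral _ hgi)) => //.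
rewrite -RintegralZl//; last exact: integrable_norm.
apply: le_Rintegral => //.
- exact: integrable_norm.
- by apply: integrable_scale => //; exact: integrable_norm.
- by move=> x _; rewrite normrM mulrC ler_wpM2r.
Qed.

Lemma integrable_cos h (w : R) : mu.-integrable setT (EFin \o h) ->
  mu.-integrable setT (EFin \o (fun t => h t * cos (w * t))).
Proof.
move=> hi; apply: (@integrable_bounded_mul _ _ 1) => // [|x]; last exact: norm_cos_le1.
by apply: measurable_cos_fun; exact: measurable_funM.
Qed.

Lemma integrable_sin h (w : R) : mu.-integrable setT (EFin \o h) ->
  mu.-integrable setT (EFin \o (fun t => h t * sin (w * t))).
Proof.
move=> hi; apply: (@integrable_bounded_mul _ _ 1) => // [|x]; last exact: norm_sin_le1.
by apply: measurable_sin_fun; exact: measurable_funM.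
Qed.

Lemma cos_transform_le h w : mu.-integrable setT (EFin \o h) ->
  `|cos_transform h w| <= \int[mu]_x `|h x|.
Proof.
move=> hi; rewrite -[leRHS]mul1r; apply: Rintegral_bounded_mul_le => // [|x].
  by apply: measurable_cos_fun; exact: measurable_funM.
exact: norm_cos_le1.
Qed.

Lemma sin_transform_le h w : mu.-integrable setT (EFin \o h) ->
  `|sin_transform h w| <= \int[mu]_x `|h x|.
Proof.
move=> hi; rewrite -[leRHS]mul1r; apply: Rintegral_bounded_mul_le => // [|x].
  by apply: measurable_sin_fun; exact: measurable_funM.
exact: norm_sin_le1.
Qed.

Lemma measurable_cos_transform h : measurable_fun setT h ->
  measurable_fun setT (cos_transform h).
Proof.
move=> mh; apply: (@measurable_Rintegral_param _ (fun z => h z.2 * cos (z.1 * z.2))).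
apply: measurable_funM; first exact: (measurableT_comp mh).
by apply: measurable_cos_fun; exact: measurable_funM.
Qed.

Lemma measurable_sin_transform h : measurable_fun setT h ->
  measurable_fun setT (sin_transform h).
Proof.
move=> mh; apply: (@measurable_Rintegral_param _ (fun z => h z.2 * sin (z.1 * z.2))).
apply: measurable_funM; first exact: (measurableT_comp mh).
by apply: measurable_sin_fun; exact: measurable_funM.
Qed.

Lemma cos_transform_sub h (w s : R) : mu.-integrable setT (EFin \o h) ->
  \int[mu]_t (h t * cos (w * (s - t))) =
  cos (w * s) * cos_transform h w + sin (w * s) * sin_transform h w.
Proof.
move=> hi; have ci := integrable_cos w hi; have si := integrable_sin w hi.
rewrite /cos_transform /sin_transform -!RintegralZl// -RintegralD//;
  try exact: integrable_scale.
by apply: eq_Rintegral => t _; rewrite mulrBr cosB; ring.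
Qed.

Lemma measurable_riesz_kernel (K : R) : measurable_fun setT (riesz_kernel K).
Proof.
apply: (@measurable_Rintegral_param _ (fun z => riesz_weight K z.2 * cos (z.2 * z.1))).
apply: measurable_funM; first exact: (measurableT_comp (measurable_riesz_weight K)).
by apply: measurable_cos_fun; exact: measurable_funM.
Qed.

Lemma riesz_kernel_norm_le (K x : R) : 0 < K ->
  `|riesz_kernel K x| <= 16 * poisson_kernel K x.
Proof. by move=> K0; rewrite /poisson_kernel mulrA; exact: riesz_kernel_le. Qed.

(** The squared modulus of the transform is the double integral of [h s * h t * cos (w * (s - t))];
    integrating it against the weight in [w] produces [riesz_kernel K (s - t)]. Integrability of [h]
    and of the weight justifies the two exchanges of integrals. *)
Lemma riesz_energy h (K : R) : 0 < K -> mu.-integrable setT (EFin \o h) ->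
  \int[mu]_w (riesz_weight K w * (cos_transform h w ^+ 2 + sin_transform h w ^+ 2))
  = \int[mu]_s (h s * conv h (riesz_kernel K) s).
Proof.
move=> K0 hi; have mh := integrable_measurable hi.
have ki := integrable_riesz_weight K0; have mk := measurable_riesz_weight K.
have mc := measurable_cos_transform mh; have ms := measurable_sin_transform mh.
set H := \int[mu]_x `|h x|.
have H0 : 0 <= H by apply: Rintegral_ge0.
(* By [cos_transform_sub], [e s w] is the integral over [t] of [h t * cos (w * (s - t))]. *)
pose e (s w : R) := cos (w * s) * cos_transform h w + sin (w * s) * sin_transform h w.
have eb s w : `|e s w| <= 2 * H.
  rewrite (le_trans (ler_normD _ _))// !normrM.
  have := cos_transform_le w hi; have := sin_transform_le w hi.
  have := norm_cos_le1 (w * s); have := norm_sin_le1 (w * s).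
  have := normr_ge0 (cos (w * s)); have := normr_ge0 (sin (w * s)).
  by rewrite -/H; nra.
have me : measurable_fun setT (fun z : R * R => e z.2 z.1).
  apply: measurable_funD; apply: measurable_funM.
  - by apply: measurable_cos_fun; exact: measurable_funM.
  - exact: (measurableT_comp mc).
  - by apply: measurable_sin_fun; exact: measurable_funM.
  - exact: (measurableT_comp ms).
have me1 s : measurable_fun setT (e s).
  apply: measurable_funD; apply: measurable_funM => //.
    by apply: measurable_cos_fun; exact: measurable_funM.
  by apply: measurable_sin_fun; exact: measurable_funM.
have me2 w : measurable_fun setT (e ^~ w).
  apply: measurable_funD; apply: measurable_funM => //.
    by apply: measurable_cos_fun; exact: measurable_funM.
  by apply: measurable_sin_fun; exact: measurable_funM.
transitivity (\int[mu]_w \int[mu]_s (riesz_weight K w * (h s * e s w))).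
  apply: eq_Rintegral => w _.
  rewrite RintegralZl//; last exact: integrable_bounded_mul (eb ^~ w).
  congr (_ * _); rewrite !expr2.
  have ci := integrable_cos w hi; have si := integrable_sin w hi.
  rewrite {1}/cos_transform {1}/sin_transform -!RintegralZr// -RintegralD//.
  - by apply: eq_Rintegral => s _; rewrite /e; ring.
  - by under eq_fun do rewrite mulrC; exact: integrable_scale.
  - by under eq_fun do rewrite mulrC; exact: integrable_scale.
rewrite (@Rintegral_fubini _ (fun z => riesz_weight K z.1 * (h z.2 * e z.2 z.1)))//=.
- apply: eq_Rintegral => s _.
  transitivity (\int[mu]_w (h s * (riesz_weight K w * e s w))).
    by apply: eq_Rintegral => w _; ring.
  rewrite RintegralZl//; last exact: integrable_bounded_mul (eb s).
  congr (_ * _).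
  transitivity (\int[mu]_w \int[mu]_t (riesz_weight K w * (h t * cos (w * (s - t))))).
    apply: eq_Rintegral => w _; rewrite RintegralZl//.
      by rewrite cos_transform_sub.
    apply: (@integrable_bounded_mul _ _ 1) => // [|x]; last exact: norm_cos_le1.
    by apply: measurable_cos_fun; apply: measurable_funM => //; exact: measurable_funB.
  rewrite (@Rintegral_fubini _ (fun z => riesz_weight K z.1 * (h z.2 * cos (z.1 * (s - z.2)))))//=.
  + apply: eq_Rintegral => t _; rewrite /riesz_kernel -RintegralZl//.
      by apply: eq_Rintegral => w _; ring.
    apply: (@integrable_bounded_mul _ _ 1) => // [|x]; last exact: norm_cos_le1.
    by apply: measurable_cos_fun; exact: measurable_funM.
  + apply: measurable_funM; first exact: (measurableT_comp mk).
    apply: measurable_funM; first exact: (measurableT_comp mh).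
    by apply: measurable_cos_fun; apply: measurable_funM => //; exact: measurable_funB.
  + move=> w; apply: integrable_scale => //.
    apply: (@integrable_bounded_mul _ _ 1) => // [|x]; last exact: norm_cos_le1.
    by apply: measurable_cos_fun; apply: measurable_funM => //; exact: measurable_funB.
  + move=> t; apply: (@integrable_bounded_mul _ _ `|h t|) => // [|x].
      by apply: measurable_funM => //; apply: measurable_cos_fun; exact: measurable_funM.
    by rewrite normrM ler_piMr// norm_cos_le1.
  + have ki' := integrable_scale H measurableT ki.
    apply: (integrable_le _ _ ki') => //.
      apply: (@measurable_Rintegral_param _ (fun z => `|riesz_weight K z.1 * (h z.2 * cos (z.1 * (s - z.2)))|)).
      apply: measurableT_comp => //.
      apply: measurable_funM; first exact: (measurableT_comp mk).
      apply: measurable_funM; first exact: (measurableT_comp mh).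
      by apply: measurable_cos_fun; apply: measurable_funM => //; exact: measurable_funB.
    move=> w _; rewrite ger0_norm; last by apply: Rintegral_ge0 => y _.
    have hci : mu.-integrable setT (EFin \o (fun t => h t * cos (w * (s - t)))).
      apply: (@integrable_bounded_mul _ _ 1) => // [|x]; last exact: norm_cos_le1.
      by apply: measurable_cos_fun; apply: measurable_funM => //; exact: measurable_funB.
    under [leLHS]eq_Rintegral do rewrite normrM.
    rewrite RintegralZl//; last exact: integrable_norm.
    rewrite ger0_norm ?riesz_weight_ge0// mulrC ler_wpM2r ?riesz_weight_ge0//.
    apply: le_Rintegral => //; [exact: integrable_norm|exact: integrable_norm|].
    by move=> t _; rewrite normrM ler_piMr// norm_cos_le1.
- apply: measurable_funM; first exact: (measurableT_comp mk).
  by apply: measurable_funM => //; exact: (measurableT_comp mh).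
- by move=> w; apply: integrable_scale => //; exact: integrable_bounded_mul (eb ^~ w).
- move=> s; apply: (@integrable_bounded_mul _ _ (`|h s| * (2 * H))) => // [|x].
    exact: measurable_funM.
  by rewrite normrM ler_wpM2l.
- have ki' := integrable_scale (2 * H * H) measurableT ki.
  apply: (integrable_le _ _ ki') => //.
    apply: (@measurable_Rintegral_param _ (fun z => `|riesz_weight K z.1 * (h z.2 * e z.2 z.1)|)).
    apply: measurableT_comp => //.
    apply: measurable_funM; first exact: (measurableT_comp mk).
    by apply: measurable_funM => //; exact: (measurableT_comp mh).
  move=> w _; rewrite ger0_norm; last by apply: Rintegral_ge0 => y _.
  have hei := integrable_bounded_mul hi (me2 w) (eb ^~ w).
  under [leLHS]eq_Rintegral do rewrite normrM.
  rewrite RintegralZl//; last exact: integrable_norm.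
  rewrite ger0_norm ?riesz_weight_ge0// mulrC ler_wpM2r ?riesz_weight_ge0//.
  rewrite /H -RintegralZl//; last exact: integrable_norm.
  apply: le_Rintegral => //; first exact: integrable_norm.
    by apply: integrable_scale => //; exact: integrable_norm.
  by move=> t _; rewrite normrM mulrC ler_wpM2r.
Qed.

End CosSinTransforms.

(** * The Bessel inequality by way of the Schur test *)

Section BesselInequality.
Context {R : realType}.
Notation mu := (@lebesgue_measure R).
Implicit Types (f g h p : R -> R).

(** The bound on [g] makes the convolution integral converge at every point, as [integrable_fubini]
    requires of the sections; the value then follows from translation invariance. *)
Lemma conv_L1 f g (B : R) : mu.-integrable setT (EFin \o f) ->
  mu.-integrable setT (EFin \o g) -> (forall x, `|g x| <= B) ->
  mu.-integrable setT (EFin \o conv f g) /\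
  \int[mu]_x conv f g x = \int[mu]_x f x * \int[mu]_x g x.
Proof.
move=> fi gi gB; have mf := integrable_measurable fi.
have mg := integrable_measurable gi.
pose F (z : R * R) := f z.1 * g (z.2 - z.1).
have mF : measurable_fun setT F.
  apply: measurable_funM; first exact: (measurableT_comp mf).
  by apply: (measurableT_comp mg); exact: measurable_funB.
have shi (h : R -> R) t : mu.-integrable setT (EFin \o h) ->
    mu.-integrable setT (EFin \o (fun s => h (s - t))).
  move=> /(integrable_shift (- t)); congr (_.-integrable _ _).
  by apply/funext => s /=; rewrite addrC.
have shE (h : R -> R) t : mu.-integrable setT (EFin \o h) ->
    \int[mu]_s h (s - t) = \int[mu]_s h s.
  move=> hi; rewrite -(Rintegral_shift (- t) hi).
  by apply: eq_Rintegral => s _; rewrite addrC.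
have F1 t : mu.-integrable setT (EFin \o (fun s => F (t, s))).
  exact: (integrable_scale (f t) measurableT (shi g t gi)).
have F2 s : mu.-integrable setT (EFin \o (fun t => F (t, s))).
  have mgs : measurable_fun setT (fun t : R => g (s - t)).
    by apply: (measurableT_comp mg); exact: measurable_funB.
  exact: (integrable_bounded_mul fi mgs (fun t => gB (s - t))).
have gi' := integrable_norm gi.
have F12 : mu.-integrable setT (EFin \o (fun t => \int[mu]_s `|F (t, s)|)).
  have := integrable_scale (\int[mu]_s `|g s|) measurableT (integrable_norm fi).
  congr (_.-integrable _ _); apply/funext => t /=; congr (_%:E).
  rewrite mulrC /F /=; under [RHS]eq_Rintegral do rewrite normrM.
  by rewrite RintegralZl ?(shE _ t gi')//; exact: (shi _ t gi').
split; first exact: (integrable_fubini mF F1 F2 F12).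
rewrite /conv -(Rintegral_fubini mF F1 F2 F12) -RintegralZr//.
apply: eq_Rintegral => t _; rewrite /F/= RintegralZl ?shE//; exact: shi.
Qed.

(** Schur's test: the inequality [2 |h s| |h t| <= h s ^+ 2 + h t ^+ 2] reduces the quadratic form
    to the mass of the dominating kernel, which is at most [16 * pi] in either variable, for every
    [K]. *)
Lemma schur_riesz h (K : R) : 0 < K -> sqint h -> mu.-integrable setT (EFin \o h) ->
  \int[mu]_s (h s * conv h (riesz_kernel K) s) <= 16 * pi * nsq h.
Proof.
move=> K0 sh hi; have mh := integrable_measurable hi; have h2i := sh.2.
have [pi1 pi2] := poisson_kernel_integrable (ltW K0).
have mp := integrable_measurable pi1; have mk := measurable_riesz_kernel K.
have pB x : `|16 * poisson_kernel K x| <= 16 * K.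
  have /andP[p0 pK] := poisson_kernel_bound x (ltW K0).
  by rewrite ger0_norm; [lra|exact: mulr_ge0].
have kB x : `|riesz_kernel K x| <= 16 * K.
  apply: le_trans (riesz_kernel_norm_le x K0) _.
  exact: le_trans (ler_norm _) (pB x).
pose k x := 16 * poisson_kernel K x.
have k_ge0 x : 0 <= k x.
  by have /andP[p0 _] := poisson_kernel_bound x (ltW K0); rewrite /k mulr_ge0.
have ki : mu.-integrable setT (EFin \o k) by exact: integrable_scale.
have kle : \int[mu]_x k x <= 16 * pi by rewrite /k RintegralZl// ler_pM2l.
have [ci cE] := conv_L1 h2i ki pB.
have mhk s : measurable_fun setT (fun t : R => riesz_kernel K (s - t)).
  by apply: (measurableT_comp mk); exact: measurable_funB.
have mks s : measurable_fun setT (fun t : R => k (s - t)).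
  by apply: (measurableT_comp (integrable_measurable ki)); exact: measurable_funB.
have hki s := integrable_bounded_mul hi (mhk s) (fun t => kB (s - t)).
have kis s : mu.-integrable setT (EFin \o (fun t => k (s - t))) by exact: integrable_reflect.
have h2ki s := integrable_bounded_mul h2i (mks s) (fun t => pB (s - t)).
have pt s : `|h s * conv h (riesz_kernel K) s| <=
    2^-1 * (16 * pi * h s ^+ 2 + conv (fun t => h t ^+ 2) k s).
  rewrite normrM.
  apply: (@le_trans _ _ (\int[mu]_t (2^-1 * (h s ^+ 2 * k (s - t) + h t ^+ 2 * k (s - t))))).
    apply: le_trans (_ : _ <= `|h s| * \int[mu]_t `|h t * riesz_kernel K (s - t)|) _.
      by rewrite ler_wpM2l// le_normr_Rintegral.
    rewrite -RintegralZl//; last exact: integrable_norm.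
    apply: le_Rintegral => //.
    - by apply: integrable_scale => //; exact: integrable_norm.
    - apply: integrable_scale => //; apply: integrable_add => //.
      exact: integrable_scale.
    move=> t _; rewrite normrM mulrA.
    have := riesz_kernel_norm_le (s - t) K0; rewrite -/(k _) => kk.
    apply: (@le_trans _ _ (`|h s| * `|h t| * k (s - t))); first by rewrite ler_wpM2l// mulr_ge0.
    rewrite -(real_normK (num_real (h s))) -(real_normK (num_real (h t))).
    by have := mulr_ge0 (sqr_ge0 (`|h s| - `|h t|)) (k_ge0 (s - t)); nra.
  rewrite RintegralZl//; last first.
    by apply: integrable_add => //; exact: integrable_scale.
  rewrite ler_pM2l// RintegralD//; last exact: integrable_scale.
  rewrite RintegralZl// lerD2r Rintegral_reflect// mulrC ler_wpM2r//.
  exact: sqr_ge0.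
have RHSi : mu.-integrable setT (EFin \o (fun s => 2^-1 * (16 * pi * h s ^+ 2 + conv (fun t => h t ^+ 2) k s))).
  by apply: integrable_scale => //; apply: integrable_add => //; exact: integrable_scale.
have LHSi : mu.-integrable setT (EFin \o (fun s => h s * conv h (riesz_kernel K) s)).
  apply: (integrable_le _ _ RHSi) => //.
  by apply: measurable_funM => //; exact: measurable_conv.
apply: (@le_trans _ _ (\int[mu]_s (2^-1 * (16 * pi * h s ^+ 2 + conv (fun t => h t ^+ 2) k s)))).
  by apply: le_Rintegral => // s _; exact: le_trans (ler_norm _) (pt s).
rewrite RintegralZl//; last by apply: integrable_add => //; exact: integrable_scale.
rewrite RintegralD//; last exact: integrable_scale.
rewrite RintegralZl// cE -/(nsq h).
have := nsq_ge0 h; nra.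
Qed.

(** The weights tend to 1 as [K] grows while the Schur bound stays the same, so Fatou gives the
    square integrability of the transforms and the estimate at once. The constant is not
    Plancherel's [2 * pi]; any constant independent of [h] serves. *)
Lemma bessel h : sqint h -> mu.-integrable setT (EFin \o h) ->
  [/\ sqint (cos_transform h), sqint (sin_transform h) &
      nsq (cos_transform h) + nsq (sin_transform h) <= 16 * pi * nsq h].
Proof.
move=> sh hi; have mh := integrable_measurable hi.
have mc := measurable_cos_transform mh; have ms := measurable_sin_transform mh.
set H := \int[mu]_x `|h x|.
have cH w : cos_transform h w ^+ 2 <= H ^+ 2.
  by rewrite -(real_normK (num_real (cos_transform h w))) ler_pXn2r ?nnegrE ?cos_transform_le//;
    apply: Rintegral_ge0.
have sH w : sin_transform h w ^+ 2 <= H ^+ 2.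
  by rewrite -(real_normK (num_real (sin_transform h w))) ler_pXn2r ?nnegrE ?sin_transform_le//;
    apply: Rintegral_ge0.
pose E w := cos_transform h w ^+ 2 + sin_transform h w ^+ 2.
have mE : measurable_fun setT E by apply: measurable_funD; exact: measurable_funX.
have [Ei Ele] : mu.-integrable setT (EFin \o E) /\ \int[mu]_w E w <= 16 * pi * nsq h.
  apply: (@Rintegral_fatou _ _ _ mu setT (fun n w => riesz_weight n.+1%:R w * E w)) => //.
  - move=> n; apply: (@integrable_bounded_mul _ _ _ (2 * H ^+ 2)) => //.
      exact: integrable_riesz_weight.
    move=> w; rewrite ger0_norm; last by rewrite addr_ge0// sqr_ge0.
    by have := cH w; have := sH w; rewrite /E; lra.
  - by move=> n w _; rewrite mulr_ge0 ?riesz_weight_ge0// addr_ge0// sqr_ge0.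
  - move=> w _; have c : riesz_weight n.+1%:R w * E w @[n --> \oo] --> 1 * E w.
      by apply: cvgM; [exact: riesz_weight_cvg|exact: cvg_cst].
    by rewrite mul1r in c.
  - by move=> n; rewrite riesz_energy// schur_riesz.
have sc : sqint (cos_transform h).
  split => //; apply: (integrable_le _ _ Ei) => //; first exact: measurable_funX.
  by move=> w _; rewrite ger0_norm ?sqr_ge0// lerDl sqr_ge0.
have ss : sqint (sin_transform h).
  split => //; apply: (integrable_le _ _ Ei) => //; first exact: measurable_funX.
  by move=> w _; rewrite ger0_norm ?sqr_ge0// lerDr sqr_ge0.
by split => //; rewrite /nsq -RintegralD//; [exact: sc.2|exact: ss.2].
Qed.

End BesselInequality.

(** * Transforms of bounded signals are convolution multipliers *)

Section Multipliers.
Context {R : realType}.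
Notation mu := (@lebesgue_measure R).
Implicit Types (f g h p : R -> R).

Lemma cos_sin_transformD f (w a b : R) : mu.-integrable setT (EFin \o f) ->
  \int[mu]_x (f x * (a * cos (w * x) + b * sin (w * x))) =
  a * cos_transform f w + b * sin_transform f w.
Proof.
move=> fi; have ci := integrable_cos w fi; have si := integrable_sin w fi.
rewrite /cos_transform /sin_transform -!RintegralZl// -RintegralD//;
  try exact: integrable_scale.
by apply: eq_Rintegral => x _; ring.
Qed.

(** The convolution theorem in real form. With [p = p1 + j p2], the function convolved with [f] is
    the real part of the transform of [p]. The integrands on the right are the real and imaginary
    parts of [p] times the transform of [f] (with kernel [exp (j t x)]), and the sum is the real
    part of the transform of that product. *)
Lemma conv_transform f p1 p2 (u : R) : mu.-integrable setT (EFin \o f) ->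
  mu.-integrable setT (EFin \o p1) -> mu.-integrable setT (EFin \o p2) ->
  conv f (fun w => cos_transform p1 w + sin_transform p2 w) u =
  cos_transform (fun t => p1 t * cos_transform f t - p2 t * sin_transform f t) u +
  sin_transform (fun t => p1 t * sin_transform f t + p2 t * cos_transform f t) u.
Proof.
move=> fi i1 i2; have mf := integrable_measurable fi.
have m1 := integrable_measurable i1; have m2 := integrable_measurable i2.
have mc := measurable_cos_transform mf; have ms := measurable_sin_transform mf.
pose F (z : R * R) := f z.1 *
  (p1 z.2 * cos ((u - z.1) * z.2) + p2 z.2 * sin ((u - z.1) * z.2)).
have mF : measurable_fun setT F.
  apply: measurable_funM; first exact: (measurableT_comp mf).
  apply: measurable_funD; apply: measurable_funM.
  - exact: (measurableT_comp m1).
  - by apply: measurable_cos_fun; apply: measurable_funM => //; exact: measurable_funB.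
  - exact: (measurableT_comp m2).
  - by apply: measurable_sin_fun; apply: measurable_funM => //; exact: measurable_funB.
have i3 x : mu.-integrable setT (EFin \o (fun t => p1 t * cos ((u - x) * t) + p2 t * sin ((u - x) * t))).
  by apply: integrable_add => //; [exact: integrable_cos|exact: integrable_sin].
have F1 x : mu.-integrable setT (EFin \o (fun t => F (x, t))).
  exact: (integrable_scale (f x) measurableT (i3 x)).
have b1 a b c s : `|a * cos c + b * sin s| <= `|a| + `|b| :> R.
  rewrite (le_trans (ler_normD _ _))// !normrM.
  by apply: lerD; rewrite ler_piMr// ?norm_cos_le1 ?norm_sin_le1.
have F2 t : mu.-integrable setT (EFin \o (fun x => F (x, t))).
  have m3 : measurable_fun setT (fun x : R => p1 t * cos ((u - x) * t) + p2 t * sin ((u - x) * t)).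
    apply: measurable_funD; apply: measurable_funM => //.
    - by apply: measurable_cos_fun; apply: measurable_funM => //; exact: measurable_funB.
    - by apply: measurable_sin_fun; apply: measurable_funM => //; exact: measurable_funB.
  exact: (integrable_bounded_mul fi m3 (fun x => b1 _ _ _ _)).
have in1 := integrable_norm i1; have in2 := integrable_norm i2.
have F12 : mu.-integrable setT (EFin \o (fun x => \int[mu]_t `|F (x, t)|)).
  have fi' := integrable_scale (\int[mu]_t (`|p1 t| + `|p2 t|)) measurableT (integrable_norm fi).
  apply: (integrable_le _ _ fi') => //.
    by apply: (@measurable_Rintegral_param _ (fun z => `|F z|)); exact: measurableT_comp.
  move=> x _; rewrite ger0_norm; last by apply: Rintegral_ge0 => y _.
  rewrite /F/=; under [leLHS]eq_Rintegral do rewrite normrM.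
  rewrite RintegralZl//; last exact: integrable_norm (i3 x).
  rewrite mulrC ler_wpM2r//; apply: le_Rintegral => //.
  - exact: integrable_norm (i3 x).
  - exact: integrable_add.
have ic1 := integrable_bounded_mul i1 mc (fun t => cos_transform_le t fi).
have is1 := integrable_bounded_mul i1 ms (fun t => sin_transform_le t fi).
have ic2 := integrable_bounded_mul i2 mc (fun t => cos_transform_le t fi).
have is2 := integrable_bounded_mul i2 ms (fun t => sin_transform_le t fi).
transitivity (\int[mu]_x \int[mu]_t F (x, t)).
  apply: eq_Rintegral => x _; rewrite /F/= (RintegralZl _ _ (i3 x))//.
  by rewrite RintegralD//; [exact: integrable_cos|exact: integrable_sin].
rewrite (Rintegral_fubini mF F1 F2 F12).
set h1 := fun t => _ - _; set h2 := fun t => _ + _.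
rewrite -[cos_transform h1 u]/(\int[mu]_t (h1 t * cos (u * t))).
rewrite -[sin_transform h2 u]/(\int[mu]_t (h2 t * sin (u * t))).
rewrite -RintegralD//; last 2 first.
- by apply: integrable_cos; exact: integrable_sub.
- by apply: integrable_sin; exact: integrable_add.
apply: eq_Rintegral => t _; rewrite /F/=.
transitivity (\int[mu]_x (f x * ((p1 t * cos (u * t) + p2 t * sin (u * t)) * cos (t * x)
   + (p1 t * sin (u * t) - p2 t * cos (u * t)) * sin (t * x)))).
  by apply: eq_Rintegral => x _; rewrite mulrBl cosB sinB (mulrC x t); ring.
by rewrite cos_sin_transformD// /h1 /h2; ring.
Qed.

(** One factor [16 * pi] for each use of Bessel's inequality, [M ^+ 2] for the multiplication by the
    signal in between, and 2 for the square of a sum. *)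
Definition multiplier_const (M : R) : R := 2 * (16 * pi) * (M ^+ 2 * (16 * pi)).

(** Transform, multiply by a function bounded by [M], transform again: each operation is bounded on
    L2. Integrability of [p1] and [p2] gives meaning to the formulas but leaves no trace in the
    constant, so the time window can later be made arbitrarily long. *)
Lemma conv_transform_bounded f p1 p2 (M : R) : sqint f ->
  mu.-integrable setT (EFin \o f) ->
  mu.-integrable setT (EFin \o p1) -> mu.-integrable setT (EFin \o p2) ->
  (forall t, p1 t ^+ 2 + p2 t ^+ 2 <= M ^+ 2) ->
  let G := fun w => cos_transform p1 w + sin_transform p2 w in
  sqint (conv f G) /\ nsq (conv f G) <= multiplier_const M * nsq f.
Proof.
move=> sf fi i1 i2 pM G.
have p0 : (0 : R) < pi := pi_gt0 R.
have ar (P a b c d x y : R) : 0 <= b -> 0 <= c -> a + b <= P * x -> c + d <= P * y ->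
    2 * (a + d) <= 2 * P * (x + y) by lra.
have p32 : 0 <= 2 * (16 * pi) :> R by lra.
have ar1 (a b c : R) : a + b <= c -> 0 <= b -> a <= c by lra.
have ar2 (a b c : R) : a + b <= c -> 0 <= a -> b <= c by lra.
have m1 := integrable_measurable i1; have m2 := integrable_measurable i2.
have [sc ss cs] := bessel sf fi; have [mc ci] := sc; have [ms si] := ss.
pose h1 t := p1 t * cos_transform f t - p2 t * sin_transform f t.
pose h2 t := p1 t * sin_transform f t + p2 t * cos_transform f t.
have -> : conv f G = fun u => cos_transform h1 u + sin_transform h2 u.
  by apply/funext => u; exact: conv_transform.
have sq_p p a : measurable_fun setT p -> (forall t, p t ^+ 2 <= M ^+ 2) -> sqint a ->
    sqint (fun t => p t * a t).
  move=> mp pM' sa; apply: (sqint_dominated _ (sqint_scale M sa)).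
    by apply: measurable_funM => //; case: sa.
  move=> t; rewrite !normrM ler_wpM2r// -(@ler_pXn2r _ 2%N)// ?nnegrE//.
  by rewrite !real_normK ?num_real.
have p1M t : p1 t ^+ 2 <= M ^+ 2 by exact: ar1 (pM t) (sqr_ge0 _).
have p2M t : p2 t ^+ 2 <= M ^+ 2 by exact: ar2 (pM t) (sqr_ge0 _).
have s1 : sqint h1 by apply: sqint_sub; exact: sq_p.
have s2 : sqint h2 by apply: sqint_add; exact: sq_p.
have i_h1 : mu.-integrable setT (EFin \o h1).
  apply: integrable_sub => //.
    exact: (integrable_bounded_mul i1 mc (fun t => cos_transform_le t fi)).
  exact: (integrable_bounded_mul i2 ms (fun t => sin_transform_le t fi)).
have i_h2 : mu.-integrable setT (EFin \o h2).
  apply: integrable_add => //.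
    exact: (integrable_bounded_mul i1 ms (fun t => sin_transform_le t fi)).
  exact: (integrable_bounded_mul i2 mc (fun t => cos_transform_le t fi)).
have [sc1 ss1 b1] := bessel s1 i_h1; have [sc2 ss2 b2] := bessel s2 i_h2.
split; first exact: sqint_add.
apply: (le_trans (nsq_add_le sc1 ss2)).
(* [h1] and [h2] are the real and imaginary parts of a product, so the sum of their squares is the
   product of the squared moduli. *)
have h12 : nsq h1 + nsq h2 <= M ^+ 2 * (nsq (cos_transform f) + nsq (sin_transform f)).
  rewrite /nsq -!RintegralD// ?s1.2 ?s2.2// -RintegralZl//; last exact: integrable_add.
  apply: le_Rintegral => //.
  - by apply: integrable_add => //; [exact: s1.2|exact: s2.2].
  - by apply: integrable_scale => //; exact: integrable_add.
  move=> t _; rewrite /h1 /h2.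
  have := ler_wpM2r (addr_ge0 (sqr_ge0 (cos_transform f t)) (sqr_ge0 (sin_transform f t))) (pM t).
  by apply: le_trans; rewrite le_eqVlt; apply/orP; left; apply/eqP; ring.
have n1 := nsq_ge0 (sin_transform h1); have n2 := nsq_ge0 (cos_transform h2).
apply: (@le_trans _ _ (2 * (16 * pi) * (nsq h1 + nsq h2))); first exact: ar b1 b2.
rewrite /multiplier_const -(mulrA _ _ (nsq f)); apply: (ler_wpM2l p32).
apply: (le_trans h12); rewrite -mulrA ler_wpM2l ?sqr_ge0//.
Qed.

Lemma multiplier_const_ge0 (M : R) : 0 <= multiplier_const M.
Proof.
have p0 : (0 : R) < pi := pi_gt0 R.
have := sqr_ge0 M; rewrite /multiplier_const; move: p0 (M ^+ 2) => p0 a a0; have := mulr_ge0 a0 (ltW (mulr_gt0 p0 p0)); nra.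
Qed.

(** By Cauchy-Schwarz, L2 convergence of the kernels gives convergence of [conv f (G_ n)] at each
    point, and Fatou keeps the common constant. *)
Lemma bounded_conv_lim (C : R) (G_ : nat -> R -> R) g : 0 <= C -> sqint g ->
  (forall n, sqint (G_ n)) ->
  nsq (fun x => g x - G_ n x) @[n --> \oo] --> 0 ->
  (forall n f, sqint f -> mu.-integrable setT (EFin \o f) ->
    sqint (conv f (G_ n)) /\ nsq (conv f (G_ n)) <= C * nsq f) ->
  bounded_conv C g.
Proof.
move=> C0 sg sG G0 H; apply: bounded_conv_ext => // f sf fi.
have [mf _] := sf; have [mg _] := sg.
have cv u : conv f (G_ n) u @[n --> \oo] --> conv f g u.
  have d0 : conv f (fun x => g x - G_ n x) u @[n --> \oo] --> 0.
    apply: (@cvg0_sq_le _ _ (fun n => nsq f * nsq (fun x => g x - G_ n x))).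
      by move=> n; apply: conv_sq_le => //; exact: sqint_sub.
    have c : nsq f * nsq (fun x => g x - G_ n x) @[n --> \oo] --> nsq f * 0.
      by apply: cvgM => //; exact: cvg_cst.
    by rewrite mulr0 in c.
  have c : conv f g u - conv f (fun x => g x - G_ n x) u @[n --> \oo] --> conv f g u - 0.
    by apply: cvgB => //; exact: cvg_cst.
  rewrite subr0 in c.
  have E n : conv f (G_ n) u = conv f g u - conv f (fun x => g x - G_ n x) u.
    rewrite /conv -RintegralB//; last 2 first.
    - exact: conv_integrable.
    - exact: (conv_integrable u sf (sqint_sub sg (sG n))).
    by apply: eq_Rintegral => x _; ring.
  by under eq_fun do rewrite E.
have [] := @Rintegral_fatou _ _ _ mu setT (fun n w => conv f (G_ n) w ^+ 2)
  (fun w => conv f g w ^+ 2) (C * nsq f) => //.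
- by move=> n; have [[]] := H n _ sf fi.
- by move=> n x _; exact: sqr_ge0.
- by move=> x _; rewrite expr2; under eq_fun do rewrite expr2; exact: cvgM.
- by move=> n; have [_] := H n _ sf fi.
- by move=> i le; split => //; split => //; exact: measurable_conv.
Qed.

End Multipliers.

Local Open Scope complex_scope.

(** * Spectra of bounded complex signals *)

Section FourierL2.
Context {R : realType}.
Notation mu := (@lebesgue_measure R).
Notation Re := (@complex.Re R).
Notation Im := (@complex.Im R).

Lemma ReM (a b : R[i]) : Re (a * b) = Re a * Re b - Im a * Im b.
Proof. by case: a => ? ?; case: b. Qed.

Lemma ImM (a b : R[i]) : Im (a * b) = Re a * Im b + Im a * Re b.
Proof. by case: a => ? ?; case: b. Qed.

Lemma ReB (a b : R[i]) : Re (a - b) = Re a - Re b.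
Proof. by case: a => ? ?; case: b. Qed.

Lemma ImB (a b : R[i]) : Im (a - b) = Im a - Im b.
Proof. by case: a => ? ?; case: b. Qed.

Lemma L2_sqint (Q : R -> R[i]) : L2 Q -> sqint (Re \o Q) /\ sqint (Im \o Q).
Proof.
move=> [mr [mi qi]]; split; split => //;
  (apply: (integrable_le _ _ qi) => //; first exact: measurable_funX) => x _;
  by rewrite ger0_norm ?sqr_ge0// /sqn ?lerDl ?lerDr ?sqr_ge0.
Qed.

Lemma cabs_sqn_le (z : R[i]) (M : R) : cabs z <= M -> Re z ^+ 2 + Im z ^+ 2 <= M ^+ 2.
Proof.
have s0 : 0 <= Re z ^+ 2 + Im z ^+ 2 by rewrite addr_ge0 ?sqr_ge0.
move=> zM; rewrite -(sqr_sqrtr s0) ler_pXn2r ?nnegrE ?sqrtr_ge0//.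
exact: le_trans (sqrtr_ge0 _) zM.
Qed.

Definition window_part (q : R -> R) (T : R) : R -> R := q \_ `[- T, T].

Section Truncated.
Variables (q : R -> R[i]) (M T : R).
Hypothesis qi : forall w, cintegrable `[- T, T] (fun t => q t * cexpmi (w * t)).
Hypothesis qM : forall t, cabs (q t) <= M.

Let p1 := window_part (Re \o q) T.
Let p2 := window_part (Im \o q) T.

Lemma integrable_window_part1 : mu.-integrable setT (EFin \o p1).
Proof.
(* At frequency 0 the modulation is trivial, so the hypothesis becomes integrability of the signal
   itself. *)
have [+ _] := qi 0; rewrite /p1 /window_part -restrict_EFin => h.
apply/integrable_restrict => //; rewrite setTI.
move: h; congr (_.-integrable _ _); apply/funext => t /=.
by rewrite ReM/= mul0r cos0 sin0 mulr1 oppr0 mulr0 subr0.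
Qed.

Lemma integrable_window_part2 : mu.-integrable setT (EFin \o p2).
Proof.
have [_ +] := qi 0; rewrite /p2 /window_part -restrict_EFin => h.
apply/integrable_restrict => //; rewrite setTI.
move: h; congr (_.-integrable _ _); apply/funext => t /=.
by rewrite ImM/= mul0r cos0 sin0 mulr1 oppr0 mulr0 add0r.
Qed.

Lemma window_part_bound t : p1 t ^+ 2 + p2 t ^+ 2 <= M ^+ 2.
Proof.
rewrite /p1 /p2 /window_part !patchE; case: ifPn => _; first exact: cabs_sqn_le.
by rewrite expr0n addr0 sqr_ge0.
Qed.

Lemma integrable_window_partN1 : mu.-integrable setT (EFin \o (fun t => - p1 t)).
Proof. by apply: integrable_opp => //; exact: integrable_window_part1. Qed.

Lemma Re_truncFT w : Re (truncFT q T w) = cos_transform p1 w + sin_transform p2 w.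
Proof.
have i1 := integrable_window_part1; have i2 := integrable_window_part2.
rewrite /truncFT/= Rintegral_mkcond /cos_transform /sin_transform -RintegralD//; last 2 first.
- exact: integrable_cos.
- exact: integrable_sin.
apply: eq_Rintegral => t _; rewrite /p1 /p2 /window_part !patchE; case: ifPn => _.
  by rewrite ReM/= mulrN opprK.
by rewrite !mul0r addr0.
Qed.

(** The imaginary part of the transform of [q] is the real part of the transform of [- j q], whose
    components are [p2] and [- p1]. This puts both parts under [conv_transform_bounded]. *)
Lemma Im_truncFT w : Im (truncFT q T w) =
  cos_transform p2 w + sin_transform (fun t => - p1 t) w.
Proof.
have i1 := integrable_window_partN1; have i2 := integrable_window_part2.
rewrite /truncFT/= Rintegral_mkcond /cos_transform /sin_transform -RintegralD//; last 2 first.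
- exact: integrable_cos.
- exact: integrable_sin.
apply: eq_Rintegral => t _; rewrite /p1 /p2 /window_part !patchE; case: ifPn => _.
  by rewrite ImM/= mulrN mulNr addrC.
by rewrite oppr0 !mul0r addr0.
Qed.

(** A function that is integrable and bounded by [M] has its square dominated by [M] times its
    modulus. *)
Lemma sqint_window_part : sqint p1 /\ sqint p2.
Proof.
have i1 := integrable_window_part1; have i2 := integrable_window_part2.
have M0 : 0 <= M by apply: le_trans (qM 0); exact: sqrtr_ge0.
have bd p : p ^+ 2 <= M ^+ 2 -> `|p ^+ 2| <= M * `|p| :> R.
  move=> pM; rewrite normrX expr2 ler_wpM2r// -(@ler_pXn2r _ 2%N)// ?nnegrE//.
  by rewrite real_normK ?num_real.
split; split.
- exact: integrable_measurable i1.
- have i1' := integrable_scale M measurableT (integrable_norm i1).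
  apply: (integrable_le _ _ i1') => //.
    by apply: measurable_funX; exact: integrable_measurable i1.
  move=> t _; apply: bd.
  by have := window_part_bound t; have := sqr_ge0 (p2 t); lra.
- exact: integrable_measurable i2.
- have i2' := integrable_scale M measurableT (integrable_norm i2).
  apply: (integrable_le _ _ i2') => //.
    by apply: measurable_funX; exact: integrable_measurable i2.
  move=> t _; apply: bd.
  by have := window_part_bound t; have := sqr_ge0 (p1 t); lra.
Qed.

Lemma sqint_truncFT : sqint (Re \o truncFT q T) /\ sqint (Im \o truncFT q T).
Proof.
have [s1 s2] := sqint_window_part.
have i1 := integrable_window_part1; have i2 := integrable_window_part2.
have [c1 n1 _] := bessel s1 i1; have [c2 n2 _] := bessel s2 i2.
have -> : Re \o truncFT q T = fun w => cos_transform p1 w + sin_transform p2 w.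
  by apply/funext => w /=; exact: Re_truncFT.
have -> : Im \o truncFT q T = fun w => cos_transform p2 w + -1 * sin_transform p1 w.
  apply/funext => w; rewrite [LHS]Im_truncFT; congr (_ + _).
  rewrite /sin_transform -RintegralZl//; last exact: integrable_sin.
  by apply: eq_Rintegral => t _; rewrite mulN1r mulNr.
by split; apply: sqint_add => //; exact: sqint_scale.
Qed.

Lemma truncFT_bounded (f : R -> R) : sqint f -> mu.-integrable setT (EFin \o f) ->
  (sqint (conv f (Re \o truncFT q T)) /\
   nsq (conv f (Re \o truncFT q T)) <= multiplier_const M * nsq f) /\
  (sqint (conv f (Im \o truncFT q T)) /\
   nsq (conv f (Im \o truncFT q T)) <= multiplier_const M * nsq f).
Proof.
move=> sf fi.
have i1 := integrable_window_part1; have i2 := integrable_window_part2.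
have -> : Re \o truncFT q T = fun w => cos_transform p1 w + sin_transform p2 w.
  by apply/funext => w /=; exact: Re_truncFT.
have -> : Im \o truncFT q T = fun w => cos_transform p2 w + sin_transform (fun t => - p1 t) w.
  by apply/funext => w /=; exact: Im_truncFT.
split; apply: conv_transform_bounded => //.
- exact: window_part_bound.
- exact: integrable_window_partN1.
- by move=> t; rewrite sqrrN addrC; exact: window_part_bound.
Qed.

End Truncated.

(** The truncated transforms obey one bound for all windows, as it depends on the signal only
    through [M], and they converge to [Q] in L2. *)
Lemma is_FT_bounded_conv (q Q : R -> R[i]) (M : R) : L2 Q -> is_FT q Q ->
  (forall t, cabs (q t) <= M) ->
  bounded_conv (multiplier_const M) (Re \o Q) /\
  bounded_conv (multiplier_const M) (Im \o Q).
Proof.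
move=> LQ [qi qcv] qM; have [sR sI] := L2_sqint LQ.
have sT n := sqint_truncFT (qi n%:R) qM.
have dist0 : (L2dist2 (truncFT q n%:R) Q @[n --> \oo] --> 0)%E.
  apply: (cvg_comp (fun n : nat => n%:R : R) (fun T => L2dist2 (truncFT q T) Q)) qcv.
  exact: cvgr_idn.
have lim0 (P : R[i] -> R) : (forall n, sqint (fun x => P (Q x) - P (truncFT q n%:R x))) ->
    (forall a b, (P b - P a) ^+ 2 <= sqn (a - b)) ->
    nsq (fun x => P (Q x) - P (truncFT q n%:R x)) @[n --> \oo] --> 0.
  move=> sP Ple.
  have H : ((nsq (fun x => P (Q x) - P (truncFT q n%:R x)))%:E @[n --> \oo] --> 0)%E.
    apply: (@squeeze_cvge _ _ _ _ (fun=> 0%E) _ (fun n => L2dist2 (truncFT q n%:R) Q)) => //.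
    - apply: nearW => n; rewrite lee_fin nsq_ge0/= /nsq integrable_fineK//; last exact: (sP n).2.
      rewrite /L2dist2; apply: ge0_le_integral => //.
      + by move=> x _; rewrite lee_fin sqr_ge0.
      + exact: measurable_int (sP n).2.
      + apply/measurable_EFinP; rewrite /sqn.
        have [[m1 _] [m2 _]] := sT n; have [m3 _] := sR; have [m4 _] := sI.
        apply: measurable_funD; apply: measurable_funX.
          by under eq_fun do rewrite ReB; exact: measurable_funB.
        by under eq_fun do rewrite ImB; exact: measurable_funB.
      + by move=> x _; rewrite lee_fin.
    - exact: cvg_cst.
  exact: (fine_cvg H).
split; [apply: (bounded_conv_lim (G_ := fun n => Re \o truncFT q n%:R))|
        apply: (bounded_conv_lim (G_ := fun n => Im \o truncFT q n%:R))] => //.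
- exact: multiplier_const_ge0.
- by move=> n; have [] := sT n.
- apply: (lim0 Re) => [n|a b]; first by apply: sqint_sub => //; have [] := sT n.
  by rewrite /sqn ReB -sqrrN opprB lerDl sqr_ge0.
- by move=> n f sf fi; exact: (truncFT_bounded (qi n%:R) qM sf fi).1.
- exact: multiplier_const_ge0.
- by move=> n; have [] := sT n.
- apply: (lim0 Im) => [n|a b]; first by apply: sqint_sub => //; have [] := sT n.
  by rewrite /sqn ImB -sqrrN opprB lerDr sqr_ge0.
- by move=> n f sf fi; exact: (truncFT_bounded (qi n%:R) qM sf fi).2.
Qed.

End FourierL2.

(** * The nonlinear term *)

Section NonlinearTerm.
Context {R : realType}.
Notation mu := (@lebesgue_measure R).
Notation Re := (@complex.Re R).
Notation Im := (@complex.Im R).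
Implicit Types (f g r s : R -> R).

Lemma convDr f r s w : sqint f -> sqint r -> sqint s ->
  conv f (fun x => r x + s x) w = conv f r w + conv f s w.
Proof.
move=> sf sr ss; rewrite /conv -RintegralD//; try exact: conv_integrable.
by apply: eq_Rintegral => x _; rewrite mulrDr.
Qed.

Lemma bounded_convD (C : R) r s : sqint r -> sqint s ->
  bounded_conv C r -> bounded_conv C s ->
  bounded_conv (4 * C) (fun x => r x + s x).
Proof.
move=> sr ss [C0 Hr] [_ Hs]; split; first by lra.
move=> f sf; have [s1 n1] := Hr _ sf; have [s2 n2] := Hs _ sf.
have -> : conv f (fun x => r x + s x) = fun w => conv f r w + conv f s w.
  by apply/funext => w; exact: convDr.
split; first exact: sqint_add.
apply: le_trans (nsq_add_le s1 s2) _.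
by move: (nsq (conv f r)) (nsq (conv f s)) (nsq f) n1 n2 => a b c; clear; lra.
Qed.

Lemma bounded_convN (C : R) r : sqint r ->
  bounded_conv C r -> bounded_conv C (fun x => -1 * r x).
Proof.
move=> sr [C0 Hr]; split; [exact: C0|move=> f sf]; have [s1 n1] := Hr _ sf.
have -> : conv f (fun x => -1 * r x) = fun w => -1 * conv f r w.
  apply/funext => w; rewrite /conv -RintegralZl//; last exact: conv_integrable.
  by apply: eq_Rintegral => x _; ring.
by split; [exact: sqint_scale|rewrite nsq_scale// sqrrN expr1n mul1r].
Qed.

Lemma corr_opp f g v : sqint f -> sqint g -> corr f g (0 - v) = corr g f v.
Proof.
move=> sf sg; rewrite /corr -(Rintegral_shift v (corr_integrable (0 - v) sf sg)).
by apply: eq_Rintegral => x _; rewrite mulrC; congr (g _ * f _); ring.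
Qed.

Lemma norm_le_of_sq (x B : R) : 0 <= B -> x ^+ 2 <= B ^+ 2 -> `|x| <= B.
Proof.
by move=> B0 xB; rewrite -(@ler_pXn2r _ 2%N)// ?nnegrE// real_normK ?num_real.
Qed.

Lemma corr_norm_le f g v (E : R) : sqint f -> sqint g -> nsq f <= E -> nsq g <= E ->
  `|corr f g v| <= E.
Proof.
move=> sf sg fE gE; have f0 := nsq_ge0 f; have g0 := nsq_ge0 g.
apply: norm_le_of_sq; first exact: le_trans fE.
apply: le_trans (corr_sq_le v sf sg) _; rewrite expr2; exact: ler_pM.
Qed.

Section Fixed.
Variables (Q : R -> R[i]) (C : R).
Let Q1 := Re \o Q.
Let Q2 := Im \o Q.
Hypotheses (s1 : sqint Q1) (s2 : sqint Q2).
Hypotheses (b1 : bounded_conv C Q1) (b2 : bounded_conv C Q2).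
(* [R1 + j R2] is the autocorrelation of [Q]: [R1] is even and [R2] is odd. *)
Let R1 v := corr Q1 Q1 v + corr Q2 Q2 v.
Let R2 v := corr Q1 Q2 v + -1 * corr Q2 Q1 v.
Let E := nsq Q1 + nsq Q2.

(** In the inner integral [Q w1] factors out and the rest, integrated over [w2], is the
    autocorrelation at [w - w1]; what remains over [w1] is a convolution, here split into real
    parts. *)
Lemma Re_nlterm w : Re (nlterm Q w) = conv Q1 R1 w - conv Q2 R2 w.
Proof using s1 s2 b1 b2.
have [c11 _] := bounded_corr s1 s1 b1; have [c22 _] := bounded_corr s2 s2 b2.
have [c12 _] := bounded_corr s1 s2 b1; have [c21 _] := bounded_corr s2 s1 b2.
have sR1 : sqint R1 by exact: sqint_add.
have sR2 : sqint R2 by apply: sqint_add => //; exact: sqint_scale.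
rewrite /nlterm/= /conv -RintegralB//; try exact: conv_integrable.
apply: eq_Rintegral => w1 _ /=; rewrite /R1 /R2 /corr.
have i11 := corr_integrable (w - w1) s1 s1; have i22 := corr_integrable (w - w1) s2 s2.
have i12 := corr_integrable (w - w1) s1 s2; have i21 := corr_integrable (w - w1) s2 s1.
have i21' := integrable_scale (-1) measurableT i21.
rewrite -RintegralD// -(RintegralZl (-1) _ i21)// -RintegralD//.
have j1 := integrable_add measurableT i11 i22.
have j2 := integrable_add measurableT i12 i21'.
rewrite -(RintegralZl _ _ j1)// -(RintegralZl _ _ j2)// -RintegralB//;
  try exact: integrable_scale.
apply: eq_Rintegral => w2 _; rewrite /nlinner !(ReM, ImM) /Q1 /Q2 /=.
by case: (Q w1) => a b; case: (Q w2) => c d; case: (Q _) => e f /=; ring.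
Qed.

Lemma Im_nlterm w : Im (nlterm Q w) = conv Q1 R2 w + conv Q2 R1 w.
Proof using s1 s2 b1 b2.
have [c11 _] := bounded_corr s1 s1 b1; have [c22 _] := bounded_corr s2 s2 b2.
have [c12 _] := bounded_corr s1 s2 b1; have [c21 _] := bounded_corr s2 s1 b2.
have sR1 : sqint R1 by exact: sqint_add.
have sR2 : sqint R2 by apply: sqint_add => //; exact: sqint_scale.
rewrite /nlterm/= /conv -RintegralD//; try exact: conv_integrable.
apply: eq_Rintegral => w1 _ /=; rewrite /R1 /R2 /corr.
have i11 := corr_integrable (w - w1) s1 s1; have i22 := corr_integrable (w - w1) s2 s2.
have i12 := corr_integrable (w - w1) s1 s2; have i21 := corr_integrable (w - w1) s2 s1.
have i21' := integrable_scale (-1) measurableT i21.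
rewrite -RintegralD// -(RintegralZl (-1) _ i21)// -RintegralD//.
have j1 := integrable_add measurableT i11 i22.
have j2 := integrable_add measurableT i12 i21'.
rewrite -(RintegralZl _ _ j1)// -(RintegralZl _ _ j2)// -RintegralD//;
  try exact: integrable_scale.
apply: eq_Rintegral => w2 _; rewrite /nlinner !(ReM, ImM) /Q1 /Q2 /=.
by case: (Q w1) => a b; case: (Q w2) => c d; case: (Q _) => e f /=; ring.
Qed.

Let C0 : 0 <= C. Proof. by case: b1. Qed.
Let E1 : nsq Q1 <= E. Proof. by rewrite /E lerDl nsq_ge0. Qed.
Let E2 : nsq Q2 <= E. Proof. by rewrite /E lerDr nsq_ge0. Qed.

Lemma autocorrelation_bounds :
  [/\ sqint R1, sqint R2, bounded_conv (4 * (C * C)) R1, bounded_conv (4 * (C * C)) R2 &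
   nsq R1 <= 2 * C * E /\ nsq R2 <= 2 * C * E].
Proof using s1 s2 b1 b2.
have [c11 n11] := bounded_corr s1 s1 b1; have [c22 n22] := bounded_corr s2 s2 b2.
have [c12 n12] := bounded_corr s1 s2 b1; have [c21 n21] := bounded_corr s2 s1 b2.
have c21' : sqint (fun x => -1 * corr Q2 Q1 x) by exact: sqint_scale.
split; [exact: sqint_add|exact: sqint_add| | |split].
- by apply: bounded_convD => //; exact: bounded_conv_corr.
- by apply: bounded_convD => //; [|apply: bounded_convN => //]; exact: bounded_conv_corr.
- apply: le_trans (nsq_add_le c11 c22) _; rewrite /E.
  by move: (nsq (corr Q1 Q1)) (nsq (corr Q2 Q2)) (nsq Q1) (nsq Q2) n11 n22 => a b c d; clear n12 n21; lra.
- apply: le_trans (nsq_add_le c12 c21') _; rewrite nsq_scale// sqrrN expr1n mul1r /E.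
  by move: (nsq (corr Q1 Q2)) (nsq (corr Q2 Q1)) (nsq Q1) (nsq Q2) n12 n21 => a b c d; clear n11 n22; lra.
Qed.

Lemma nlterm_sqint : sqint (Re \o nlterm Q) /\ sqint (Im \o nlterm Q).
Proof using s1 s2 b1 b2.
have [sR1 sR2 [_ B1] [_ B2] _] := autocorrelation_bounds.
have -> : Re \o nlterm Q = fun w => conv Q1 R1 w - conv Q2 R2 w.
  by apply/funext => w; exact: Re_nlterm.
have -> : Im \o nlterm Q = fun w => conv Q1 R2 w + conv Q2 R1 w.
  by apply/funext => w; exact: Im_nlterm.
split; [apply: sqint_sub|apply: sqint_add].
- by have [] := B1 _ s1.
- by have [] := B2 _ s2.
- by have [] := B2 _ s1.
- by have [] := B1 _ s2.
Qed.

(** The bound is linear in the energy although the term is cubic: the other two factors are absorbed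
    by the operator constant [C], hence by the bound on the signal. *)
Lemma nlterm_nsq_le :
  nsq (Re \o nlterm Q) + nsq (Im \o nlterm Q) <= 16 * (C * C) * E.
Proof using s1 s2 b1 b2.
have [sR1 sR2 [_ B1] [_ B2] _] := autocorrelation_bounds.
have -> : Re \o nlterm Q = fun w => conv Q1 R1 w + -1 * conv Q2 R2 w.
  by apply/funext => w; rewrite mulN1r; exact: Re_nlterm.
have -> : Im \o nlterm Q = fun w => conv Q1 R2 w + conv Q2 R1 w.
  by apply/funext => w; exact: Im_nlterm.
have [t11 n11] := B1 _ s1; have [t22 n22] := B2 _ s2.
have [t12 n12] := B2 _ s1; have [t21 n21] := B1 _ s2.
have := nsq_add_le t11 (sqint_scale (-1) t22); rewrite nsq_scale// sqrrN expr1n mul1r.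
have := nsq_add_le t12 t21; rewrite /E.
move: (nsq (conv Q1 R1)) (nsq (conv Q2 R2)) (nsq (conv Q1 R2)) (nsq (conv Q2 R1))
  n11 n22 n12 n21 => a b c d.
move: (nsq (fun _ => _ + _)) (nsq (fun _ => _ + _)) (nsq Q1) (nsq Q2) => x y z t.
lra.
Qed.

(** Cauchy-Schwarz in each convolution gives a bound uniform in [w]. It supplies the pointwise
    majorant needed to differentiate in [z] under the integral over frequencies. *)
Lemma nlterm_sup_le w :
  Re (nlterm Q w) ^+ 2 <= 8 * C * (E * E) /\ Im (nlterm Q w) ^+ 2 <= 8 * C * (E * E).
Proof using s1 s2 b1 b2.
have [sR1 sR2 _ _ [nR1 nR2]] := autocorrelation_bounds.
have e0 := nsq_ge0 Q1; have e0' := nsq_ge0 Q2.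
have key f r : sqint f -> sqint r -> nsq f <= E -> nsq r <= 2 * C * E ->
    conv f r w ^+ 2 <= 2 * C * (E * E).
  move=> sf sr fE rE; apply: le_trans (conv_sq_le w sf sr) _.
  have -> : 2 * C * (E * E) = E * (2 * C * E) by ring.
  by apply: ler_pM => //; exact: nsq_ge0.
have k11 := key _ _ s1 sR1 E1 nR1; have k22 := key _ _ s2 sR2 E2 nR2.
have k12 := key _ _ s1 sR2 E1 nR2; have k21 := key _ _ s2 sR1 E2 nR1.
rewrite Re_nlterm Im_nlterm.
have ar (a b c : R) : a ^+ 2 <= c -> b ^+ 2 <= c ->
    (a - b) ^+ 2 <= 4 * c /\ (a + b) ^+ 2 <= 4 * c.
  by move=> ac bc; have := sqr_ge0 (a + b); have := sqr_ge0 (a - b); nra.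
have -> : 8 * C * (E * E) = 4 * (2 * C * (E * E)) by ring.
by split; [exact: (ar _ _ _ k11 k22).1|exact: (ar _ _ _ k12 k21).2].
Qed.

(** Convolutions are moved across the inner product: the two cross terms with the even kernel [R1]
    are equal and cancel, while each diagonal term with the odd kernel [R2] equals its own
    opposite. *)
Lemma nlterm_conserves :
  \int[mu]_w (Q2 w * Re (nlterm Q w) - Q1 w * Im (nlterm Q w)) = 0.
Proof using s1 s2 b1 b2.
have ar (a b c : R) : a = -1 * a -> b = -1 * b -> (c - b) - (a + c) = 0 by lra.
have [sR1 sR2 B1 B2 _] := autocorrelation_bounds.
have [_ H1] := B1; have [_ H2] := B2.
have [t11 n11] := H1 _ s1; have [t22 n22] := H2 _ s2.
have [t12 n12] := H2 _ s1; have [t21 n21] := H1 _ s2.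
have bR1 v : `|R1 v| <= 2 * E.
  apply: le_trans (ler_normD _ _) _.
  by rewrite mulr_natl mulr2n lerD// corr_norm_le.
have bR2 v : `|R2 v| <= 2 * E.
  apply: le_trans (ler_normD _ _) _; rewrite normrM normrN1 mul1r.
  by rewrite mulr_natl mulr2n lerD// corr_norm_le.
have ev v : R1 (0 - v) = 1 * R1 v by rewrite /R1 !corr_opp// mul1r.
have od v : R2 (0 - v) = -1 * R2 v by rewrite /R2 !corr_opp//; ring.
have S1 := conv_sym sR1 B1 bR1 ev s1 s2.
have S2 := conv_sym sR2 B2 bR2 od s1 s1.
have S3 := conv_sym sR2 B2 bR2 od s2 s2.
have i211 := sqint_mul s2 t11; have i222 := sqint_mul s2 t22.
have i112 := sqint_mul s1 t12; have i121 := sqint_mul s1 t21.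
have -> : \int[mu]_w (Q2 w * Re (nlterm Q w) - Q1 w * Im (nlterm Q w)) =
  (\int[mu]_w (Q2 w * conv Q1 R1 w) - \int[mu]_w (Q2 w * conv Q2 R2 w)) -
  (\int[mu]_w (Q1 w * conv Q1 R2 w) + \int[mu]_w (Q1 w * conv Q2 R1 w)).
  have j1 := integrable_sub measurableT i211 i222.
  have j2 := integrable_add measurableT i112 i121.
  rewrite -RintegralB// -RintegralD// -RintegralB//.
  by apply: eq_Rintegral => w _; rewrite Re_nlterm Im_nlterm; ring.
by rewrite S1 mul1r; exact: ar.
Qed.

End Fixed.
End NonlinearTerm.

(** * Fundamental theorem of calculus and energy balance *)

Section LipschitzFTC.
Context {R : realType}.
Notation mu := (@lebesgue_measure R).

Lemma is_derive_seq (u : R -> R) (x d : R) (h : nat -> R) :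
  is_derive x 1 u d -> (forall n, h n != 0) -> h n @[n --> \oo] --> 0 ->
  (u (x + h n) - u x) / h n @[n --> \oo] --> d.
Proof.
move=> [du <-] h0 hcv.
have := du; rewrite /derivable => /cvg_ex[/= l ul].
have -> : 'D_1 u x = l by exact: cvg_lim ul.
rewrite (_ : (fun n => _) = (fun n => (h n)^-1 *: (u (h n *: 1 + x) - u x))).
  exact: ((cvgr_dnbhsP _ _ _).1 ul h (conj h0 hcv)).
by apply/funext => n /=; rewrite scaler1 [h n + x]addrC /GRing.scale/= mulrC.
Qed.

Lemma lipschitz_continuous (v : R -> R) (L : R) :
  (forall x y, `|v x - v y| <= L * `|x - y|) -> continuous v.
Proof.
move=> vL x; apply/cvgrPdist_lt => e e0.
have L1 : 0 < `|L| + 1 by rewrite ltr_wpDl.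
near=> y; rewrite (le_lt_trans (vL x y))//.
rewrite (@le_lt_trans _ _ ((`|L| + 1) * `|x - y|))//.
  by rewrite ler_wpM2r// (le_trans (ler_norm _))// lerDl.
rewrite mulrC -ltr_pdivlMr//.
near: y; apply: (@cvgr_dist_lt _ _ _ _ _ id); first exact: cvg_id.
by rewrite divr_gt0.
Unshelve. all: by end_near. Qed.

(** Projection onto [[s, t]]: composing with it extends a function by its end values and keeps its
    Lipschitz constant. *)
Definition clamp (s t x : R) : R := if x <= s then s else if t <= x then t else x.

Lemma clamp_itv s t x : s <= t -> s <= clamp s t x <= t.
Proof.
move=> st; rewrite /clamp; case: ifPn => [|xs]; first by rewrite lexx st.
case: ifPn => [|xt]; first by rewrite lexx st.
by move: xs xt; rewrite -!ltNge => /ltW -> /ltW ->.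
Qed.

Lemma clamp_id s t x : s <= x <= t -> clamp s t x = x.
Proof.
move=> /andP[sx xt]; rewrite /clamp; case: ifPn => xs; first lra.
by case: ifPn => // tx; lra.
Qed.

Lemma clamp_lip s t x y : s <= t -> `|clamp s t x - clamp s t y| <= `|x - y|.
Proof.
move=> st; rewrite /clamp.
have [xs|xs] := leP x s; have [ys|ys] := leP y s;
  have [tx|tx] := leP t x; have [ty|ty] := leP t y;
  rewrite ?subrr ?normr0 ?normr_ge0//; rewrite ler_norml;
  have [xy|xy] := ger0P (x - y); apply/andP; split; lra.
Qed.

(** The derivative need not be continuous. Difference quotients are bounded by [L] and converge to
    [du], so dominated convergence applies; their integrals are explicit through a primitive of the
    extended function and tend to the boundary terms. *)
Lemma FTC_lipschitz (u du : R -> R) (s t L : R) : s < t ->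
  (forall x y, s <= x <= t -> s <= y <= t -> `|u x - u y| <= L * `|x - y|) ->
  (forall z, s < z < t -> is_derive z 1 u (du z)) ->
  mu.-integrable `]s, t[ (EFin \o du) /\ \int[mu]_(z in `]s, t[) du z = u t - u s.
Proof.
move=> st uL dud; have st' := ltW st.
have L0 : 0 <= L.
  have := uL s t; rewrite !lexx st' => /(_ isT isT) H.
  have : 0 <= L * `|s - t| by exact: le_trans H.
  by rewrite pmulr_lge0// normr_gt0 subr_eq0 lt_eqF.
pose v x := u (clamp s t x).
have vL x y : `|v x - v y| <= L * `|x - y|.
  apply: le_trans (uL _ _ (clamp_itv x st') (clamp_itv y st')) _.
  by rewrite ler_wpM2l// clamp_lip.
have cv := lipschitz_continuous vL.
have mv := continuous_measurable_fun cv.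
pose h n : R := n.+1%:R^-1.
have h_gt0 n : 0 < h n by rewrite invr_gt0.
have h_neq0 n : h n != 0 by rewrite gt_eqF.
have h_cv : h n @[n --> \oo] --> 0 by exact: cvg_harmonic.
have h_le1 n : h n <= 1 by rewrite invf_le1// ler1n.
pose D n x := (v (x + h n) - v x) / h n.
have mvh n : continuous (fun x => v (x + h n)).
  apply: (@lipschitz_continuous _ L) => x y; apply: le_trans (vL _ _) _.
  by rewrite le_eqVlt; apply/orP; left; apply/eqP; congr (_ * `|_|); ring.
have [dui lim1] : mu.-integrable `]s, t[ (EFin \o du) /\
    \int[mu]_(x in `]s, t[) D n x @[n --> \oo] --> \int[mu]_(x in `]s, t[) du x.
  apply: (@Rintegral_dominated _ _ _ mu _ _ _ (fun=> L)) => //.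
  - move=> n; apply: measurable_funTS; apply: measurable_funM => //.
    by apply: measurable_funB => //; exact: continuous_measurable_fun.
  - move=> x /=; rewrite in_itv/= => /andP[sx xt].
    have dx := dud x; rewrite sx xt in dx.
    apply: cvg_trans (is_derive_seq (dx isT) h_neq0 h_cv).
    apply: near_eq_cvg; near=> n; rewrite /D /v !clamp_id ?(ltW sx) ?(ltW xt)//=.
    apply/andP; split; first by rewrite (le_trans (ltW sx))// lerDl ltW.
    rewrite -lerBrDl; near: n.
    have tx : 0 < t - x by rewrite subr_gt0.
    have /cvgrPdist_lt/(_ _ tx) := h_cv; apply: filterS => n.
    by rewrite sub0r normrN gtr0_norm// => /ltW.
  - apply: (@integrableS _ _ _ mu `[s, t]) => //; first exact: subset_itv_oo_cc.
    by apply: continuous_integrable_itv => x; exact: cvg_cst.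
  - move=> n x _; rewrite /D normrM normfV (gtr0_norm (h_gt0 n)) ler_pdivrMr//.
    apply: le_trans (vL _ _) _.
    by rewrite [x + _]addrC addrK gtr0_norm.
split => //.
(* Starting at [s - 1] makes [s] an interior point; differentiability up to [t + 1] covers the
   points [t + h n]. *)
pose V x := \int[mu]_(y in `[s - 1, x]) v y.
have dV x : s <= x <= t + 1 -> is_derive x 1 V (v x).
  move=> /andP[sx xt].
  have xt2 : x < t + 2 by lra.
  have sx1 : s - 1 < x by lra.
  have [dd dE] := continuous_FTC1_closed xt2
    (continuous_integrable_itv (s - 1) (t + 2) cv) sx1 (cv x).
  by split => //; rewrite -derive1E.
have DE n : \int[mu]_(x in `]s, t[) D n x =
    (V (t + h n) - V t) / h n - (V (s + h n) - V s) / h n.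
  have cD : continuous (D n).
    by move=> x; apply: cvgM; [apply: cvgB; [exact: mvh|exact: cv]|exact: cvg_cst].
  have i1 := continuous_integrable_itv s t (mvh n).
  have i2 := continuous_integrable_itv s t cv.
  have i3 : mu.-integrable `[s, t] (EFin \o (fun x => v (x + h n) - v x)).
    exact: integrable_sub.
  have -> : \int[mu]_(x in `]s, t[) D n x = \int[mu]_(x in `[s, t]) D n x.
    have iD := continuous_integrable_itv s t cD.
    rewrite Rintegral_itv_obnd_cbnd; last first.
      by apply: integrableS iD => //; exact: subset_itv_oo_cc.
    rewrite Rintegral_itv_bndo_bndc//.
    by apply: integrableS iD => //; exact: subset_itv_co_cc.
  rewrite /D RintegralZr// RintegralB//.
  have -> : \int[mu]_(x in `[s, t]) v (x + h n) = V (t + h n) - V (s + h n).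
    apply: (@Rintegral_FTC _ (fun x => V (x + h n))) => // x /andP[sx xt].
    have dVx : is_derive (x + h n) 1 V (v (x + h n)).
      by apply: dV; have := h_gt0 n; have := h_le1 n; lra.
    have dsh : is_derive x 1 (fun y : R => y + h n) (1 : R).
      by apply: is_derive_eq; rewrite addr0.
    by have := @is_derive1_comp _ V (fun y => y + h n) x _ _ dVx dsh; rewrite mulr1.
  have -> : \int[mu]_(x in `[s, t]) v x = V t - V s.
    by apply: Rintegral_FTC => // x /andP[sx xt]; apply: dV; lra.
  by rewrite -mulrBl; congr (_ / _); ring.
have dVs : is_derive s 1 V (v s) by apply: dV; lra.
have dVt : is_derive t 1 V (v t) by apply: dV; lra.
have lim2 : \int[mu]_(x in `]s, t[) D n x @[n --> \oo] --> v t - v s.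
  under eq_fun do rewrite DE.
  by apply: cvgB; [exact: is_derive_seq dVt h_neq0 h_cv|exact: is_derive_seq dVs h_neq0 h_cv].
have E1 := cvg_lim (@Rhausdorff R) lim1; have E2 := cvg_lim (@Rhausdorff R) lim2.
by rewrite -E1 E2 /v !clamp_id ?lexx ?st'.
Unshelve. all: by end_near. Qed.

End LipschitzFTC.

(** * Energy balance over a set of frequencies *)

Section EnergyBalance.
Context {R : realType}.
Notation mu := (@lebesgue_measure R).

Lemma within_continuousS (f : R -> R) (s t x y : R) : s <= x -> y <= t ->
  {within `[s, t], continuous f} -> {within `[x, y], continuous f}.
Proof.
move=> sx yt; apply: continuous_subspaceW; apply: subset_itv; by rewrite bnd_simp.
Qed.

Lemma derivative_bound_lipschitz (f df : R -> R) (s t G : R) :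
  {within `[s, t], continuous f} ->
  (forall z, s < z < t -> is_derive z 1 f (df z)) ->
  (forall z, s < z < t -> `|df z| <= G) ->
  forall x y, s <= x <= t -> s <= y <= t -> `|f x - f y| <= G * `|x - y|.
Proof.
move=> cf dfd dfG.
have key x y : s <= x -> x < y -> y <= t -> `|f y - f x| <= G * `|y - x|.
  move=> sx xy yt.
  have dxy z : z \in `]x, y[ -> is_derive z 1 f (df z).
    rewrite in_itv/= => /andP[xz zy]; apply: dfd.
    by rewrite (le_lt_trans sx xz) (lt_le_trans zy yt).
  have [z] := MVT xy dxy (within_continuousS sx yt cf).
  rewrite in_itv/= => /andP[xz zy] ->; rewrite normrM ler_wpM2r// dfG//.
  by rewrite (le_lt_trans sx xz) (lt_le_trans zy yt).
move=> x y /andP[sx xt] /andP[sy yt].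
have [xy|yx|->] := ltgtP x y; last by rewrite !subrr normr0 mulr0.
  by rewrite distrC [`|x - y|]distrC key.
exact: key.
Qed.

(** The shift by 1 absorbs the affine bound: [expR (- c * x) * (p x + 1)] has nonpositive
    derivative, and the mean value theorem compares its values at [s] and [z]. *)
Lemma gronwall (p dp : R -> R) (s t c : R) :
  {within `[s, t], continuous p} ->
  (forall z, s < z < t -> is_derive z 1 p (dp z)) ->
  (forall z, s < z < t -> dp z <= c * (p z + 1)) ->
  forall z, s <= z <= t -> p z + 1 <= (p s + 1) * expR (c * (z - s)).
Proof.
move=> cp dpd dpc z /andP[sz zt].
have [<-|sltz] := eqVneq s z; first by rewrite subrr mulr0 expR0 mulr1.
have {}sltz : s < z by rewrite lt_neqAle sltz.
pose g x := expR (- c * x) * (p x + 1).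
pose dg x := expR (- c * x) * (dp x - c * (p x + 1)).
have dgd x : x \in `]s, z[ -> is_derive x 1 g (dg x).
  rewrite in_itv/= => /andP[sx xz].
  have dpx : is_derive x 1 p (dp x) by apply: dpd; rewrite sx (lt_le_trans xz).
  rewrite /g; apply: is_derive_eq; rewrite /dg /GRing.scale/=; ring.
have cg : {within `[s, z], continuous g}.
  move=> x; apply: cvgM; last first.
    by apply: cvgD; [exact: (within_continuousS (lexx s) zt cp)|exact: cvg_cst].
  have ce : continuous (fun x : R => expR (- c * x)).
    by move=> y; apply: continuous_comp; [exact: mulrl_continuous|exact: continuous_expR].
  exact: (continuous_subspaceT ce).
have [x] := MVT sltz dgd cg; rewrite in_itv/= => /andP[sx xz] gE.
have gle : g z <= g s.
  rewrite -subr_le0 gE mulr_le0_ge0// ?subr_ge0//.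
  rewrite /dg mulr_ge0_le0 ?expR_ge0// subr_le0 dpc//.
  by rewrite sx (lt_le_trans xz).
have -> : p z + 1 = expR (c * z) * g z.
  by rewrite /g mulrA -expRD mulNr subrr expR0 mul1r.
have -> : (p s + 1) * expR (c * (z - s)) = expR (c * z) * g s.
  rewrite /g mulrA -expRD mulrC; congr (expR _ * _); ring.
by rewrite ler_pM2l// expR_gt0.
Qed.

Lemma expR_itv_le (lambda s t z : R) : s <= z <= t ->
  expR (lambda * z) <= expR (`|lambda| * (`|s| + `|t|)).
Proof.
move=> /andP[sz zt]; rewrite ler_expR (le_trans (ler_norm _))// normrM ler_wpM2l//.
have [z0|z0] := ger0P z; have := ler_norm t; have := ler_norm (- s); rewrite normrN;
  have := normr_ge0 s; have := normr_ge0 t; lra.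
Qed.

Section Finite.
Variables (P H : R -> R -> R) (S : set R) (s t alpha lambda c : R).
Hypotheses (st : s < t) (mS : measurable S) (c0 : 0 <= c).
Hypothesis P_ge0 : forall z w, 0 <= P z w.
Hypothesis P_cont : forall w, S w -> {within `[s, t], continuous (P ^~ w)}.
Hypothesis P_deriv : forall z w, s < z < t -> S w ->
  is_derive z 1 (P ^~ w) (- alpha * P z w + H z w).
Hypothesis H_bound : forall z w, s < z < t -> S w -> `|H z w| <= c * (P z w + 1).
Hypothesis P_int : forall z, s <= z <= t -> mu.-integrable S (EFin \o P z).
Hypothesis H_int : forall z, s < z < t -> mu.-integrable S (EFin \o H z).

Let X := expR (`|lambda| * (`|s| + `|t|)).
Let Y := expR ((`|alpha| + c) * (t - s)).
(** [k * (P s w + 1)] majorises the derivative of the weighted density on []s, t[]: [X] bounds the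
    exponential weight and [Y] is the Gronwall factor. *)
Let k := X * ((`|lambda - alpha| + c) * Y).

Let P_le z w : s <= z <= t -> S w -> P z w + 1 <= (P s w + 1) * Y.
Proof.
move=> szt Sw; have /andP[sz zt] := szt.
have := @gronwall (P ^~ w) (fun z => - alpha * P z w + H z w) s t (`|alpha| + c)
  (P_cont Sw) (fun z hz => P_deriv hz Sw) _ z szt.
move=> h; apply: le_trans (h _) _.
  move=> x hx; have hb := le_trans (ler_norm _) (H_bound hx Sw).
  have ha : - alpha * P x w <= `|alpha| * P x w.
    by rewrite ler_wpM2r// -normrN ler_norm.
  by have := P_ge0 x w; have := normr_ge0 alpha; nra.
rewrite ler_wpM2l ?addr_ge0// /Y ler_expR ler_wpM2l ?addr_ge0//.
by rewrite lerB.
Qed.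

Let f z w := expR (lambda * z) * P z w.
Let df z w := expR (lambda * z) * ((lambda - alpha) * P z w + H z w).

Let f_deriv z w : s < z < t -> S w -> is_derive z 1 (f ^~ w) (df z w).
Proof.
move=> szt Sw; have dP := P_deriv szt Sw.
rewrite /f; apply: is_derive_eq; rewrite /df /GRing.scale/=; ring.
Qed.

Let df_le z w : s < z < t -> S w -> `|df z w| <= k * (P s w + 1).
Proof.
move=> szt Sw; have /andP[sz zt] := szt.
have szt' : s <= z <= t by rewrite !ltW.
rewrite /df normrM ger0_norm ?expR_ge0// /k -!mulrA.
apply: ler_pM; rewrite ?expR_ge0 ?expR_itv_le//.
apply: (@le_trans _ _ ((`|lambda - alpha| + c) * (P z w + 1))).
  apply: le_trans (ler_normD _ _) _; rewrite normrM (ger0_norm (P_ge0 z w)).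
  have := H_bound szt Sw; have := normr_ge0 (lambda - alpha); have := P_ge0 z w; nra.
by rewrite ler_wpM2l ?addr_ge0// mulrC P_le.
Qed.

Hypothesis one_int : mu.-integrable S (EFin \o (fun=> 1)).

(** Gronwall dominates all densities by the one at [s], so the integral over [S] is Lipschitz in [z]
    and can be differentiated under the sign. The constant in the majorant is integrable because [S]
    has finite measure here. *)
Lemma energy_balance_fin :
  let d z := expR (lambda * z) *
    ((lambda - alpha) * \int[mu]_(w in S) P z w + \int[mu]_(w in S) H z w) in
  mu.-integrable `]s, t[ (EFin \o d) /\
  \int[mu]_(z in `]s, t[) d z =
    expR (lambda * t) * \int[mu]_(w in S) P t w -
    expR (lambda * s) * \int[mu]_(w in S) P s w.
Proof.
move=> d; have st' := ltW st.
have sst : s <= s <= t by rewrite lexx.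
have k0 : 0 <= k.
  by rewrite /k mulr_ge0 ?expR_ge0// mulr_ge0 ?expR_ge0// addr_ge0.
pose G w := k * (P s w + 1).
have Gi : mu.-integrable S (EFin \o G).
  apply: integrable_scale => //; apply: integrable_add => //; exact: P_int.
have fi z : s <= z <= t -> mu.-integrable S (EFin \o f z).
  by move=> h; apply: integrable_scale => //; exact: P_int.
have f_cont w : S w -> {within `[s, t], continuous (f ^~ w)}.
  move=> Sw x; apply: cvgM; last exact: P_cont.
  have ce : continuous (fun x : R => expR (lambda * x)).
    by move=> y; apply: continuous_comp; [exact: mulrl_continuous|exact: continuous_expR].
  exact: (continuous_subspaceT ce).
pose U z := \int[mu]_(w in S) f z w.
have UE z : s <= z <= t -> U z = expR (lambda * z) * \int[mu]_(w in S) P z w.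
  by move=> h; rewrite /U /f RintegralZl//; exact: P_int.
rewrite -!UE ?st' ?lexx//.
apply: (@FTC_lipschitz _ U d s t (\int[mu]_(w in S) G w)) => //.
- move=> x y hx hy; rewrite /U -RintegralB//; [|exact: fi|exact: fi].
  have fxyi : mu.-integrable S (EFin \o (fun w => f x w - f y w)).
    by apply: integrable_sub => //; exact: fi.
  apply: (le_trans (le_normr_Rintegral _ fxyi)) => //.
  rewrite -RintegralZr//; apply: le_Rintegral => //.
  + exact: integrable_norm.
  + by under eq_fun do rewrite mulrC; exact: integrable_scale.
  + move=> w Sw; apply: (derivative_bound_lipschitz (f_cont w Sw)) => //.
    * by move=> z hz; exact: f_deriv.
    * by move=> z hz; exact: df_le.
- move=> z szt; have /andP[sz zt] := szt.
  have dfE x w : s < x < t -> S w -> partial1of2 f x w = df x w.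
    by move=> hx Sw; rewrite partial1of2E; case: (f_deriv hx Sw).
  have Iz : `]s, t[%classic z by rewrite /= in_itv.
  have intf x : `]s, t[%classic x -> mu.-integrable S (EFin \o f x).
    by rewrite /= in_itv/= => /andP[? ?]; apply: fi; rewrite !ltW.
  have derf x w : `]s, t[%classic x -> S w -> derivable (f ^~ w) x 1.
    by rewrite /= in_itv/= => hx Sw; have [] := f_deriv hx Sw.
  have G0 w : 0 <= G w by rewrite mulr_ge0// addr_ge0.
  have Gub x w : `]s, t[%classic x -> S w -> `|partial1of2 f x w| <= G w.
    by rewrite /= in_itv/= => hx Sw; rewrite dfE//; exact: df_le.
  have mS' : measurable (S : set (measurableTypeR R)) by [].
  have dU := derivable_under_integral mS' Iz intf derf G0 Gi Gub.
  have DU := differentiation_under_integral mS' Iz intf derf G0 Gi Gub.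
  split => //; rewrite -derive1E DU.
  transitivity (\int[mu]_(w in S) df z w).
    by apply: eq_Rintegral => w /set_mem Sw; rewrite dfE.
  have Pi := P_int (z := z); rewrite !ltW// in Pi.
  have Pi' := integrable_scale (lambda - alpha) mS' (Pi isT).
  have Hi := H_int szt.
  rewrite /df RintegralZl//; last exact: integrable_add.
  by rewrite RintegralD// RintegralZl//; exact: Pi.
Qed.
End Finite.

End EnergyBalance.

Section EnergyBalanceGeneral.
Context {R : realType}.
Notation mu := (@lebesgue_measure R).

Lemma Rintegral_setI_cvg (S : set R) (f : R -> R) : measurable S ->
  mu.-integrable S (EFin \o f) ->
  \int[mu]_(w in S `&` `[- n%:R, n%:R]) f w @[n --> \oo] --> \int[mu]_(w in S) f w.
Proof.
move=> mS fi; have mf := integrable_measurable fi.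
under eq_fun do rewrite Rintegral_mkcondr.
have [] := @Rintegral_dominated _ _ _ mu S
  (fun n => f \_ `[- n%:R, n%:R]) f (fun x => `|f x|) => //.
- move=> n; apply/measurable_restrict => //.
  by apply: measurable_funS mf => //; exact: subIsetl.
- move=> x Sx; apply: cvg_near_cst; near=> n.
  rewrite patchE mem_set//= in_itv/= -ler_norml.
  by near: n; exact: nbhs_infty_ger.
- exact: integrable_norm.
- by move=> n x _; rewrite patchE; case: ifPn => // _; rewrite normr0.
Unshelve. all: by end_near. Qed.

Lemma Rintegral_subset_le (A B : set R) (f : R -> R) : measurable A -> measurable B ->
  A `<=` B -> (forall w, 0 <= f w) -> mu.-integrable B (EFin \o f) ->
  \int[mu]_(w in A) f w <= \int[mu]_(w in B) f w.
Proof.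
move=> mA mB AB f0 fi.
have fA : mu.-integrable A (EFin \o f) by exact: integrableS fi.
rewrite -lee_fin !integrable_fineK//; apply: ge0_subset_integral => //.
- by apply/measurable_EFinP; exact: integrable_measurable fi.
- by move=> x _; rewrite lee_fin.
Qed.

Section General.
Variables (P H : R -> R -> R) (S : set R) (s t alpha lambda c M M' : R).
Hypotheses (st : s < t) (mS : measurable S) (c0 : 0 <= c).
Hypothesis P_ge0 : forall z w, 0 <= P z w.
Hypothesis P_cont : forall w, S w -> {within `[s, t], continuous (P ^~ w)}.
Hypothesis P_deriv : forall z w, s < z < t -> S w ->
  is_derive z 1 (P ^~ w) (- alpha * P z w + H z w).
Hypothesis H_bound : forall z w, s < z < t -> S w -> `|H z w| <= c * (P z w + 1).
Hypothesis P_int : forall z, s <= z <= t -> mu.-integrable S (EFin \o P z).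
Hypothesis H_int : forall z, s < z < t -> mu.-integrable S (EFin \o H z).
Hypothesis P_le : forall z, s <= z <= t -> \int[mu]_(w in S) P z w <= M.
Hypothesis H_le : forall z, s < z < t -> \int[mu]_(w in S) `|H z w| <= M'.

(** A set of infinite measure is exhausted by its intersections with [[- n, n]]. The bounds [M] and
    [M'], uniform in [z], dominate the integrands over [z]; this is where the energy must be known
    to be bounded beforehand. *)
Lemma energy_balance :
  let d z := expR (lambda * z) *
    ((lambda - alpha) * \int[mu]_(w in S) P z w + \int[mu]_(w in S) H z w) in
  mu.-integrable `]s, t[ (EFin \o d) /\
  \int[mu]_(z in `]s, t[) d z =
    expR (lambda * t) * \int[mu]_(w in S) P t w -
    expR (lambda * s) * \int[mu]_(w in S) P s w.
Proof.
move=> d; have st' := ltW st.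
pose I n : set R := `[- n%:R, n%:R]%classic.
pose Sn n := S `&` I n.
have mSn n : measurable (Sn n) by apply: measurableI => //; exact: measurable_itv.
have SnS n : Sn n `<=` S by exact: subIsetl.
pose dn n z := expR (lambda * z) *
  ((lambda - alpha) * \int[mu]_(w in Sn n) P z w + \int[mu]_(w in Sn n) H z w).
have Pni n z : s <= z <= t -> mu.-integrable (Sn n) (EFin \o P z).
  by move=> hz; apply: integrableS (P_int hz) => //; exact: mSn.
have Hni n z : s < z < t -> mu.-integrable (Sn n) (EFin \o H z).
  by move=> hz; apply: integrableS (H_int hz) => //; exact: mSn.
have fin n := @energy_balance_fin _ P H (Sn n) s t alpha lambda c st (mSn n) c0 P_ge0
  (fun w Sw => P_cont (SnS n w Sw)) (fun z w hz Sw => P_deriv hz (SnS n w Sw))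
  (fun z w hz Sw => H_bound hz (SnS n w Sw)) (Pni n) (Hni n).
have one n : mu.-integrable (Sn n) (EFin \o (fun=> 1 : R)).
  have i1 : mu.-integrable (I n) (EFin \o (fun=> 1 : R)).
    by apply: continuous_integrable_itv => x; exact: cvg_cst.
  by apply: integrableS i1 => //; [exact: measurable_itv|exact: mSn|exact: subIsetr].
pose X := expR (`|lambda| * (`|s| + `|t|)).
pose B := X * (`|lambda - alpha| * M + M').
have [di lim1] : mu.-integrable `]s, t[ (EFin \o d) /\
    \int[mu]_(z in `]s, t[) dn n z @[n --> \oo] --> \int[mu]_(z in `]s, t[) d z.
  apply: (@Rintegral_dominated _ _ _ mu _ _ _ (fun=> B)) => //.
  - by move=> n; have [i _] := fin n (one n); exact: integrable_measurable i.
  - move=> z /=; rewrite in_itv/= => hz; have /andP[sz zt] := hz.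
    have hz' : s <= z <= t by rewrite !ltW.
    apply: cvgM; first exact: cvg_cst.
    apply: cvgD; last exact: Rintegral_setI_cvg (H_int hz).
    by apply: cvgM; [exact: cvg_cst|exact: Rintegral_setI_cvg (P_int hz')].
  - apply: (@integrableS _ _ _ mu `[s, t]) => //; first exact: subset_itv_oo_cc.
    by apply: continuous_integrable_itv => x; exact: cvg_cst.
  - move=> n z /=; rewrite in_itv/= => hz; have /andP[sz zt] := hz.
    have hz' : s <= z <= t by rewrite !ltW.
    rewrite /dn normrM ger0_norm ?expR_ge0//.
    apply: ler_pM; rewrite ?expR_ge0 ?expR_itv_le//.
    apply: le_trans (ler_normD _ _) _; rewrite normrM; apply: lerD.
      rewrite ler_wpM2l// ger0_norm; last by apply: Rintegral_ge0.
      by apply: le_trans (P_le hz'); apply: Rintegral_subset_le => //; exact: P_int.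
    apply: le_trans (H_le hz).
    apply: (le_trans (le_normr_Rintegral _ (Hni n z hz))); first exact: mSn.
    apply: (@Rintegral_subset_le (Sn n) S (fun w => `|H z w|)) => //.
    exact: integrable_norm (H_int hz).
split => //.
have lim2 : \int[mu]_(z in `]s, t[) dn n z @[n --> \oo] -->
    expR (lambda * t) * \int[mu]_(w in S) P t w -
    expR (lambda * s) * \int[mu]_(w in S) P s w.
  have E n : \int[mu]_(z in `]s, t[) dn n z =
      expR (lambda * t) * \int[mu]_(w in Sn n) P t w -
      expR (lambda * s) * \int[mu]_(w in Sn n) P s w.
    by have [_ e] := fin n (one n); exact: e.
  under eq_fun do rewrite E.
  by apply: cvgB; apply: cvgM; try exact: cvg_cst; apply: Rintegral_setI_cvg => //;
    apply: P_int; rewrite ?lexx ?st'.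
have E1 := cvg_lim (@Rhausdorff R) lim1; have E2 := cvg_lim (@Rhausdorff R) lim2.
by rewrite -E1 E2.
Qed.
End General.
End EnergyBalanceGeneral.

(** * Local boundedness of the energy *)

Section LocallyBounded.
Context {R : realType}.
Variables (E : R -> R) (k : R).

Definition bounded_on (s t : R) := exists B, forall z, s <= z <= t -> E z <= B.

Hypothesis k0 : 0 <= k.
Hypothesis E_ge0 : forall z, 0 <= E z.
Hypothesis E_lsc : forall x n, 0 < x -> n < E x ->
  exists2 e, 0 < e & forall z, x - e <= z <= x -> 0 <= z -> n < E z.
Hypothesis E_decr : forall s t, 0 <= s -> s < t -> bounded_on s t -> E t <= E s.
Hypothesis E_growth : forall s t, 0 <= s -> s < t -> bounded_on s t ->
  E s <= expR (k * (t - s)) * E t.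

Lemma bounded_on_sub s t s' t' : s <= s' -> t' <= t -> bounded_on s t -> bounded_on s' t'.
Proof.
move=> ss tt [B hB]; exists B => z /andP[sz zt]; apply: hB.
by rewrite (le_trans ss)// (le_trans zt).
Qed.

Lemma bounded_on_cat s t u : bounded_on s t -> bounded_on t u -> bounded_on s u.
Proof.
move=> [B hB] [B' hB']; exists (Num.max B B') => z /andP[sz zu].
rewrite le_max; have [zt|tz] := leP z t; first by rewrite hB// sz.
by rewrite hB' ?orbT// (ltW tz).
Qed.

(* Go left from a large value of E until boundedness fails: by monotonicity E is
   still large there. *)
Lemma unbounded_refine (a b n : R) : 0 <= a -> a < b -> ~ bounded_on a b ->
  exists a' b', [/\ a <= a', a' < b', b' <= b, ~ bounded_on a' b' &
    forall z, a' <= z <= b' -> n < E z].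
Proof.
move=> a0 ab nb.
(* Exceeding [E a] as well will force the stretch of boundedness to end strictly to the right of
   [a]. *)
pose m := Num.max n (E a).
have [y /andP[ay yb] Ey] : exists2 y, a <= y <= b & m < E y.
  apply: contra_notP nb => h; exists m => z hz; rewrite leNgt; apply/negP => mz.
  by apply: h; exists z.
pose A := [set s | a <= s <= y /\ bounded_on s y].
have Ay : A y.
  split; first by rewrite ay lexx.
  by exists (E y) => z; rewrite -eq_le => /eqP ->.
have lbA : lbound A a by move=> s [/andP[]].
have hi : has_inf A by split; [exists y|exists a].
pose x := inf A.
have ax : a <= x by apply: lb_le_inf => //; exists y.
have xy : x <= y by apply: inf_lbound => //; exists a.
have bd s : x < s -> s <= y -> bounded_on s y.
  move=> xs sy.
  have [r [_ br] rs] := @inf_adherent _ A (s - x) (ltac:(by rewrite subr_gt0)) hi.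
  apply: bounded_on_sub br => //; apply: ltW.
  by move: rs; rewrite -/x addrC subrK.
(* The growth hypothesis compares every [z] strictly between [x] and [y] with [E y], with one
   constant; the end [x] adds a single value. *)
have bxy : bounded_on x y.
  exists (Num.max (E x) (expR (k * (y - x)) * E y)) => z /andP[xz zy].
  rewrite le_max.
  move: xz; rewrite le_eqVlt => /predU1P[<-|xz]; first by rewrite lexx.
  move: zy; rewrite le_eqVlt => /predU1P[zy|zy].
    apply/orP; right; rewrite zy ler_peMl//.
    by rewrite -[leLHS]expR0 ler_expR mulr_ge0// subr_ge0.
  apply/orP; right; apply: le_trans (E_growth _ zy (bd z xz (ltW zy))) _.
    exact: le_trans a0 (le_trans ax (ltW xz)).
  by rewrite ler_wpM2r// ler_expR ler_wpM2l// lerB// ltW.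
have Exy : E y <= E x.
  move: xy bxy; rewrite le_eqVlt => /predU1P[->//|xy] bxy.
  by apply: E_decr => //; exact: le_trans ax.
have mx : m < E x by exact: lt_le_trans Exy.
have ax' : a < x.
  rewrite lt_neqAle ax andbT; apply: contraPneq mx => <-.
  by apply/negP; rewrite -leNgt le_max lexx orbT.
have nx : n < E x by apply: le_lt_trans mx; rewrite le_max lexx.
have [e e0 he] := E_lsc (le_lt_trans a0 ax') nx.
pose a' := Num.max a (x - e).
have a'x : a' < x by rewrite gt_max ax' ltrBlDr ltrDl.
exists a', x; split => //.
- by rewrite le_max lexx.
- exact: le_trans yb.
(* Boundedness on [[a', x]] would prolong the stretch ending at [y] to the left of its infimum
   [x]. *)
- move=> b1; have := bounded_on_cat b1 bxy => b2.
  have : x <= a'.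
    apply: inf_lbound; first by exists a.
    by split => //; rewrite le_max lexx/= (le_trans (ltW a'x)).
  by rewrite leNgt a'x.
- move=> z /andP[a'z zx]; apply: he.
    by rewrite zx andbT (le_trans _ a'z)// le_max lexx orbT.
  by rewrite (le_trans a0)// (le_trans _ a'z)// le_max lexx.
Qed.

Let bad (ab : R * R) := [/\ 0 <= ab.1, ab.1 < ab.2 & ~ bounded_on ab.1 ab.2].

(** Dependent choice: the state of the recursion carries the proof that its interval is bad, which
    the next refinement needs. *)
Lemma nested_unbounded (a b : R) : 0 <= a -> a < b -> ~ bounded_on a b ->
  exists f : nat -> R * R, forall n, bad (f n) /\
    [/\ (f n).1 <= (f n.+1).1, (f n.+1).2 <= (f n).2 &
     forall z, (f n.+1).1 <= z <= (f n.+1).2 -> n%:R < E z].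
Proof.
move=> a0 ab nb.
have step (n : nat) (x : {ab | bad ab}) : {y : {ab | bad ab} |
    [/\ (sval x).1 <= (sval y).1, (sval y).2 <= (sval x).2 &
    forall z, (sval y).1 <= z <= (sval y).2 -> n%:R < E z]}.
  apply: cid; case: x => -[u v] [/= u0 uv nuv].
  have [u' [v' [uu uv' vv nuv' h]]] := unbounded_refine n%:R u0 uv nuv.
  have bad' : bad (u', v') by split => //=; exact: le_trans uu.
  by exists (exist _ (u', v') bad').
have badab : bad (a, b) by [].
pose f := fix f n := if n is m.+1 then sval (step m (f m)) else exist _ (a, b) badab.
exists (fun n => sval (f n)) => n; split; first exact: (svalP (f n)).
exact: (svalP (step n (f n))).
Qed.

(** The nested intervals share the supremum [p] of their left ends, where the real number [E p]
    would exceed every integer. *)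
Lemma locally_bounded (a b : R) : 0 <= a -> a < b -> bounded_on a b.
Proof.
move=> a0 ab; apply: contrapT => nb.
have [f hf] := nested_unbounded a0 ab nb.
have f1 m n : (m <= n)%N -> (f m).1 <= (f n).1.
  elim: n => [|n ih]; first by rewrite leqn0 => /eqP ->.
  rewrite leq_eqVlt => /predU1P[->//|]; rewrite ltnS => /ih /le_trans; apply.
  by have [_ []] := hf n.
have f2 m n : (m <= n)%N -> (f n).2 <= (f m).2.
  elim: n => [|n ih]; first by rewrite leqn0 => /eqP ->.
  rewrite leq_eqVlt => /predU1P[->//|]; rewrite ltnS => /ih; apply: le_trans.
  by have [_ []] := hf n.
have f12 m n : (f m).1 <= (f n).2.
  apply: le_trans (f1 m _ (leq_maxl m n)) _; apply: le_trans (f2 n _ (leq_maxr m n)).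
  by have [[_ /ltW]] := hf (maxn m n).
pose A := [set (f n).1 | n in setT].
have ubA n : ubound A (f n).2 by move=> _ [m _ <-].
have hs : has_sup A by split; [exists (f 0%N).1; exists 0%N|exists (f 0%N).2].
pose p := sup A.
have Ep n : n%:R < E p.
  have [_ [_ _]] := hf n; apply; apply/andP; split.
    by apply: sup_upper_bound => //; exists n.+1.
  by apply: sup_le_ub (ubA _); exact: hs.1.
have := Ep (Num.truncn (E p)).+1.
by rewrite ltNge; apply/negP/negPn; exact: ltW (truncnS_gt _).
Qed.
End LocallyBounded.

(** * Propagation with finite out-of-band attenuation *)

Section Propagation.
Context {R : realType}.
Notation mu := (@lebesgue_measure R).
Notation Re := (@complex.Re R).
Notation Im := (@complex.Im R).
Variables (W : set R) (a0 a1 b2 g M : R) (q Q : R -> R -> R[i]).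
Hypothesis mW : measurable W.
Hypothesis Q_L2 : forall z : R, 0 <= z -> L2 (Q z).
Hypothesis Q_FT : forall z : R, 0 <= z -> is_FT (q z) (Q z).
Hypothesis q_le : forall z t : R, 0 <= z -> cabs (q z t) <= M.
Hypothesis Q_cont0 : forall w,
  (Re (Q z w) @[z --> (0:R)^'+] --> Re (Q 0 w)) /\
  (Im (Q z w) @[z --> (0:R)^'+] --> Im (Q 0 w)).
Hypothesis Q_deriv : forall z w : R, 0 < z ->
  cderive (fun s => Q s w) z (nlse_rhs (brickwall W a0 a1) b2 g (Q z) w).

Let C := multiplier_const M.
Let gam := g / (4 * pi ^+ 2).
Let P z w := sqn (Q z w).

(** This is twice the real part of [conj Q] times [j gam N], with [N] the nonlinear term: the rate
    at which the nonlinearity feeds the squared modulus. Dispersion contributes nothing, its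
    multiplier being imaginary. *)
Definition flux_density (z w : R) : R := 2 * gam *
  (Im (Q z w) * Re (nlterm (Q z) w) - Re (Q z w) * Im (nlterm (Q z) w)).

Definition band_energy (S : set R) (z : R) : R := \int[mu]_(w in S) sqn (Q z w).

Definition band_flux (S : set R) (z : R) : R := \int[mu]_(w in S) flux_density z w.

Definition total_energy : R -> R := band_energy setT.

Lemma Re_nlse_rhs (al : R -> R) (q0 : R -> R[i]) w : Re (nlse_rhs al b2 g q0 w) =
  - al w / 2 * Re (q0 w) - b2 / 2 * w ^+ 2 * Im (q0 w) - gam * Im (nlterm q0 w).
Proof.
rewrite /nlse_rhs /gam; case: (q0 w) => x y; case: (nlterm q0 w) => n1 n2 /=.
by ring.
Qed.

Lemma Im_nlse_rhs (al : R -> R) (q0 : R -> R[i]) w : Im (nlse_rhs al b2 g q0 w) =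
  - al w / 2 * Im (q0 w) + b2 / 2 * w ^+ 2 * Re (q0 w) + gam * Re (nlterm q0 w).
Proof.
rewrite /nlse_rhs /gam; case: (q0 w) => x y; case: (nlterm q0 w) => n1 n2 /=.
by ring.
Qed.

Lemma sqn_deriv (z w : R) : 0 < z -> is_derive z 1 (P ^~ w)
  (- brickwall W a0 a1 w * P z w + flux_density z w).
Proof.
move=> z0; have [dR dI] := Q_deriv w z0.
rewrite /P /sqn; apply: is_derive_eq.
rewrite Re_nlse_rhs Im_nlse_rhs /flux_density /GRing.scale/=.
by field.
Qed.

Lemma sqn_ge0 (x : R[i]) : 0 <= sqn x.
Proof. by rewrite /sqn addr_ge0 ?sqr_ge0. Qed.

Lemma sqn_cont (s t w : R) : 0 <= s -> s < t -> {within `[s, t], continuous (P ^~ w)}.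
Proof.
move=> s0 st.
have cP z : 0 < z -> {for z, continuous (P ^~ w)}.
  move=> z0; apply: differentiable_continuous; apply/derivable1_diffP.
  by have [] := sqn_deriv w z0.
apply/(continuous_within_itvP _ st); split.
- move=> z; rewrite in_itv/= => /andP[sz zt]; apply: cP; exact: le_lt_trans sz.
(* At [z = 0], where the equation is not assumed, continuity comes from the right limits of the
   spectrum. *)
- move: s0; rewrite le_eqVlt => /predU1P[<-|s0].
    have [cr ci] := Q_cont0 w.
    by rewrite /P /sqn; apply: cvgD; rewrite expr2; under eq_fun do rewrite expr2; apply: cvgM.
  by apply: cvg_at_right_filter; exact: cP.
- by apply: cvg_at_left_filter; apply: cP; exact: le_lt_trans st.
Qed.

Lemma sqn_int (S : set R) (z : R) : measurable S -> 0 <= z -> mu.-integrable S (EFin \o P z).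
Proof.
by move=> mS z0; have [_ [_ i]] := Q_L2 z0; apply: integrableS i.
Qed.

Lemma total_energyE (z : R) : 0 <= z ->
  total_energy z = nsq (Re \o Q z) + nsq (Im \o Q z).
Proof.
move=> z0; have [sR sI] := L2_sqint (Q_L2 z0).
by rewrite /nsq -RintegralD//; [exact: sR.2|exact: sI.2].
Qed.

Lemma band_energy_ge0 (S : set R) (z : R) : 0 <= band_energy S z.
Proof. by apply: Rintegral_ge0 => w _; exact: sqn_ge0. Qed.

Lemma band_energy_le_total (S : set R) (z : R) : measurable S -> 0 <= z ->
  band_energy S z <= total_energy z.
Proof.
move=> mS z0; apply: Rintegral_subset_le => //; last exact: sqn_int.
by move=> w; exact: sqn_ge0.
Qed.

Lemma band_energy_setC (S : set R) (z : R) : measurable S -> 0 <= z ->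
  total_energy z = band_energy S z + band_energy (~` S) z.
Proof.
move=> mS z0; rewrite /total_energy /band_energy -(setUv S) Rintegral_setU//.
- exact: measurableC.
- by rewrite setUv; exact: sqn_int.
- exact/disj_setPCl.
Qed.

Lemma Q_bounded_conv (z : R) : 0 <= z ->
  bounded_conv C (Re \o Q z) /\ bounded_conv C (Im \o Q z).
Proof.
move=> z0; exact: (is_FT_bounded_conv (Q_L2 z0) (Q_FT z0) (fun t => q_le t z0)).
Qed.

Definition nl_energy_const : R := 16 * (C * C).

Lemma C_ge0 : 0 <= C. Proof. exact: multiplier_const_ge0. Qed.

Lemma nl_energy_const_ge0 : 0 <= nl_energy_const.
Proof. exact: (mulr_ge0 (ler0n _ 16) (mulr_ge0 C_ge0 C_ge0)). Qed.

(** Young's inequality with a free weight. A large [k] puts the small factor [k^-1] on the nonlinear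
    term, and outside the band the factor [k] falls on a small energy. *)
Lemma flux_density_le (k z w : R) : 0 < k ->
  `|flux_density z w| <= `|gam| * (k * P z w +
    k^-1 * (Re (nlterm (Q z) w) ^+ 2 + Im (nlterm (Q z) w) ^+ 2)).
Proof.
move=> k0; rewrite /flux_density /P /sqn normrM normrM ger0_norm// -mulrA mulrCA.
rewrite ler_wpM2l//.
move: (Im (Q z w)) (Re (Q z w)) (Re (nlterm (Q z) w)) (Im (nlterm (Q z) w)) => x y u v.
have yg (a b : R) : 2 * (a * b) <= k * a ^+ 2 + k^-1 * b ^+ 2.
  have -> : k * a ^+ 2 + k^-1 * b ^+ 2 = k^-1 * (k * a - b) ^+ 2 + 2 * (a * b).
    by field; rewrite gt_eqF.
  by rewrite lerDr mulr_ge0 ?sqr_ge0// invr_ge0 ltW.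
have := yg x u; have := yg x (- u); have := yg y v; have := yg y (- v).
rewrite !sqrrN !mulrN !mulrDr.
move: (k * x ^+ 2) (k * y ^+ 2) (k^-1 * u ^+ 2) (k^-1 * v ^+ 2) (x * u) (y * v) => A B D F X Y.
by have [h|h] := ger0P (X - Y); lra.
Qed.

Lemma flux_density_int (S : set R) (z : R) : measurable S -> 0 <= z ->
  mu.-integrable S (EFin \o flux_density z).
Proof.
move=> mS z0; have [s1 s2] := L2_sqint (Q_L2 z0); have [b1 b2'] := Q_bounded_conv z0.
have [n1 n2] := nlterm_sqint s1 s2 b1 b2'.
suff : mu.-integrable setT (EFin \o flux_density z) by apply: integrableS.
apply: integrable_scale => //.
by apply: integrable_sub => //; [exact: (sqint_mul s2 n1)|exact: (sqint_mul s1 n2)].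
Qed.

Lemma band_flux_norm_le (S : set R) (k z : R) : measurable S -> 0 < k -> 0 <= z ->
  \int[mu]_(w in S) `|flux_density z w| <=
  `|gam| * (k * band_energy S z + k^-1 * (nl_energy_const * total_energy z)).
Proof.
move=> mS k0 z0; have [s1 s2] := L2_sqint (Q_L2 z0); have [b1 b2'] := Q_bounded_conv z0.
have [n1 n2] := nlterm_sqint s1 s2 b1 b2'.
have nle := nlterm_nsq_le s1 s2 b1 b2'.
have nT : mu.-integrable setT (EFin \o (fun w => Re (nlterm (Q z) w) ^+ 2 + Im (nlterm (Q z) w) ^+ 2)).
  by apply: integrable_add => //; [exact: n1.2|exact: n2.2].
have nS : mu.-integrable S (EFin \o (fun w => Re (nlterm (Q z) w) ^+ 2 + Im (nlterm (Q z) w) ^+ 2)).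
  by apply: integrableS nT.
have PS := sqn_int mS z0.
apply: (@le_trans _ _ (\int[mu]_(w in S) (`|gam| * (k * P z w +
    k^-1 * (Re (nlterm (Q z) w) ^+ 2 + Im (nlterm (Q z) w) ^+ 2))))).
  apply: le_Rintegral => //.
  - exact: integrable_norm (flux_density_int mS z0).
  - by apply: integrable_scale => //; apply: integrable_add => //; exact: integrable_scale.
  - by move=> w _; exact: flux_density_le.
rewrite RintegralZl//; last by apply: integrable_add => //; exact: integrable_scale.
rewrite RintegralD//; [|exact: integrable_scale|exact: integrable_scale].
rewrite !RintegralZl// ler_wpM2l// lerD2l ler_wpM2l ?invr_ge0 ?(ltW k0)//.
rewrite total_energyE// (le_trans _ nle)//.
rewrite /nsq -RintegralD//; [|exact: n1.2|exact: n2.2].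
by apply: Rintegral_subset_le => // w; rewrite addr_ge0 ?sqr_ge0.
Qed.

Lemma band_flux_setC (S : set R) (z : R) : measurable S -> 0 <= z ->
  band_flux S z + band_flux (~` S) z = 0.
Proof.
move=> mS z0; have [s1 s2] := L2_sqint (Q_L2 z0); have [b1 b2'] := Q_bounded_conv z0.
have [n1 n2] := nlterm_sqint s1 s2 b1 b2'.
rewrite /band_flux -Rintegral_setU//; last 3 first.
- exact: measurableC.
- by rewrite setUv; exact: flux_density_int.
- exact/disj_setPCl.
rewrite setUv /flux_density RintegralZl//; last first.
  by apply: integrable_sub => //; [exact: (sqint_mul s2 n1)|exact: (sqint_mul s1 n2)].
have := nlterm_conserves s1 s2 b1 b2' => ->.
by rewrite mulr0.
Qed.

Lemma propagation_balance (S : set R) (alS lambda s t E0 : R) : measurable S ->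
  (forall w, S w -> brickwall W a0 a1 w = alS) -> 0 <= s -> s < t ->
  (forall z, s <= z <= t -> total_energy z <= E0) ->
  let d z := expR (lambda * z) *
    ((lambda - alS) * band_energy S z + band_flux S z) in
  mu.-integrable `]s, t[ (EFin \o d) /\
  \int[mu]_(z in `]s, t[) d z =
    expR (lambda * t) * band_energy S t - expR (lambda * s) * band_energy S s.
Proof.
move=> mS Sal s0 st EE0.
have nc0 := nl_energy_const_ge0; have C0 := C_ge0.
have E00 : 0 <= E0.
  by apply: le_trans (EE0 s _); [exact: band_energy_ge0|rewrite lexx ltW].
have z_ge0 z : s <= z <= t -> 0 <= z by move=> /andP[sz _]; exact: le_trans sz.
have z_ge0' z : s < z < t -> 0 <= z.
  by move=> /andP[sz _]; exact: ltW (le_lt_trans s0 sz).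
pose K := C * (E0 * E0).
have K0 : 0 <= K by rewrite mulr_ge0// mulr_ge0.
(* Young's inequality with weight 1, and [8 * K] for each of the two squares bounded by
   [nlterm_sup_le]. *)
pose c := `|gam| * (1 + 16 * K).
have c0 : 0 <= c.
  by apply: mulr_ge0 => //; apply: addr_ge0 => //; exact: mulr_ge0.
have ar (k p x y : R) : 0 <= k -> 0 <= p -> x <= 8 * k -> y <= 8 * k ->
    p + (x + y) <= (1 + 16 * k) * (p + 1) by nra.
apply: (@energy_balance _ P flux_density S s t alS lambda c E0
  (`|gam| * (1 * E0 + 1^-1 * (nl_energy_const * E0)))) => //.
- by move=> z w; exact: sqn_ge0.
- by move=> w _; exact: sqn_cont.
- move=> z w /andP[sz zt] Sw; rewrite -(Sal w Sw); apply: sqn_deriv.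
  exact: le_lt_trans sz.
- move=> z w hz Sw; have z0 := z_ge0' z hz.
  have [s1 s2] := L2_sqint (Q_L2 z0); have [b1 b2'] := Q_bounded_conv z0.
  have [] := nlterm_sup_le s1 s2 b1 b2' w; rewrite -total_energyE//.
  have hz' : s <= z <= t by move/andP: hz => [? ?]; rewrite !ltW.
  have TE : total_energy z * total_energy z <= E0 * E0.
    by apply: ler_pM; rewrite ?EE0 ?band_energy_ge0.
  move=> nr ni; apply: le_trans (flux_density_le z w ltr01) _.
  rewrite /c -[X in _ <= X]mulrA ler_wpM2l// invr1 !mul1r.
  have C8 : 8 * C * (total_energy z * total_energy z) <= 8 * K.
    by rewrite -[X in X <= _]mulrA ler_wpM2l// ler_wpM2l.
  by apply: ar => //; [exact: sqn_ge0|exact: le_trans nr C8|exact: le_trans ni C8].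
- by move=> z hz; exact: sqn_int (z_ge0 z hz).
- by move=> z hz; exact: flux_density_int (z_ge0' z hz).
- move=> z hz; apply: le_trans (EE0 z hz); apply: band_energy_le_total => //.
  exact: z_ge0.
- move=> z hz; have z0 := z_ge0' z hz.
  have hz' : s <= z <= t by move/andP: hz => [? ?]; rewrite !ltW.
  apply: le_trans (band_flux_norm_le mS ltr01 z0) _; rewrite ler_wpM2l// lerD//.
    rewrite ler_wpM2l//; exact: le_trans (band_energy_le_total mS z0) (EE0 z hz').
  by rewrite ler_wpM2l ?invr1// ler_wpM2l// EE0.
Qed.

Hypotheses (a0_ge0 : 0 <= a0) (a0_le : a0 <= a1).

Lemma Rintegral_itvoo_expR (b t : R) : 0 < t -> b != 0 ->
  \int[mu]_(z in `]0, t[) expR (b * z) = (expR (b * t) - 1) / b.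
Proof.
move=> t0 b0.
have ce : continuous (fun z : R => expR (b * z)).
  by move=> y; apply: continuous_comp; [exact: mulrl_continuous|exact: continuous_expR].
have i := continuous_integrable_itv 0 t ce.
rewrite Rintegral_itv_obnd_cbnd; last first.
  by apply: integrableS i => //; exact: subset_itv_oo_cc.
rewrite Rintegral_itv_bndo_bndc; last first.
  by apply: integrableS i => //; exact: subset_itv_co_cc.
transitivity (expR (b * t) / b - expR (b * 0) / b); last first.
  by rewrite mulr0 expR0 -mulrBl.
apply: (@Rintegral_FTC _ (fun z => expR (b * z) / b)) => //; first exact: ltW.
move=> z _; apply: is_derive_eq; rewrite /GRing.scale/=; field.
by [].
Qed.

Lemma integrable_itvoo_cst (s t B : R) : mu.-integrable `]s, t[ (EFin \o (fun=> B)).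
Proof.
apply: (@integrableS _ _ _ mu `[s, t]) => //; first exact: subset_itv_oo_cc.
by apply: continuous_integrable_itv => x; exact: cvg_cst.
Qed.

Lemma integrable_itvoo_expR (s t b : R) :
  mu.-integrable `]s, t[ (EFin \o (fun z => expR (b * z))).
Proof.
apply: (@integrableS _ _ _ mu `[s, t]) => //; first exact: subset_itv_oo_cc.
apply: continuous_integrable_itv => x.
by apply: continuous_comp; [exact: mulrl_continuous|exact: continuous_expR].
Qed.

Lemma brickwall_in w : W w -> brickwall W a0 a1 w = a0.
Proof. by move=> Ww; rewrite /brickwall asboolT. Qed.

Lemma brickwall_out w : (~` W) w -> brickwall W a0 a1 w = a1.
Proof. by move=> Ww; rewrite /brickwall asboolF. Qed.

(** Adding the balances of the band and of its complement cancels the flux; only attenuation is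
    left. *)
Lemma total_balance (lambda s t : R) : 0 <= s -> s < t ->
  bounded_on total_energy s t ->
  let d z := expR (lambda * z) * ((lambda - a0) * band_energy W z +
    (lambda - a1) * band_energy (~` W) z) in
  mu.-integrable `]s, t[ (EFin \o d) /\
  \int[mu]_(z in `]s, t[) d z =
    expR (lambda * t) * total_energy t - expR (lambda * s) * total_energy s.
Proof.
move=> s0 st [E0 hE0] d; have mWC : measurable (~` W) by exact: measurableC.
have t0 : 0 <= t by exact: ltW (le_lt_trans s0 st).
have [i1 e1] := propagation_balance lambda mW brickwall_in s0 st hE0.
have [i2 e2] := propagation_balance lambda mWC brickwall_out s0 st hE0.
pose d1 z := expR (lambda * z) * ((lambda - a0) * band_energy W z + band_flux W z).
pose d2 z := expR (lambda * z) * ((lambda - a1) * band_energy (~` W) z + band_flux (~` W) z).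
have i12 : mu.-integrable `]s, t[ (EFin \o (fun z => d1 z + d2 z)).
  by apply: integrable_add.
have dE z : `]s, t[%classic z -> d z = d1 z + d2 z.
  rewrite /= in_itv/= => /andP[sz _].
  have := band_flux_setC mW (ltW (le_lt_trans s0 sz)) => /eqP.
  by rewrite addr_eq0 => /eqP fE; rewrite /d /d1 /d2 fE; ring.
split.
  apply: eq_integrable i12 => // z /set_mem zst /=; congr (_%:E).
  by rewrite dE.
transitivity (\int[mu]_(z in `]s, t[) (d1 z + d2 z)).
  by apply: eq_Rintegral => z /set_mem zst; rewrite dE.
rewrite RintegralD// e1 e2 (band_energy_setC mW t0) (band_energy_setC mW s0).
by ring.
Qed.

Lemma total_decr (s t : R) : 0 <= s -> s < t -> bounded_on total_energy s t ->
  total_energy t <= total_energy s.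
Proof.
move=> s0 st bd; have [i e] := total_balance 0 s0 st bd.
move: e; rewrite !mul0r expR0 !mul1r => e.
rewrite -subr_le0 -e.
apply: (@le_trans _ _ (\int[mu]_(z in `]s, t[) (0 : R))); last first.
  by rewrite Rintegral_cst// mul0r.
apply: le_Rintegral; [by []|exact: i|exact: integrable_itvoo_cst|].
move=> z _; rewrite mul0r expR0 mul1r !sub0r.
have a10 : 0 <= a1 by exact: le_trans a0_le.
by rewrite -subr_ge0 sub0r opprD !mulNr !opprK addr_ge0// mulr_ge0// band_energy_ge0.
Qed.

(** The weight [lambda = a1] matches the larger attenuation, so the integrand of the balance is
    nonnegative: the energy cannot fall faster than at rate [a1]. *)
Lemma total_growth (s t : R) : 0 <= s -> s < t -> bounded_on total_energy s t ->
  total_energy s <= expR (a1 * (t - s)) * total_energy t.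
Proof.
move=> s0 st bd; have [i e] := total_balance a1 s0 st bd.
have h : expR (a1 * s) * total_energy s <= expR (a1 * t) * total_energy t.
  rewrite -subr_ge0 -e; apply: Rintegral_ge0 => z _.
  by rewrite subrr mul0r addr0 !mulr_ge0 ?expR_ge0 ?subr_ge0// band_energy_ge0.
rewrite mulrBr expRD mulrAC expRN ler_pdivlMr ?expR_gt0//.
by rewrite mulrC.
Qed.

(** Otherwise points tending to [x] from the left would keep an energy at most [n]; the densities
    converge pointwise along them, and Fatou contradicts [n < total_energy x]. *)
Lemma total_lsc (x n : R) : 0 < x -> n < total_energy x ->
  exists2 e, 0 < e & forall z, x - e <= z <= x -> 0 <= z -> n < total_energy z.
Proof.
move=> x0 nx; apply: contrapT => h.
have hz (m : nat) : exists z, [/\ x - m.+1%:R^-1 <= z <= x, 0 <= z & total_energy z <= n].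
  apply: contrapT => hm; apply: h; exists m.+1%:R^-1 => // z hz z0.
  by rewrite ltNge; apply/negP => le; apply: hm; exists z.
have [zm zmP] := choice hz.
have zcv : zm m @[m --> \oo] --> x.
  apply: (@squeeze_cvgr _ _ _ _ (fun m => x - m.+1%:R^-1) (fun=> x)).
  - by apply: nearW => m; have [] := zmP m.
  - have c : x - m.+1%:R^-1 @[m --> \oo] --> x - 0.
      by apply: cvgB; [exact: cvg_cst|exact: cvg_harmonic].
    by rewrite subr0 in c.
  - exact: cvg_cst.
have cP w : P (zm m) w @[m --> \oo] --> P x w.
  have cx : {for x, continuous (P ^~ w)}.
    apply: differentiable_continuous; apply/derivable1_diffP.
    by have [] := sqn_deriv w x0.
  exact: (cvg_comp zm (P ^~ w) zcv cx).
have [] := @Rintegral_fatou _ _ _ mu setT (fun m => P (zm m)) (P x) n.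
- exact: measurableT.
- by move=> m; have [_ z0 _] := zmP m; exact: sqn_int.
- by move=> m w _; exact: sqn_ge0.
- by move=> w _; exact: cP.
- by move=> m; have [_ _] := zmP m.
- by move=> _; rewrite leNgt nx.
Qed.

Lemma total_energy_le (t : R) : 0 <= t -> total_energy t <= total_energy 0.
Proof.
rewrite le_eqVlt => /predU1P[<-//|t0].
apply: total_decr => //.
apply: (@locally_bounded _ total_energy a1) => //.
- exact: le_trans a0_le.
- by move=> z; exact: band_energy_ge0.
- exact: total_lsc.
- exact: total_decr.
- exact: total_growth.
Qed.

Definition flux_const : R := `|gam| * (1 + nl_energy_const) * total_energy 0.

Lemma flux_const_ge0 : 0 <= flux_const.
Proof.
by rewrite /flux_const !mulr_ge0 ?band_energy_ge0// addr_ge0// nl_energy_const_ge0.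
Qed.

Lemma band_flux_le (S : set R) (z : R) : measurable S -> 0 <= z ->
  `|band_flux S z| <= flux_const.
Proof.
move=> mS z0.
apply: (le_trans (le_normr_Rintegral _ (flux_density_int mS z0))) => //.
apply: le_trans (band_flux_norm_le mS ltr01 z0) _.
rewrite /flux_const -[leRHS]mulrA ler_wpM2l// invr1 !mul1r mulrDl mul1r.
have tz := total_energy_le z0.
apply: lerD; first exact: le_trans (band_energy_le_total mS z0) tz.
by rewrite ler_wpM2l// nl_energy_const_ge0.
Qed.

(** With [lambda = a1] the balance outside the band contains only the flux, integrated against
    [expR (a1 * z)], which yields the factor [1 / a1]. The exponential term accounts for input
    energy outside the band, which may be present at [z = 0]. *)
Lemma out_of_band_le (t : R) : 0 < a1 -> 0 < t ->
  band_energy (~` W) t <= expR (- a1 * t) * total_energy 0 + flux_const / a1.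
Proof.
move=> a1_gt0 t0; have mWC : measurable (~` W) by exact: measurableC.
have hE (z : R) : 0 <= z <= t -> total_energy z <= total_energy 0.
  by move=> /andP[z0 _]; exact: total_energy_le.
have [i e] := propagation_balance a1 mWC brickwall_out (lexx 0) t0 hE.
have ei := integrable_itvoo_expR 0 t a1.
have fi : mu.-integrable `]0, t[ (EFin \o (fun z => flux_const * expR (a1 * z))).
  exact: integrable_scale.
have : expR (a1 * t) * band_energy (~` W) t - expR (a1 * 0) * band_energy (~` W) 0 <=
    flux_const * ((expR (a1 * t) - 1) / a1).
  rewrite -e -Rintegral_itvoo_expR ?gt_eqF// -RintegralZl//.
  apply: le_Rintegral => // z; rewrite /= in_itv/= => /andP[z0 _].
  rewrite subrr mul0r add0r mulrC ler_wpM2r ?expR_ge0//.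
  exact: le_trans (ler_norm _) (band_flux_le mWC (ltW z0)).
rewrite mulr0 expR0 mul1r => h.
have e0 : 0 < expR (a1 * t) by exact: expR_gt0.
rewrite -(ler_pM2l e0) mulrDr mulrA -expRD mulNr subrr expR0 mul1r.
have b0 := band_energy_le_total mWC (lexx 0).
have fa : 0 <= flux_const / a1 by rewrite divr_ge0 ?flux_const_ge0// ltW.
move: h b0 fa; rewrite (_ : flux_const * ((expR (a1 * t) - 1) / a1) =
  expR (a1 * t) * (flux_const / a1) - flux_const / a1); last by ring.
have ar (x y z u v : R) : x - y <= u - v -> y <= z -> 0 <= v -> x <= z + u by lra.
exact: ar.
Qed.

(** The exchange is measured from outside the band, where little energy remains. Integrated over
    []0, t[], the out-of-band bound costs at most [total_energy 0 / a1 + flux_const / a1 * t]; the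
    weight [k] stays free, to be balanced against [a1]. *)
Lemma in_band_le (k t : R) : 0 < a1 -> 0 < k -> 0 < t ->
  `|expR (a0 * t) * band_energy W t - band_energy W 0| <=
  expR (a0 * t) * (`|gam| * (k * (total_energy 0 / a1 + flux_const / a1 * t) +
    k^-1 * (nl_energy_const * total_energy 0) * t)).
Proof.
move=> a1_gt0 k_gt0 t0; have mWC : measurable (~` W) by exact: measurableC.
have hE (z : R) : 0 <= z <= t -> total_energy z <= total_energy 0.
  by move=> /andP[z0 _]; exact: total_energy_le.
have [i e] := propagation_balance a0 mW brickwall_in (lexx 0) t0 hE.
have -> : band_energy W 0 = expR (a0 * 0) * band_energy W 0.
  by rewrite mulr0 expR0 mul1r.
rewrite -e.
apply: (le_trans (le_normr_Rintegral _ i)) => //.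
pose B1 := flux_const / a1; pose B2 := k^-1 * (nl_energy_const * total_energy 0).
pose G z := expR (a0 * t) * (`|gam| * (k * (total_energy 0 * expR (- a1 * z) + B1) + B2)).
have ei := integrable_itvoo_expR 0 t (- a1).
have ci B := integrable_itvoo_cst 0 t B.
have ei1 : mu.-integrable `]0, t[ (EFin \o (fun z => total_energy 0 * expR (- a1 * z))).
  exact: integrable_scale.
have ei2 : mu.-integrable `]0, t[ (EFin \o (fun z => total_energy 0 * expR (- a1 * z) + B1)).
  exact: integrable_add.
have ei3 : mu.-integrable `]0, t[ (EFin \o (fun z => k * (total_energy 0 * expR (- a1 * z) + B1))).
  exact: integrable_scale.
have ei4 : mu.-integrable `]0, t[ (EFin \o (fun z => k * (total_energy 0 * expR (- a1 * z) + B1) + B2)).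
  exact: integrable_add.
have ei5 : mu.-integrable `]0, t[ (EFin \o (fun z => `|gam| * (k * (total_energy 0 * expR (- a1 * z) + B1) + B2))).
  exact: integrable_scale.
have Gi : mu.-integrable `]0, t[ (EFin \o G) by exact: integrable_scale.
have mu0t : fine (mu `]0, t[%classic) = t.
  by rewrite lebesgue_measure_itv/= lte_fin t0 oppr0 addr0.
apply: (@le_trans _ _ (\int[mu]_(z in `]0, t[) G z)).
  apply: le_Rintegral => //; first exact: integrable_norm.
  move=> z; rewrite /= in_itv/= => /andP[z0 zt]; have z0' := ltW z0.
  rewrite subrr mul0r add0r normrM ger0_norm ?expR_ge0//.
  apply: ler_pM; rewrite ?expR_ge0//; first by rewrite ler_expR ler_wpM2l// ltW.
  have := band_flux_setC mW z0' => /eqP; rewrite addr_eq0 => /eqP ->; rewrite normrN.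
  apply: (le_trans (le_normr_Rintegral _ (flux_density_int mWC z0'))); first exact: mWC.
  apply: le_trans (band_flux_norm_le mWC k_gt0 z0') _.
  rewrite ler_wpM2l// lerD//.
    by rewrite ler_wpM2l ?(ltW k_gt0)// [total_energy 0 * _]mulrC out_of_band_le.
  rewrite ler_wpM2l ?invr_ge0 ?(ltW k_gt0)// ler_wpM2l ?nl_energy_const_ge0//.
  exact: total_energy_le.
rewrite /G RintegralZl// ler_wpM2l ?expR_ge0// RintegralZl// ler_wpM2l//.
rewrite RintegralD// RintegralZl// RintegralD// RintegralZl// !Rintegral_cst//.
have mu0t' : fine (mu `]0, t[) = t by exact: mu0t.
rewrite !mu0t' Rintegral_itvoo_expR// ?oppr_eq0 ?gt_eqF//.
rewrite lerD2r ler_wpM2l ?(ltW k_gt0)// lerD2r ler_wpM2l ?band_energy_ge0//.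
rewrite invrN mulrN -mulNr opprB ler_pdivrMr// mulVf ?gt_eqF//.
Qed.

End Propagation.

(** * The brick-wall limit *)

Section L2Limit.
Context {R : realType}.
Notation mu := (@lebesgue_measure R).
Notation Re := (@complex.Re R).
Notation Im := (@complex.Im R).

(** A triangle inequality whose leading coefficient can be brought arbitrarily close to 1; the usual
    factor 2 would not identify the limits of energies. *)
Lemma sqn_le_weighted (e : R) (a b : R[i]) : 0 < e ->
  sqn a <= (1 + e) * sqn b + (1 + e^-1) * sqn (a - b).
Proof.
move=> e0.
have key (x y : R) : x ^+ 2 <= (1 + e) * y ^+ 2 + (1 + e^-1) * (x - y) ^+ 2.
  rewrite -subr_ge0; have -> : (1 + e) * y ^+ 2 + (1 + e^-1) * (x - y) ^+ 2 - x ^+ 2 =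
    e^-1 * (e * y - (x - y)) ^+ 2 by field; rewrite gt_eqF.
  by rewrite mulr_ge0 ?sqr_ge0// invr_ge0 ltW.
have := lerD (key (Re a) (Re b)) (key (Im a) (Im b)).
rewrite /sqn ReB ImB => h; apply: (le_trans h).
by rewrite le_eqVlt; apply/orP; left; apply/eqP; ring.
Qed.

Lemma sqnB_sym (a b : R[i]) : sqn (a - b) = sqn (b - a).
Proof. by rewrite /sqn !ReB !ImB; ring. Qed.

Lemma L2_sub (f h : R -> R[i]) : L2 f -> L2 h ->
  mu.-integrable setT (EFin \o (fun w => sqn (f w - h w))).
Proof.
move=> Lf Lh; have [f1 f2] := L2_sqint Lf; have [h1 h2] := L2_sqint Lh.
rewrite (_ : (fun w => _) = (fun w => (Re (f w) - Re (h w)) ^+ 2 + (Im (f w) - Im (h w)) ^+ 2)).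
  by apply: integrable_add => //; [exact: (sqint_sub f1 h1).2|exact: (sqint_sub f2 h2).2].
by apply/funext => w; rewrite /sqn ReB ImB.
Qed.

Lemma L2_integrable (f : R -> R[i]) (S : set R) : measurable S -> L2 f ->
  mu.-integrable S (EFin \o (fun w => sqn (f w))).
Proof. by move=> mS [_ [_ i]]; apply: integrableS i. Qed.

Lemma Rintegral_sqn_le (e : R) (f h : R -> R[i]) (S : set R) : 0 < e ->
  measurable S -> L2 f -> L2 h ->
  \int[mu]_(w in S) sqn (f w) <= (1 + e) * \int[mu]_(w in S) sqn (h w) +
    (1 + e^-1) * \int[mu]_w sqn (f w - h w).
Proof.
move=> e0 mS Lf Lh; have dT := L2_sub Lf Lh.
have dS : mu.-integrable S (EFin \o (fun w => sqn (f w - h w))) by apply: integrableS dT.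
have fS := L2_integrable mS Lf; have hS := L2_integrable mS Lh.
have e1 : 0 <= 1 + e^-1 by rewrite addr_ge0// invr_ge0 ltW.
apply: (@le_trans _ _ (\int[mu]_(w in S) ((1 + e) * sqn (h w) + (1 + e^-1) * sqn (f w - h w)))).
  apply: le_Rintegral => //.
    by apply: integrable_add => //; exact: integrable_scale.
  by move=> w _; exact: sqn_le_weighted.
rewrite RintegralD//; [|exact: integrable_scale|exact: integrable_scale].
rewrite !RintegralZl// lerD2l ler_wpM2l//.
by apply: Rintegral_subset_le => // w; exact: sqn_ge0.
Qed.

(** The weighted inequality is used in both directions: the limit in [n] removes the distance term,
    and [e] is then arbitrarily small. *)
Lemma L2_limit_energy (f : nat -> R -> R[i]) (h : R -> R[i]) (S : set R) (l : R) :
  measurable S -> (forall n, L2 (f n)) -> L2 h ->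
  \int[mu]_w sqn (f n w - h w) @[n --> \oo] --> 0 ->
  \int[mu]_(w in S) sqn (f n w) @[n --> \oo] --> l ->
  \int[mu]_(w in S) sqn (h w) = l.
Proof.
move=> mS Lf Lh d0 fl; set x := \int[mu]_(w in S) sqn (h w).
have x0 : 0 <= x by apply: Rintegral_ge0 => w _; exact: sqn_ge0.
have lim0 (a b : R) (u : nat -> R) (ul : R) : u n @[n --> \oo] --> ul ->
    a * u n + b * \int[mu]_w sqn (f n w - h w) @[n --> \oo] --> a * ul.
  move=> cu; rewrite -[a * ul]addr0 -(mulr0 b).
  by apply: cvgD; apply: cvgM => //; exact: cvg_cst.
have l0 : 0 <= l.
  rewrite -(cvg_lim _ fl)//; apply: limr_ge; first by apply/cvg_ex; exists l.
  by apply: nearW => n; apply: Rintegral_ge0 => w _; exact: sqn_ge0.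
have le1 e : 0 < e -> x <= (1 + e) * l.
  move=> e0; have c := lim0 (1 + e) (1 + e^-1) _ _ fl.
  rewrite -(cvg_lim _ c)//; apply: limr_ge; first by apply/cvg_ex; eexists; exact: c.
  apply: nearW => n.
  have -> : \int[mu]_w sqn (f n w - h w) = \int[mu]_w sqn (h w - f n w).
    by apply: eq_Rintegral => w _; exact: sqnB_sym.
  exact: Rintegral_sqn_le.
have le2 e : 0 < e -> l <= (1 + e) * x.
  move=> e0; have cx : x @[_ --> \oo] --> x by exact: cvg_cst.
  have c := lim0 (1 + e) (1 + e^-1) _ _ cx.
  rewrite -(cvg_lim _ fl)// -(cvg_lim _ c)//; apply: ler_lim.
  - by apply/cvg_ex; exists l.
  - by apply/cvg_ex; eexists; exact: c.
  - by apply: nearW => n; exact: Rintegral_sqn_le.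
have small (a b : R) : 0 <= b -> (forall e, 0 < e -> a <= (1 + e) * b) -> a <= b.
  move=> b0 h'; apply/ler_addgt0Pr => e e0.
  have b1 : 0 < b + 1 by rewrite ltr_wpDl.
  apply: le_trans (h' (e / (b + 1)) _) _; first by rewrite divr_gt0.
  rewrite mulrDl mul1r lerD2l -mulrA ler_piMr ?(ltW e0)//.
  by rewrite mulrC ler_pdivrMr// mul1r lerDl.
apply/eqP; rewrite eq_le; apply/andP; split.
  exact: (small _ _ l0 le1).
exact: (small _ _ x0 le2).
Qed.

Lemma measurable_window (N : nat) (wbar Wd : 'I_N -> R) : measurable (window wbar Wd).
Proof.
rewrite /window; apply: fin_bigcup_measurable; first exact: finite_finset.
move=> n _; rewrite (_ : [set w | _] = `[wbar n - Wd n / 2, wbar n + Wd n / 2]%classic).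
  exact: measurable_itv.
by apply/seteqP; split => w /=; rewrite in_itv/= ler_distl.
Qed.

Lemma energyE (f : R -> R[i]) (S : set R) : measurable S -> L2 f ->
  energy f S = ((2 * pi)^-1 * \int[mu]_(w in S) sqn (f w))%:E.
Proof.
by move=> mS Lf; rewrite /energy EFinM integrable_fineK//; exact: L2_integrable.
Qed.

Lemma cvg_of_bound (u : nat -> R) (l K : R) :
  (forall n, `|u n - l| <= K / n.+1%:R) -> u n @[n --> \oo] --> l.
Proof.
move=> h; apply/subr_cvg0; apply: norm_cvg0.
apply: (@squeeze_cvgr _ _ _ _ (fun=> 0) (fun n => K / n.+1%:R)).
- by apply: nearW => n; rewrite normr_ge0 h.
- exact: cvg_cst.
- by rewrite -(mulr0 K); apply: cvgM; [exact: cvg_cst|exact: cvg_harmonic].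
Qed.

End L2Limit.

Lemma expRN_le_inv (R : realType) (x : R) : 0 < x -> expR (- x) <= x^-1.
Proof.
move=> x0; rewrite expRN lef_pV2 ?posrE ?expR_gt0//.
by apply: le_trans (expR_ge1Dx x); rewrite lerDr.
Qed.

(** The limit [a1 -> +oo] is read along the attenuations chosen in the theorem and brought from the
    extended reals to the reals. *)
Lemma L2dist2_sq_cvg (R : realType) (Qa : R -> R -> R[i]) (Q : R -> R[i]) (n0 : nat) :
  (forall n, L2 (Qa ((n + n0).+1%:R ^+ 2))) -> L2 Q ->
  (L2dist2 (Qa a1) Q @[a1 --> +oo%R] --> 0%E) ->
  \int[@lebesgue_measure R]_w sqn (Qa ((n + n0).+1%:R ^+ 2) w - Q w) @[n --> \oo] --> 0.
Proof.
move=> La LQ cv.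
have ay : ((n + n0).+1%:R ^+ 2 : R) @[n --> \oo] --> +oo.
  apply/cvgryPge => B; near=> n.
  have nB : B <= n%:R by near: n; exact: nbhs_infty_ger.
  have n1 : 1 <= (n + n0).+1%:R :> R by rewrite ler1n.
  apply: (le_trans nB); apply: (@le_trans _ _ (n + n0).+1%:R).
    by rewrite ler_nat (leq_trans (leq_addr n0 n)).
  by rewrite expr2 ler_peMl// (le_trans ler01).
have c := cvg_comp (fun n : nat => (n + n0).+1%:R ^+ 2 : R) (fun a1 => L2dist2 (Qa a1) Q) ay cv.
apply: (@fine_cvg _ _ _ _ (fun n => L2dist2 (Qa ((n + n0).+1%:R ^+ 2)) Q) 0%R).
exact: c.
Unshelve. all: by end_near. Qed.

(* Qa a1 z w : spectrum of the propagation with finite out-of-band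
   attenuation a1 (defined for all a1 >= A);  qa a1 z t : its time signal;
   Q z w : the brick-wall propagation, i.e. the limit a1 -> +oo. *)
Theorem theorem1 (R : realType) (N : nat) (wbar Wd : 'I_N -> R)
    (a0 b2 g A qmax : R)
    (Qa qa : R -> R -> R -> R[i]) (Q : R -> R -> R[i]) :
  (forall n m : 'I_N, n != m ->
     [set w | `|w - wbar n| <= Wd n / 2] `&` [set w | `|w - wbar m| <= Wd m / 2]
     = set0) ->
  0 <= a0 ->
  (* common initial condition *)
  (forall a1, A <= a1 -> Qa a1 0 = Q 0) ->
  (* L^2 spectra, Fourier transforms of signals bounded by qmax *)
  (forall a1 z, A <= a1 -> 0 <= z -> L2 (Qa a1 z)) ->
  (forall a1 z, A <= a1 -> 0 <= z -> is_FT (qa a1 z) (Qa a1 z)) ->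
  (forall a1 z t, A <= a1 -> 0 <= z -> cabs (qa a1 z t) <= qmax) ->
  (* propagation equation with alpha = a0 on W, a1 off W *)
  (* right-continuity at z = 0 (differentiability below covers z > 0) *)
  (forall a1 w, A <= a1 ->
     (complex.Re (Qa a1 z w) @[z --> (0:R)^'+] --> complex.Re (Qa a1 0 w)) /\
     (complex.Im (Qa a1 z w) @[z --> (0:R)^'+] --> complex.Im (Qa a1 0 w))) ->
  (forall a1 z w, A <= a1 -> 0 < z -> nl_defined (Qa a1 z) w) ->
  (forall a1 z w, A <= a1 -> 0 < z ->
     cderive (fun s => Qa a1 s w) z
       (nlse_rhs (brickwall (window wbar Wd) a0 a1) b2 g (Qa a1 z) w)) ->
  (* brick-wall propagation = limit a1 -> +oo (in L^2, for each z > 0) *)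
  (forall z : R, 0 < z -> L2 (Q z) /\
     (L2dist2 (Qa a1 z) (Q z) @[a1 --> +oo%R] --> 0%E)) ->
  forall z : R, 0 < z ->
    energy (Q z) (~` window wbar Wd) = 0%E /\
    energy (Q z) setT = (energy (Q 0%R) (window wbar Wd) * (expR (- a0 * z)%R)%:E)%E.
Proof.
move=> _ a00 init HL2 HFT Hq Hc0 _ Hd Hlim z z0.
have mW := measurable_window wbar Wd; set W := window wbar Wd in mW Hd *.
have mWC : measurable (~` W) by exact: measurableC.
pose mu := @lebesgue_measure R.
(* Shifting the index by [n0] makes every attenuation [k m ^+ 2] at least [A] and at least [a0]. *)
pose n0 := (Num.truncn (`|A| + a0)).+1.
(* [k m] is the weight in Young's inequality and [k m ^+ 2] the attenuation [a1], so that [k / a1]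
   and [1 / k] agree. *)
pose k (m : nat) : R := (m + n0).+1%:R.
have k1 m : 1 <= k m by rewrite ler1n.
have k0 m : 0 < k m by exact: lt_le_trans (k1 m).
have kn0 m : k m != 0 by rewrite gt_eqF.
have km m : m.+1%:R <= k m by rewrite ler_nat ltnS leq_addr.
have kle m : `|A| + a0 <= k m ^+ 2.
  apply: (@le_trans _ _ (k m)); last by rewrite expr2 ler_peMl// ltW.
  apply: (@le_trans _ _ n0%:R); first exact: ltW (truncnS_gt _).
  by rewrite ler_nat (leq_trans (leq_addl m n0)).
have kA m : A <= k m ^+ 2.
  by apply: le_trans (ler_norm A) (le_trans _ (kle m)); rewrite lerDl.
have ka m : a0 <= k m ^+ 2 by apply: le_trans (kle m); rewrite lerDr.
have k20 m : 0 < k m ^+ 2 by rewrite exprn_gt0.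
pose Qn m := Qa (k m ^+ 2).
have L0 : L2 (Q 0) by rewrite -(init _ (kA 0%N)); apply: HL2.
have [LQ Qlim] := Hlim z z0.
have Ln m : L2 (Qn m z) by apply: HL2 => //; exact: ltW.
pose T0 := \int[mu]_w sqn (Q 0 w).
pose F := `|g / (4 * pi ^+ 2)| * (1 + nl_energy_const qmax) * T0.
have T0E m : total_energy (Qn m) 0 = T0.
  by rewrite /total_energy /band_energy /Qn init.
have FE m : flux_const g qmax (Qn m) = F by rewrite /flux_const T0E.
have W0E m : band_energy (Qn m) W 0 = \int[mu]_(w in W) sqn (Q 0 w).
  by rewrite /band_energy /Qn init.
have T00 : 0 <= T0 by apply: Rintegral_ge0 => w _; exact: sqn_ge0.
have F0 : 0 <= F by rewrite -(FE 0%N); exact: flux_const_ge0.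
have outb m := out_of_band_le mW (fun z => HL2 _ z (kA m)) (fun z => HFT _ z (kA m))
  (fun z t => Hq _ z t (kA m)) (fun w => Hc0 _ w (kA m))
  (fun z w => Hd _ z w (kA m)) a00 (ka m) (k20 m) z0.
have inb m := in_band_le mW (fun z => HL2 _ z (kA m)) (fun z => HFT _ z (kA m))
  (fun z t => Hq _ z t (kA m)) (fun w => Hc0 _ w (kA m))
  (fun z w => Hd _ z w (kA m)) a00 (ka m) (k20 m) (k0 m) z0.
have dcv : \int[mu]_w sqn (Qn n z w - Q z w) @[n --> \oo] --> 0.
  exact: (@L2dist2_sq_cvg _ (fun a1 => Qa a1 z) (Q z) n0).
have div_le (K : R) m : 0 <= K -> K / k m <= K / m.+1%:R.
  by move=> K0; rewrite ler_wpM2l// lef_pV2 ?posrE.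
have out_cv : \int[mu]_(w in ~` W) sqn (Qn n z w) @[n --> \oo] --> 0.
  apply: (@cvg_of_bound _ _ _ (z^-1 * T0 + F)) => m; rewrite subr0 ger0_norm; last first.
    by apply: Rintegral_ge0 => w _; exact: sqn_ge0.
  have K0 : 0 <= z^-1 * T0 + F by rewrite addr_ge0// mulr_ge0// invr_ge0 ltW.
  apply: le_trans (outb m) _; apply: le_trans (div_le _ m K0).
  rewrite T0E FE.
  (* A polynomial rate is enough here, at the price of a constant depending on [z > 0]. *)
  have e1 : expR (- k m ^+ 2 * z) <= z^-1 / k m ^+ 2.
    rewrite mulNr -invfM [z * _]mulrC; apply: expRN_le_inv.
    by rewrite mulr_gt0.
  apply: (@le_trans _ _ ((z^-1 * T0 + F) / k m ^+ 2)).
    by rewrite mulrDl lerD2r mulrAC ler_wpM2r.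
  rewrite ler_wpM2l// lef_pV2 ?posrE// expr2 ler_peMl// ltW.
have in_cv : \int[mu]_(w in W) sqn (Qn n z w) @[n --> \oo] -->
    expR (- a0 * z) * \int[mu]_(w in W) sqn (Q 0 w).
  (* With [a1 = k m ^+ 2], the right-hand side of [in_band_le] is exactly
     [expR (a0 * z) * (G / k m)]. *)
  pose G := `|g / (4 * pi ^+ 2)| * ((T0 + F * z) + nl_energy_const qmax * T0 * z).
  have G0 : 0 <= G.
    rewrite /G mulr_ge0// addr_ge0//; first by rewrite addr_ge0// mulr_ge0// ltW.
    apply: mulr_ge0; last exact: ltW.
    by apply: mulr_ge0 => //; exact: nl_energy_const_ge0.
  apply: (@cvg_of_bound _ _ _ G) => m; apply: le_trans (div_le _ m G0).
  have e0 : 0 < expR (a0 * z) by exact: expR_gt0.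
  rewrite -(ler_pM2l e0) -{1}(gtr0_norm e0) -normrM mulrBr mulrA -expRD mulNr subrr.
  rewrite expR0 mul1r; have := inb m; rewrite T0E FE W0E => h; apply: (le_trans h).
  rewrite le_eqVlt; apply/orP; left; apply/eqP; congr (_ * _); rewrite /G.
  by field.
have outE := L2_limit_energy mWC Ln LQ dcv out_cv.
have inE := L2_limit_energy mW Ln LQ dcv in_cv.
rewrite (energyE mWC LQ) (energyE measurableT LQ) (energyE mW L0) outE mulr0; split => //.
have -> : \int[mu]_w sqn (Q z w) =
    \int[mu]_(w in W) sqn (Q z w) + \int[mu]_(w in ~` W) sqn (Q z w).
  rewrite -Rintegral_setU ?setUv//; first exact: L2_integrable.
  exact/disj_setPCl.
by rewrite outE inE addr0 -EFinM; congr (_%:E); ring.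
Qed.
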